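(* Let $G=\mathbb R_+^2$ and let the SP $\{(d_i,e_i,0),i=1,2\}$ satisfy the set-$B$ condition and the projection condition. Let $x\in G$, $b\in\mathbb R^2$ and $\sigma\in\mathbb R^{2\times2}$ be such that $\sigma\sigma'$ is a nondegenerate covariance matrix, and set $R=(d_1\ d_2)$. Let $X_t=x+bt+\sigma W_t$, $t\ge0$, and let $Z=\Gamma(X)$ be the reflected Brownian motion associated with $(x,b,\sigma,R)$. Then $\mathbb P$-almost surely $(Z,Z-X)$ satisfies the boundary jitter property on $[0,\infty)$.
   Context: $W$ is a two-dimensional standard Brownian motion on a filtered probability space $(\Omega,\mathcal F,\{\mathcal F_t\},\mathbb P)$ satisfying the usual conditions. $e_1,e_2$ is the standard basis of $\mathbb R^2$; $'$ denotes transpose; $d_1,d_2\in\mathbb R^2$ with $\langle d_i,e_i\rangle=1$. $\mathrm{cone}(A)$ is the set of finite nonnegative linear combinations of elements of $A$, $\mathrm{cone}(\emptyset)=\{0\}$. $F_i=\{x\in\partial G:\langle x,e_i\rangle=0\}$, $\mathcal I(x)=\{i\in\{1,2\}:x\in F_i\}$ for $x\in G$, $d(x)=\mathrm{cone}(\{d_i:i\in\mathcal I(x)\})$ for $x\in\partial G$, $d(x)=\{0\}$ for $x\in G^\circ$; $\mathcal S=\{x\in\partial G:|\mathcal I(x)|=1\}$, $\mathcal N=\partial G\setminus\mathcal S=\{0\}$. SP: continuous functions $(Z,Y)$ on $[0,\infty)$ with values in $\mathbb R^2$ solve the SP for a continuous $X$ if $Y(0)\in d(Z(0))$ and for all $t\ge0$: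 $Z(t)=X(t)+Y(t)$; $Z(t)\in G$; $Y(t)-Y(s)\in\mathrm{cone}[\cup_{u\in(s,t]}d(Z(u))]$ for all $s\in[0,t)$. Set-$B$ condition: there exist $\delta>0$ and a compact, convex, symmetric set $B\subset\mathbb R^2$ with $0\in B^\circ$ such that for $i=1,2$: if $z\in\partial B$ and $|\langle z,e_i\rangle|<\delta$ then $\langle\nu,d_i\rangle=0$ for all unit vectors $\nu$ with $\langle\nu,y-z\rangle\ge0$ for all $y\in B$. Projection condition: there is $\pi:\mathbb R^2\to G$ with $\pi(x)=x$ for $x\in G$ and $\pi(x)-x\in d(\pi(x))$ for $x\notin G$. Under these conditions the SP has a unique solution for every continuous $X$, and $\Gamma(X):=Z$ is the Skorokhod map (applied pathwise). Boundary jitter property of $(Z,Y)$ on $[0,\infty)$: (1) if $t\ge0$ and $Z(t)\in\mathcal S$, then for all $s<t<u$, $Y$ is nonconstant on $(s\vee0,u)$; (2) $\int_0^\infty1_{\mathcal N}(Z(t))\,dt=0$; (3) if $Z(0)\in\mathcal N$, then for each $i\in\mathcal I(Z(0))$ and $\delta>0$ there is $u\in(0,\delta)$ with $\mathcal I(Z(u))=\{i\}$; (4) if $t>0$ and $Z(t)\in\mathcal N$, then for each $i\in\mathcal I(Z(t))$ and $\delta\in(0,t)$ there is $s\in(t-\delta,t)$ with $\mathcal I(Z(s))=\{i\}$. *)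

(* Defs.v *)
From HB Require Import structures.
From mathcomp Require Export all_boot all_order all_algebra.
From mathcomp Require Export all_classical all_reals all_analysis.

Set Implicit Arguments.
Unset Strict Implicit.
Unset Printing Implicit Defensive.

Import Order.TTheory GRing.Theory Num.Theory.
Import numFieldNormedType.Exports.

Local Open Scope classical_set_scope.
Local Open Scope ring_scope.

Section Quadrant.
Context {R : realType}.
Implicit Types (x y z : 'cV[R]_2) (A B : set 'cV[R]_2).

Definition dotv x y : R := \sum_(k < 2) x k 0 * y k 0.

Definition basisv (i : 'I_2) : 'cV[R]_2 := delta_mx i 0.

Definition boundary A : set 'cV[R]_2 := closure A `\` interior A.

(* The empty combination n = 0 gives cone set0 = [set 0]. *)
Definition cone A : set 'cV[R]_2 :=
  [set y | exists (n : nat) (a : 'I_n -> R) (v : 'I_n -> 'cV[R]_2),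
     [/\ forall k, 0 <= a k, forall k, A (v k) & y = \sum_(k < n) a k *: v k]].

Definition quadrant : set 'cV[R]_2 := [set x | forall i, 0 <= x i 0].

Definition face (i : 'I_2) : set 'cV[R]_2 :=
  [set x | boundary quadrant x /\ dotv x (basisv i) = 0].

Definition active x : set 'I_2 := [set i | face i x].

(* On the interior of the quadrant [active x] is empty, so the cone is {0}. *)
Definition refl_cone (d : 'I_2 -> 'cV[R]_2) x : set 'cV[R]_2 :=
  cone [set d i | i in active x].

Definition smooth_bdry : set 'cV[R]_2 :=
  [set x | boundary quadrant x /\ exists i, active x = [set i]].

Definition nonsmooth_bdry : set 'cV[R]_2 := boundary quadrant `\` smooth_bdry.

Definition set_B_condition (d : 'I_2 -> 'cV[R]_2) : Prop :=
  exists (delta : R) (B : set 'cV[R]_2),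
    [/\ 0 < delta,
        [/\ compact B,
            convex_set B,
            forall x, B x -> B (- x)
          & interior B 0]
      & forall (i : 'I_2) z, boundary B z -> `|dotv z (basisv i)| < delta ->
          forall nu : 'cV[R]_2, dotv nu nu = 1 ->
            (forall y, B y -> 0 <= dotv nu (y - z)) ->
            dotv nu (d i) = 0].

Definition projection_condition (d : 'I_2 -> 'cV[R]_2) : Prop :=
  exists pi : 'cV[R]_2 -> 'cV[R]_2,
    [/\ forall x, quadrant (pi x),
        forall x, quadrant x -> pi x = x
      & forall x, ~ quadrant x -> refl_cone d (pi x) (pi x - x)].

(* Paths are total functions on R of which only the restriction to [0, +oo[
   is ever used. *)
Definition continuous_path (f : R -> 'cV[R]_2) : Prop :=
  {within `[0, +oo[, continuous f}.

Definition solves_SP (d : 'I_2 -> 'cV[R]_2) (X Z Y : R -> 'cV[R]_2) : Prop :=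
  [/\ [/\ continuous_path X, continuous_path Z & continuous_path Y],
      refl_cone d (Z 0) (Y 0)
    & forall t : R, 0 <= t ->
      [/\ Z t = X t + Y t,
          quadrant (Z t)
        & forall s : R, 0 <= s < t ->
            cone (\bigcup_(u in `]s, t]) refl_cone d (Z u)) (Y t - Y s)]].

(* The graph of the Skorokhod map: Z = Gamma X on [0, +oo[. *)
Definition skorokhod_map (d : 'I_2 -> 'cV[R]_2) (X Z : R -> 'cV[R]_2) : Prop :=
  solves_SP d X Z (Z \- X).

Definition boundary_jitter (Z Y : R -> 'cV[R]_2) : Prop :=
  [/\ forall t : R, 0 <= t -> smooth_bdry (Z t) ->
        forall s u : R, s < t < u ->
          ~ exists c, forall r : R, Num.max s 0 < r < u -> Y r = c,
      (\int[lebesgue_measure]_(t in `[0%R : R, +oo[)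
         (\1_nonsmooth_bdry (Z t))%:E = 0)%E,
      nonsmooth_bdry (Z 0) ->
        forall i : 'I_2, active (Z 0) i -> forall delta : R, 0 < delta ->
          exists2 u : R, 0 < u < delta & active (Z u) = [set i]
    & forall t : R, 0 < t -> nonsmooth_bdry (Z t) ->
        forall i : 'I_2, active (Z t) i -> forall delta : R, 0 < delta < t ->
          exists2 s : R, t - delta < s < t & active (Z s) = [set i]].

End Quadrant.

Section Brownian.
Context {d : measure_display} {T : measurableType d} {R : realType}.
Variable P : probability T R.

(* A filtration (F t), t >= 0, satisfying the usual conditions.  The last
   clause also makes P complete, as F 0 consists of measurable sets. *)
Definition usual_filtration (F : R -> set (set T)) : Prop :=
  [/\ forall t, 0 <= t -> sigma_algebra [set: T] (F t) /\ F t `<=` measurable,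
      forall s t, 0 <= s <= t -> F s `<=` F t,
      forall t, 0 <= t -> F t = \bigcap_(s in `]t, +oo[) F s
    & forall N, P.-negligible N -> F 0 N].

Definition coord_pair (v : 'cV[R]_2) : R * R := (v 0 0, v 1 0).

(* Borel sets of the plane are taken in R * R, via [coord_pair]. *)
Definition brownian_motion (F : R -> set (set T)) (W : R -> T -> 'cV[R]_2)
    : Prop :=
  [/\ forall t (B : set (R * R)), 0 <= t -> measurable B ->
        F t [set w | B (coord_pair (W t w))],
      {ae P, forall w, W 0 w = 0},
      {ae P, forall w, continuous_path (W^~ w)},
      forall s t (A : set T) (B : set (R * R)), 0 <= s < t ->
        F s A -> measurable B ->
        P (A `&` [set w | B (coord_pair (W t w - W s w))]) =
        (P A * P [set w | B (coord_pair (W t w - W s w))])%E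
    & forall s t (B : set (R * R)), 0 <= s < t -> measurable B ->
        P [set w | B (coord_pair (W t w - W s w))] =
        (normal_prob 0 (Num.sqrt (t - s)) \x
         normal_prob 0 (Num.sqrt (t - s)))%E B].

End Brownian.

(* Main.v *)
(* Write d_1 = (1, a) and d_2 = (c, 1).  The set-B and projection conditions
   force |a c| < 1, or a c = 1 with a, c > 0.  Hence the Skorokhod map is
   Lipschitz for the uniform norm on [0, t], so that every event which is open
   for that norm in terms of (X, Z) on [0, t] belongs to F_t, and some v with
   positive coordinates satisfies <v, d_i> >= 0.  The stochastic input is then
   reduced to independent Gaussian increments, used at deterministic times or at
   first grid times.

   (2) When Z t = 0, the process <v, X> attains at t its minimum over [0, t];
   for fixed t this has probability zero, and Fubini's theorem concludes.
   (1) If Y were constant around t, then Z - X would be too, and a coordinate of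
   X would touch a level without crossing it; but right after the first
   grid time close to that level X descends through it at one of many scales.
   (3)-(4) The corner can be neither reached nor left without touching face i.
   At each scale r, with a conditional probability bounded below, X follows for a
   time of order r^2 a tube that drives Z onto face i before |Z| becomes much
   smaller than r; the scales 16^-k give infinitely many such chances.  So
   between a time off the corner, which exists by (2), and the next visit of the
   corner, face i is touched. *)
Require Import Defs.
From mathcomp Require Import measurable_realfun ring lra.

Set Implicit Arguments.
Unset Strict Implicit.
Unset Printing Implicit Defensive.

Import Order.TTheory GRing.Theory Num.Theory.
Import numFieldNormedType.Exports.

Local Open Scope classical_set_scope.
Local Open Scope ring_scope.

(** * Paths on the half-line *)

(** The obstacle is measurability. [Z] is only known path by path, almost surely, and the Brownian
    hypothesis speaks of increments after deterministic times. So a random time is rounded to a grid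
    of mesh 1 / (m + 1), the event is split according to the grid point, and the conditional bounds
    are summed. How fine the grid must be depends on the path; therefore the exceptional event is
    only shown to lie in the m-th approximating event from some path-dependent rank on, and the
    bounds on these events are uniform in m.

    Two kinds of estimates are needed. Right after a single time, a descent must occur with
    probability close to 1, whence many scales inside one attempt. At the corner, an attempt that
    succeeds with probability bounded below is enough, because it can be repeated at infinitely many
    scales.

    When a c = 1 the directions are parallel and the shares of the two faces in the pushing cannot
    be separated; one scalar regulator then replaces the two coupled ones. *)

Section HalfLinePaths.
Context {R : realType}.
Implicit Types f g : R -> R.

(** Continuity on the half-line spelled out with radii, ready for linear arithmetic; values at
    negative times never enter. *)
Definition path_continuous f := forall t : R, 0 <= t -> forall e : R, 0 < e ->
  exists2 del : R, 0 < del &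
    forall u : R, 0 <= u -> `|u - t| < del -> `|f u - f t| < e.

Lemma path_continuous_within f :
  {within `[0, +oo[, continuous f} -> path_continuous f.
Proof.
move=> /subspace_continuousP cf t t0 e e0.
have t0' : `[0, +oo[%classic t by rewrite /= in_itv/= t0.
have /cvgrPdist_lt/(_ _ e0) := cf t t0'.
rewrite near_withinE => /nbhs_ballP[del/= del0 h].
exists del => // u u0 ut; rewrite distrC; apply: h.
  by rewrite /ball/= distrC.
by rewrite /= in_itv/= u0.
Qed.

Lemma path_continuousB f g :
  path_continuous f -> path_continuous g -> path_continuous (fun t => f t - g t).
Proof.
move=> cf cg t t0 e e0.
have e20 : 0 < e / 2 by lra.
have [d1 d10 h1] := cf t t0 _ e20; have [d2 d20 h2] := cg t t0 _ e20.
exists (Num.min d1 d2) => [|u u0]; first by rewrite lt_min d10.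
rewrite lt_min => /andP[/h1-/(_ u0) ? /h2-/(_ u0) ?].
rewrite (_ : _ - _ = (f u - f t) - (g u - g t)); last by ring.
by rewrite (le_lt_trans (ler_normB _ _))//; lra.
Qed.

Lemma path_continuousZ (a : R) f :
  path_continuous f -> path_continuous (fun t => a * f t).
Proof.
move=> cf t t0 e e0.
have a0 : 0 < `|a| + 1 by rewrite ltr_wpDl.
have [del del0 h] := cf t t0 _ (divr_gt0 e0 a0).
exists del => // u u0 /h-/(_ u0); rewrite ltr_pdivlMr// => hu.
rewrite -mulrBr normrM (le_lt_trans _ hu)// mulrC ler_wpM2l//; lra.
Qed.

Lemma path_continuousD f g :
  path_continuous f -> path_continuous g -> path_continuous (fun t => f t + g t).
Proof.
move=> cf cg; have := path_continuousB cf (path_continuousZ (-1) cg).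
by congr path_continuous; apply/funext => t; rewrite mulN1r opprK.
Qed.

Lemma path_continuous_cst (c : R) : path_continuous (fun=> c).
Proof. by move=> t t0 e e0; exists 1 => // u _ _; rewrite subrr normr0. Qed.

Lemma path_continuous_min f g : path_continuous f -> path_continuous g ->
  path_continuous (fun t => Num.min (f t) (g t)).
Proof.
move=> cf cg t t0 e e0.
have [d1 d10 h1] := cf t t0 _ e0; have [d2 d20 h2] := cg t t0 _ e0.
exists (Num.min d1 d2) => [|u u0]; first by rewrite lt_min d10.
rewrite lt_min => /andP[/h1-/(_ u0) + /h2-/(_ u0)].
rewrite /Num.min !ltr_norml.
by move=> ? ?; case: (ltP (f u) (g u)) => ?; case: (ltP (f t) (g t)) => ?; lra.
Qed.

Lemma path_continuous_gt f (t c : R) : path_continuous f -> 0 <= t -> c < f t ->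
  exists2 del : R, 0 < del & forall u : R, 0 <= u -> `|u - t| < del -> c < f u.
Proof.
move=> cf t0 ct; have ct0 : 0 < f t - c by lra.
have [del del0 h] := cf _ t0 _ ct0.
by exists del => // u u0 /h-/(_ u0); rewrite ltr_norml => /andP[? ?]; lra.
Qed.

Lemma path_continuous_lt f (t c : R) : path_continuous f -> 0 <= t -> f t < c ->
  exists2 del : R, 0 < del & forall u : R, 0 <= u -> `|u - t| < del -> f u < c.
Proof.
move=> cf t0 ct; have ct0 : 0 < c - f t by lra.
have [del del0 h] := cf _ t0 _ ct0.
by exists del => // u u0 /h-/(_ u0); rewrite ltr_norml => /andP[? ?]; lra.
Qed.

Lemma last_zero f (a b : R) : path_continuous f -> 0 <= a ->
  (exists2 u : R, a <= u <= b & f u = 0) ->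
  exists2 u : R, a <= u <= b /\ f u = 0 & forall v : R, u < v <= b -> f v != 0.
Proof.
move=> cf a0 [u0 /andP[au0 u0b] fu0].
pose E := [set u : R | a <= u <= b /\ f u = 0].
have E0 : E !=set0 by exists u0; rewrite /E/= au0.
have ubE : ubound E b by move=> u [/andP[]].
have hsE : has_sup E by split => //; exists b.
have supb : sup E <= b by apply: ge_sup.
have u0sup : u0 <= sup E by apply: ub_le_sup; [exists b|rewrite /E/= au0].
exists (sup E).
  split; first by rewrite supb (le_trans au0).
  apply/eqP/negP => /negP fs.
  have fs0 : 0 < `|f (sup E)| by rewrite normr_gt0.
  have s0 : 0 <= sup E by lra.
  have [del del0 h] := cf _ s0 _ fs0.
  have [v [/andP[av vb] fv] vs] := sup_adherent del0 hsE.
  have vle : v <= sup E by apply: ub_le_sup; [exists b|split; rewrite ?av].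
  have : `|f v - f (sup E)| < `|f (sup E)|.
    by apply: h; rewrite ?ltr_norml; lra.
  by rewrite fv sub0r normrN ltxx.
move=> v /andP[sv vb]; apply/eqP => fv.
suff : v <= sup E by lra.
by apply: ub_le_sup; [exists b|split => //; lra].
Qed.

Lemma first_zero f (a b : R) : path_continuous f -> 0 <= a ->
  (exists2 u : R, a <= u <= b & f u = 0) ->
  exists2 u : R, a <= u <= b /\ f u = 0 & forall v : R, a <= v < u -> f v != 0.
Proof.
move=> cf a0 [u0 /andP[au0 u0b] fu0].
pose E := [set u : R | a <= u <= b /\ f u = 0].
have E0 : E !=set0 by exists u0; rewrite /E/= au0.
have lbE : lbound E a by move=> u [/andP[]].
have hlE : has_lbound E by exists a.
have hiE : has_inf E by [].
have ainf : a <= inf E by apply: lb_le_inf.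
have infb : inf E <= u0 by apply: ge_inf => //; rewrite /E/= au0.
exists (inf E).
  split; first by rewrite ainf (le_trans infb).
  apply/eqP/negP => /negP fs.
  have fs0 : 0 < `|f (inf E)| by rewrite normr_gt0.
  have s0 : 0 <= inf E by lra.
  have [del del0 h] := cf _ s0 _ fs0.
  have [v [/andP[av vb] fv] vs] := inf_adherent del0 hiE.
  have vle : inf E <= v by apply: ge_inf => //; split; rewrite ?av.
  have : `|f v - f (inf E)| < `|f (inf E)|.
    by apply: h; rewrite ?ltr_norml; lra.
  by rewrite fv sub0r normrN ltxx.
move=> v /andP[av vs]; apply/eqP => fv.
suff : inf E <= v by lra.
by apply: ge_inf => //; split => //; lra.
Qed.

Lemma path_uniformly_continuous f (T e : R) : path_continuous f -> 0 < e ->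
  exists2 del : R, 0 < del & forall u v : R, 0 <= u <= T -> 0 <= v <= T ->
    `|u - v| < del -> `|f u - f v| < e.
Proof.
move=> cf e0.
have /compact_near_coveringP K := @segment_compact R 0 T.
(* Compactness in its near-covering form: [P] holds for centres near each point and all small radii,
   hence for one radius on the whole segment. *)
pose P (del x : R) := 0 <= x <= T ->
  forall u : R, 0 <= u <= T -> `|u - x| < del -> `|f u - f x| < e.
have := K _ (0^'+) P _ _.
case.
  move=> x /=; rewrite in_itv/= => /andP[x0 xT].
  have e20 : 0 < e / 2 by lra.
  have [del del0 h] := cf _ x0 _ e20.
  exists (ball x (del / 2), [set y : R | 0 < y < del / 2]) => /=.
    split; first by apply: nbhsx_ballx; lra.
    near=> y; apply/andP; split; first by near: y; exact: nbhs_right_gt.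
    by near: y; apply: nbhs_right_lt; lra.
  move=> [y c]/= [xy /andP[c0 cd]] yT u uT uy.
  rewrite /ball/= in xy.
  have h1 : `|f y - f x| < e / 2 by apply: h; [lra|rewrite distrC; lra].
  have h2 : `|f u - f x| < e / 2.
    apply: h; first lra.
    rewrite (_ : u - x = (u - y) - (x - y)); last by ring.
    by rewrite (le_lt_trans (ler_normB _ _))//; lra.
  rewrite (_ : f u - f y = (f u - f x) - (f y - f x)); last by ring.
  by rewrite (le_lt_trans (ler_normB _ _))//; lra.
move=> r /= r0 hr; exists (r / 2); first lra.
move=> u v uT vT uv; apply: (hr (r / 2)) => //=; last lra.
  by rewrite sub0r normrN gtr0_norm; lra.
Unshelve. all: by end_near. Qed.

Lemma path_argmax f (a b : R) : path_continuous f -> 0 <= a <= b ->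
  exists2 c : R, a <= c <= b & forall u : R, a <= u <= b -> f u <= f c.
Proof.
move=> cf /andP[a0 ab].
have wf : {within `[a, b], continuous f}.
  apply/subspace_continuousP => t /=; rewrite in_itv/= => /andP[at_ tb].
  apply/cvgrPdist_lt => e e0; rewrite near_withinE; apply/nbhs_ballP.
  have [|del del0 h] := cf t _ _ e0; first lra.
  exists del => // u; rewrite /ball/= => tu; rewrite in_itv/= => /andP[au _].
  by rewrite distrC; apply: h; [lra|rewrite distrC].
have [c + hc] := EVT_max ab wf; rewrite in_itv/= => cab.
by exists c => // u uab; apply: hc; rewrite in_itv.
Qed.

Lemma path_pos_lb f (a b : R) : path_continuous f -> 0 <= a ->
  (forall u : R, a <= u <= b -> 0 < f u) ->
  exists2 e : R, 0 < e & forall u : R, a <= u <= b -> e <= f u.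
Proof.
move=> cf a0 fp.
have [ab|ba] := leP a b; last by exists 1 => // u; lra.
have [|c cab hc] := @path_argmax (fun t => -1 * f t) a b (path_continuousZ (-1) cf).
  by rewrite a0.
exists (f c); first exact: fp.
by move=> u /hc; rewrite !mulN1r lerN2.
Qed.

(** Times are written s * q with q rational in [0, 1], so that the index set is countable and
    independent of s; this matters when s is itself a variable of a product space. *)
Lemma rational_dense_le (f : R -> R) (s e : R) : path_continuous f -> 0 <= s ->
  (forall q : rat, (0 <= q <= 1)%R -> f (s * ratr q) <= e) ->
  forall u : R, 0 <= u <= s -> f u <= e.
Proof.
move=> cf s0 hq u /andP[u0 us].
have [->|un0] := eqVneq u 0.
  by have := hq 0; rewrite rmorph0 mulr0; apply; rewrite lexx ler01.
have {un0}u0 : 0 < u by rewrite lt_neqAle eq_sym un0.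
have sp : 0 < s by lra.
rewrite leNgt; apply/negP => eu.
have [del del0 h] := path_continuous_gt cf (ltW u0) eu.
have : Num.max 0 ((u - del) / s) < u / s.
  by rewrite gt_max divr_gt0//= ltr_pM2r ?invr_gt0//; lra.
move=> /rat_in_itvoo[q]; rewrite in_itv/= gt_max => /andP[/andP[q0 qd] qu].
rewrite ltr_pdivrMr// in qd; rewrite ltr_pdivlMr// in qu.
have : e < f (s * ratr q).
  apply: h; first by rewrite mulr_ge0// ltW.
  by rewrite ltr_norml; lra.
have q1 : 0 <= q <= 1.
  rewrite -(ler0q R) ltW//= -(ler_rat R) rmorph1.
  have : ratr q * s <= 1 * s by lra.
  by rewrite ler_pM2r.
by have := hq q q1; lra.
Qed.

Lemma path_zeros_measurable (f : R -> R) : path_continuous f ->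
  measurable [set t : R | 0 <= t /\ f t = 0].
Proof.
move=> cf; pose g t := f (Num.max 0 t).
have cg : continuous g.
  move=> t; apply/cvgrPdist_lt => e e0.
  have t0 : 0 <= Num.max 0 t by rewrite le_max lexx.
  have [del del0 h] := cf _ t0 _ e0.
  apply/nbhs_ballP; exists del => // u; rewrite /ball/= => hu.
  rewrite distrC; apply: h; first by rewrite le_max lexx.
  apply: le_lt_trans hu; rewrite distrC.
  have h1 := ler_norm (t - u); have h2 := ler_norm (u - t); rewrite distrC in h2.
  rewrite ler_norml; case: (leP 0 u) => ?; case: (leP 0 t) => ?; apply/andP; split; lra.
rewrite (_ : [set t | _] = `[0, +oo[ `&` (setT `&` g @^-1` [set 0])).
  apply: measurableI => //; exact: continuous_measurable_fun.
apply/seteqP; split=> t /=; rewrite in_itv/= andbT /g.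
  by move=> [t0 ft]; rewrite max_r.
by move=> [t0 [_]]; rewrite max_r.
Qed.

(** With (m + 1)^2 points of mesh 1 / (m + 1) the grid both refines and covers ever longer
    intervals, so that no horizon has to be fixed beforehand. *)
Lemma grid_point (q y : R) m : q <= y -> y - q < m%:R ->
  exists2 k, (k < m.+1 * m.+1)%N & y <= q + k%:R / m.+1%:R <= y + m.+1%:R^-1.
Proof.
move=> qy ym; have m0 : 0 < m.+1%:R :> R by [].
have x0 : 0 <= (y - q) * m.+1%:R by rewrite mulr_ge0//; lra.
have /andP[k1 k2] := truncn_itv x0; set k := Num.truncn _ in k1 k2.
exists k.+1.
  rewrite -(ltr_nat R) -(natr1 k) natrM; apply: (le_lt_trans (lerD k1 (lexx 1))).
  apply: (@lt_le_trans _ _ (m%:R * m.+1%:R + 1)); first by rewrite ltrD2r ltr_pM2r.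
  by rewrite -!natrM natr1 ler_nat mulSn addSn ltnS leq_addl.
apply/andP; split; first by rewrite -lerBlDl ler_pdivlMr// ltW.
have : k.+1%:R / m.+1%:R <= y - q + m.+1%:R^-1.
  by rewrite ler_pdivrMr// mulrDl mulVf ?gt_eqF// -(natr1 k) lerD2r.
by set x1 := k.+1%:R / _; set x2 := _^-1; lra.
Qed.

End HalfLinePaths.

(** * Reflection in the quadrant *)

Section Quadrant.
Context {R : realType}.
Implicit Types (d : 'I_2 -> 'cV[R]_2) (x y : 'cV[R]_2) (i k : 'I_2).

Lemma ord2P i k : k = i \/ k = rev_ord i.
Proof.
by case: i k => [[|[|//]] ?] [[|[|//]] ?]; (left; exact: val_inj) || (right; exact: val_inj).
Qed.

Lemma sum_ord2 (V : nmodType) i (f : 'I_2 -> V) : \sum_k f k = f i + f (rev_ord i).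
Proof.
by rewrite !big_ord_recl big_ord0 addr0;
  case: i => [[|[|//]] ?]; [congr (f _ + f _)|rewrite addrC; congr (f _ + f _)];
  apply: val_inj.
Qed.

Lemma rev_ord_neq i : rev_ord i != i.
Proof. by case: i => [[|[|//]] ?]. Qed.

Lemma dotv_ord2 i x y : dotv x y = x i 0 * y i 0 + x (rev_ord i) 0 * y (rev_ord i) 0.
Proof. exact: sum_ord2. Qed.

Lemma dotv_basisv x i : dotv x (basisv i) = x i 0.
Proof.
by rewrite (dotv_ord2 i) !mxE !eqxx (negbTE (rev_ord_neq i)) mulr1 mulr0 addr0.
Qed.

Lemma colP2 x y i : x i 0 = y i 0 -> x (rev_ord i) 0 = y (rev_ord i) 0 -> x = y.
Proof.
by move=> h h'; apply/colP => k; case: (ord2P i k) => ->.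
Qed.

Lemma interior_coord (A : set 'cV[R]_2) x : interior A x <->
  exists2 e : R, 0 < e & forall y, (forall k, `|y k 0 - x k 0| < e) -> A y.
Proof.
split=> [/nbhs_ballP[e /= e0 h]|[e e0 h]].
  exists e => // y hy; apply: h; split => // k j.
  by rewrite ord1 /ball/= distrC.
apply/nbhs_ballP; exists e => //= y [_ hy]; apply: h => k.
by have := hy k 0; rewrite /ball/= distrC.
Qed.

Lemma interior_quadrant x : (forall i, 0 < x i 0) -> interior (@quadrant R) x.
Proof.
move=> x0; apply/interior_coord; exists (Num.min (x 0 0) (x (rev_ord 0) 0)).
  by rewrite lt_min !x0.
move=> y hy k; have := hy k; rewrite lt_min !ltr_norml.
by case: (ord2P 0 k) => ->; lra.
Qed.

Lemma boundary_quadrant x i : quadrant x -> x i 0 = 0 -> boundary quadrant x.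
Proof.
move=> qx xi; split; first exact: subset_closure.
move=> /interior_coord[e e0 /(_ (x - (e / 2) *: basisv i))/(_ _)/(_ i)].
rewrite !mxE !eqxx xi => h.
suff : 0 <= 0 - e / 2 * 1 :> R by lra.
apply: h => k; rewrite !mxE addrAC subrr sub0r normrN normrM gtr0_norm ?divr_gt0//.
by case: (k == i); rewrite /= ?normr0 ?normr1; lra.
Qed.

Lemma active_coord x i : active x i -> x i 0 = 0.
Proof. by case; rewrite dotv_basisv. Qed.

Lemma active_face x i : quadrant x -> x i 0 = 0 -> active x i.
Proof. by move=> qx xi; split; [exact: (boundary_quadrant (i := i))|rewrite dotv_basisv]. Qed.

Lemma active_set1 x i : quadrant x -> x i 0 = 0 -> x (rev_ord i) 0 != 0 ->
  active x = [set i].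
Proof.
move=> qx xi xj; apply/seteqP; split=> [k /active_coord|k ->]; last exact: active_face.
by case: (ord2P i k) => -> //= h; rewrite h eqxx in xj.
Qed.

Lemma boundary_quadrant_face x : quadrant x -> boundary quadrant x ->
  exists i, x i 0 = 0.
Proof.
move=> qx [_ nx]; apply: contrapT => /forallNP h; apply: nx.
by apply: interior_quadrant => i; rewrite lt_neqAle qx andbT eq_sym; apply/eqP.
Qed.

Lemma nonsmooth_bdry_corner x : quadrant x -> nonsmooth_bdry x -> x = 0.
Proof.
move=> qx [bx nx]; have [i xi] := boundary_quadrant_face qx bx.
apply: (@colP2 _ _ i); rewrite mxE//.
apply: contrapT => /eqP xj; apply: nx; split => //; exists i.
exact: active_set1.
Qed.

Lemma nonsmooth_bdry0 : nonsmooth_bdry (0 : 'cV[R]_2).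
Proof.
have q0 : quadrant (0 : 'cV[R]_2) by move=> k; rewrite mxE.
have z0 k : (0 : 'cV[R]_2) k 0 = 0 by rewrite mxE.
split; first exact: (boundary_quadrant (i := 0) q0 (z0 0)).
move=> [_ [i e]]; have := active_face q0 (z0 (rev_ord i)); rewrite e /= => h.
by have := rev_ord_neq i; rewrite h eqxx.
Qed.

(** Normal form of a conic combination: one coefficient per face, and [Q i] must hold as soon as
    that of face i is positive. A cone over a whole interval of times thus shrinks to two
    numbers. *)
Definition face_push d (Q : 'I_2 -> Prop) y := exists al : 'I_2 -> R,
  [/\ forall i, 0 <= al i, forall i, 0 < al i -> Q i & y = \sum_i al i *: d i].

Lemma face_push0 d Q : face_push d Q 0.
Proof.
exists (fun=> 0); split => //; first by move=> i; rewrite ltxx.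
by rewrite big1// => i _; rewrite scale0r.
Qed.

Lemma face_pushD d Q x y : face_push d Q x -> face_push d Q y -> face_push d Q (x + y).
Proof.
move=> [a [a0 aQ ->]] [b [b0 bQ ->]]; exists (fun i => a i + b i); split.
- by move=> i; exact: addr_ge0.
- move=> i; rewrite lt_neqAle addr_ge0// andbT eq_sym paddr_eq0// negb_and.
  by case/orP => h; [apply: aQ|apply: bQ]; rewrite lt_neqAle eq_sym h/=.
- by rewrite -big_split; apply: eq_bigr => i _; rewrite scalerDl.
Qed.

Lemma face_pushZ d Q (c : R) x : 0 <= c -> face_push d Q x -> face_push d Q (c *: x).
Proof.
move=> c0 [a [a0 aQ ->]]; exists (fun i => c * a i); split.
- by move=> i; exact: mulr_ge0.
- move=> i; rewrite lt_neqAle mulr_ge0// andbT eq_sym mulf_eq0 negb_or.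
  by move=> /andP[_ h]; apply: aQ; rewrite lt_neqAle eq_sym h/=.
- by rewrite scaler_sumr; apply: eq_bigr => i _; rewrite scalerA.
Qed.

Lemma face_pushS d (Q Q' : 'I_2 -> Prop) x : (forall i, Q i -> Q' i) ->
  face_push d Q x -> face_push d Q' x.
Proof. by move=> QQ [a [a0 aQ ->]]; exists a; split => // i /aQ/QQ. Qed.

Lemma face_push_gen d (Q : 'I_2 -> Prop) i : Q i -> face_push d Q (d i).
Proof.
move=> Qi; exists (fun k => (k == i)%:R); split.
- by move=> k; case: eqP.
- by move=> k; case: eqP => [->//|]; rewrite ltxx.
- by rewrite (sum_ord2 i) eqxx (negbTE (rev_ord_neq i)) scale1r scale0r addr0.
Qed.

Lemma cone_face_push d (Q : 'I_2 -> Prop) (A : set 'cV[R]_2) y :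
  (forall v, A v -> face_push d Q v) -> cone A y -> face_push d Q y.
Proof.
move=> AQ [n [a [v [a0 Av ->]]]].
elim/big_ind : _ => [|x1 x2|k _]; [exact: face_push0|exact: face_pushD|].
by apply: face_pushZ => //; exact: AQ.
Qed.

Lemma refl_cone_push d x y : refl_cone d x y -> face_push d (fun i => x i 0 = 0) y.
Proof.
apply: cone_face_push => _ [i /active_coord xi <-].
exact: (face_push_gen d (Q := fun i => x i 0 = 0)).
Qed.

Lemma refl_cones_push d (I : set R) (Z : R -> 'cV[R]_2) y :
  cone (\bigcup_(u in I) refl_cone d (Z u)) y ->
  face_push d (fun i => exists2 u, I u & Z u i 0 = 0) y.
Proof.
apply: cone_face_push => v [u Iu /refl_cone_push]; apply: face_pushS => i zi.
by exists u.
Qed.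

End Quadrant.

(** * The Skorokhod problem in coordinates *)

Section SkorokhodSolution.
Context {R : realType}.
Variable d : 'I_2 -> 'cV[R]_2.

Record sp_solution (X Z : R -> 'cV[R]_2) : Prop := SpSolution {
  sp_cont_in : forall i, path_continuous (fun t => X t i 0);
  sp_cont : forall i, path_continuous (fun t => Z t i 0);
  sp_ge0 : forall t, 0 <= t -> quadrant (Z t);
  sp_init : face_push d (fun i => Z 0 i 0 = 0) (Z 0 - X 0);
  sp_push : forall s t, 0 <= s < t ->
    face_push d (fun i => exists2 u, s < u <= t & Z u i 0 = 0)
      ((Z t - X t) - (Z s - X s)) }.

Lemma continuous_path_coord (f : R -> 'cV[R]_2) i :
  continuous_path f -> path_continuous (fun t => f t i 0).
Proof.
move=> /subspace_continuousP cf; apply: path_continuous_within.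
apply/subspace_continuousP => t /cf ft.
exact: (cvg_comp _ _ ft (@coord_continuous _ _ _ i 0 (f t))).
Qed.

Lemma skorokhod_map_solution X Z : skorokhod_map d X Z -> sp_solution X Z.
Proof.
move=> [[cX cZ cY] Y0 h]; split.
- by move=> i; exact: continuous_path_coord.
- by move=> i; exact: continuous_path_coord.
- by move=> t /h[].
- exact: refl_cone_push.
- move=> s t st; have t0 : 0 <= t by lra.
  have [_ _ /(_ s st)/refl_cones_push] := h t t0.
  apply: face_pushS => i [u]/=; rewrite in_itv/= => su zu; by exists u.
Qed.

End SkorokhodSolution.

(** * Reflection directions under the set-B and projection conditions *)

Section SetB.
Context {R : realType}.
Variables (d : 'I_2 -> 'cV[R]_2).
Hypothesis hd : forall i, dotv (d i) (basisv i) = 1.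

Let d1 i : d i i 0 = 1. Proof. by rewrite -(dotv_basisv (d i)). Qed.

Lemma convex_set_comb (B : set 'cV[R]_2) (x y : 'cV[R]_2) (t : R) : convex_set B -> B x -> B y ->
  0 <= t <= 1 -> B (t *: x + (1 - t) *: y).
Proof.
move=> cB Bx By /andP[t0 t1].
by have := cB x y (Itv01 t0 t1); rewrite !inE => /(_ Bx By).
Qed.

(** The extreme point [w *: basisv k] has a vanishing coordinate [rev_ord k], so the set-B condition
    of the other face applies to it; it is attained because the section of [B] by the axis is
    compact. *)
Lemma axis_radius (B : set 'cV[R]_2) k : compact B -> interior B 0 ->
  exists w : R, [/\ 0 < w, B (w *: basisv k)
    & forall t, B (t *: basisv k) -> t <= w].
Proof.
move=> cB B0.
pose E := [set t : R | B (t *: basisv k)].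
have cmul : continuous (fun t : R => t *: (basisv k : 'cV[R]_2)).
  by move=> t; apply: cvgZr_tmp; exact: cvg_id.
have clB : closed B by apply: compact_closed => //; exact: norm_hausdorff.
have clE : closed E by apply: closed_comp => // t _; exact: cmul.
have E0 : E !=set0.
  by exists 0; rewrite /E/= scale0r; exact: interior_subset.
have cE : compact E.
  pose B' := (fun x : 'cV[R]_2 => x k 0) @` B.
  have cB' : compact B'.
    apply: continuous_compact => //.
    by apply: continuous_subspaceT => x; exact: coord_continuous.
  apply: subclosed_compact cB' _ => // t Et; exists (t *: basisv k) => //=.
  by rewrite !mxE !eqxx mulr1.
have hsE := compact_has_sup E0 cE.
have Ew : E (sup E).
  apply: clE => A /nbhs_ballP[e /= e0 eA].
  have [t Et ts] := sup_adherent e0 hsE.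
  exists t; split => //; apply: eA; rewrite /ball/= ltr_norml.
  by have : t <= sup E by [apply: ub_le_sup => //; case: hsE]; lra.
have tle t : E t -> t <= sup E by move=> ?; apply: ub_le_sup => //; case: hsE.
exists (sup E); split => //.
have /interior_coord[e e0 h] := B0.
suff : e / 2 <= sup E by lra.
apply/tle/h => l; rewrite !mxE subr0 normrM gtr0_norm ?divr_gt0//.
by case: (l == k); rewrite ?normr0 ?normr1; lra.
Qed.

(** From an interior point, a small step along [- nu] would stay in [B] and make the functional
    negative. *)
Lemma boundary_support (B : set 'cV[R]_2) (nu z : 'cV[R]_2) : dotv nu nu = 1 ->
  B z -> (forall y, B y -> 0 <= dotv nu (y - z)) -> boundary B z.
Proof.
move=> nu1 Bz h; split; first exact: subset_closure.
move=> /interior_coord[e e0 hz].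
have nuk k : `|nu k 0| <= 1.
  move: nu1; rewrite (dotv_ord2 k) ler_norml; nra.
have := h (z - (e / 2) *: nu); rewrite (dotv_ord2 0) !mxE.
have : dotv nu nu = nu 0 0 * nu 0 0 + nu (rev_ord 0) 0 * nu (rev_ord 0) 0 by exact: dotv_ord2.
rewrite nu1 => n1 /(_ _) h0.
suff : 0 <= - (e / 2) by lra.
rewrite (_ : - (e / 2) = nu 0 0 * (z 0 0 - e / 2 * nu 0 0 - z 0 0) +
  nu (rev_ord 0) 0 * (z (rev_ord 0) 0 - e / 2 * nu (rev_ord 0) 0 - z (rev_ord 0) 0)).
  apply: h0; apply: hz => k; rewrite !mxE addrAC subrr sub0r normrN normrM gtr0_norm ?divr_gt0//.
  by have := nuk k; nra.
rewrite (_ : _ + _ = - (e / 2) * (nu 0 0 * nu 0 0 + nu (rev_ord 0) 0 * nu (rev_ord 0) 0)); last by ring.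
by rewrite -n1 mulr1.
Qed.

(* The unit inward normal of the line [y k - s * y (rev k) = w]. *)
Let normal k (s : R) : 'cV[R]_2 := \col_l ((if l == k then - 1 else s) / Num.sqrt (1 + s ^+ 2)).

Let sqr1 (s : R) : 0 < Num.sqrt (1 + s ^+ 2).
Proof. by rewrite sqrtr_gt0 ltr_pwDl// sqr_ge0. Qed.

Let normalE k s y : dotv (normal k s) y =
  (s * y (rev_ord k) 0 - y k 0) / Num.sqrt (1 + s ^+ 2).
Proof.
by rewrite (dotv_ord2 k) !mxE eqxx (negbTE (rev_ord_neq k)); ring.
Qed.

Let normal_unit k s : dotv (normal k s) (normal k s) = 1.
Proof.
rewrite normalE !mxE eqxx (negbTE (rev_ord_neq k)).
rewrite (_ : s * (s / _) - _ = (1 + s ^+ 2) / Num.sqrt (1 + s ^+ 2)); last by ring.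
have s0 : 0 < 1 + s ^+ 2 by rewrite ltr_pwDl// sqr_ge0.
by rewrite -mulrA -invfM -expr2 sqr_sqrtr ?ltW// divff// gt_eqF.
Qed.

(** The normal of a line supporting [B] at such a z is orthogonal to [d (rev_ord k)] by the set-B
    condition; as this direction has coordinate 1 along its own axis, the slope can be read off. *)
Lemma support_slope (B : set 'cV[R]_2) (delta : R) k (s : R) z :
  (forall (i : 'I_2) z, boundary B z -> `|dotv z (basisv i)| < delta ->
     forall nu : 'cV[R]_2, dotv nu nu = 1 ->
       (forall y, B y -> 0 <= dotv nu (y - z)) -> dotv nu (d i) = 0) ->
  B z -> `|z (rev_ord k) 0| < delta ->
  (forall y, B y -> y k 0 - s * y (rev_ord k) 0 <= z k 0 - s * z (rev_ord k) 0) ->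
  s = d (rev_ord k) k 0.
Proof.
move=> hB Bz zd hs.
have hnu y : B y -> 0 <= dotv (normal k s) (y - z).
  move=> /hs hy; rewrite normalE divr_ge0//.
  by rewrite !mxE; lra.
have := hB (rev_ord k) z (boundary_support (normal_unit k s) Bz hnu).
rewrite dotv_basisv => /(_ zd _ (normal_unit k s) hnu).
rewrite normalE d1 mulr1 => /eqP; rewrite mulf_eq0 invr_eq0 (gt_eqF (sqr1 s)) orbF.
by rewrite subr_eq0 => /eqP.
Qed.

(* The slope of the supporting line at [w e_k] is the supremum of the secant
   slopes to points on its right, which convexity bounds by those on its left. *)
Lemma support_line (B : set 'cV[R]_2) (delta : R) k (w : R) :
  0 < delta -> convex_set B -> interior B 0 ->
  (forall (i : 'I_2) z, boundary B z -> `|dotv z (basisv i)| < delta ->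
     forall nu : 'cV[R]_2, dotv nu nu = 1 ->
       (forall y, B y -> 0 <= dotv nu (y - z)) -> dotv nu (d i) = 0) ->
  B (w *: basisv k) -> (forall t, B (t *: basisv k) -> t <= w) ->
  forall y, B y -> y k 0 - d (rev_ord k) k 0 * y (rev_ord k) 0 <= w.
Proof.
move=> delta0 cB B0 hB Bw wmax.
have kk : (rev_ord k == k) = false := negbTE (rev_ord_neq k).
pose S := [set s : R | exists2 y, B y & 0 < y (rev_ord k) 0 /\ s = (y k 0 - w) / y (rev_ord k) 0].
have cross x y : B x -> B y -> 0 < x (rev_ord k) 0 -> y (rev_ord k) 0 < 0 ->
    (x k 0 - w) / x (rev_ord k) 0 <= (y k 0 - w) / y (rev_ord k) 0.
  move=> Bx By x0 y0.
  set p := x (rev_ord k) 0 in x0 *; set q := y (rev_ord k) 0 in y0 *.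
  have pq : 0 < p - q by lra.
  (* The point where the segment from y to x crosses the axis k. *)
  have /wmax : B (((- q) / (p - q) * x k 0 + p / (p - q) * y k 0) *: basisv k).
    rewrite (_ : _ *: _ = (- q / (p - q)) *: x + (1 - (- q / (p - q))) *: y).
      apply: convex_set_comb => //; rewrite divr_ge0 ?ler_pdivrMr//; lra.
    apply: (@colP2 _ _ _ k); rewrite !mxE eqxx ?kk /=.
      by field; lra.
    by rewrite -/p -/q; field; lra.
  rewrite -mulrA [p / _]mulrC -mulrA -/(_ / _).
  have -> : - q * ((p - q)^-1 * x k 0) + (p - q)^-1 * (p * y k 0) =
      (- q * x k 0 + p * y k 0) / (p - q) by ring.
  rewrite ler_pdivrMr// => h.
  by rewrite ler_pdivrMr// mulrAC ler_ndivlMr//; lra.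
have /interior_coord[e e0 he] := B0.
pose pt (c : R) : 'cV[R]_2 := c *: basisv (rev_ord k).
have Bpt (c : R) : `|c| < e -> B (pt c).
  move=> ce; apply: he => l; rewrite !mxE subr0 normrM.
  by case: (l == _); rewrite ?normr1 ?normr0 ?mulr1 ?mulr0.
have ptE (c : R) : pt c (rev_ord k) 0 = c by rewrite !mxE eqxx mulr1.
have S0 : S !=set0.
  exists ((pt (e / 2) k 0 - w) / pt (e / 2) (rev_ord k) 0), (pt (e / 2)).
    by apply: Bpt; rewrite gtr0_norm; lra.
  by rewrite ptE; split => //; lra.
have Sub y : B y -> y (rev_ord k) 0 < 0 -> ubound S ((y k 0 - w) / y (rev_ord k) 0).
  by move=> By y0 _ [x Bx [x0 ->]]; exact: cross.
have hsS : has_sup S.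
  split => //; exists ((pt (- (e / 2)) k 0 - w) / pt (- (e / 2)) (rev_ord k) 0).
  by apply: Sub; [apply: Bpt; rewrite normrN gtr0_norm; lra|rewrite ptE; lra].
have line y : B y -> y k 0 - sup S * y (rev_ord k) 0 <= w.
  move=> By; case: (ltgtP (y (rev_ord k) 0) 0) => y0.
  - have : sup S <= (y k 0 - w) / y (rev_ord k) 0 by apply: ge_sup => //; exact: Sub.
    by rewrite ler_ndivlMr//; lra.
  - have : (y k 0 - w) / y (rev_ord k) 0 <= sup S.
      by apply: ub_le_sup; [case: hsS|exists y].
    by rewrite ler_pdivrMr//; lra.
  - rewrite y0 mulr0 subr0; apply: wmax.
    rewrite (_ : _ *: _ = y)//; apply: (@colP2 _ _ _ k); rewrite !mxE eqxx ?kk ?y0 /=; ring.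
have <- // : sup S = d (rev_ord k) k 0.
apply: (support_slope hB Bw); rewrite !mxE eqxx ?kk ?mulr0 ?normr0//= => y By.
by rewrite mulr1 subr0; exact: line.
Qed.

(** The supporting lines at [w0] and [w1] on the axes, tested at the extreme points of the other
    axis, give |c| w1 <= w0 and |a| w0 <= w1, whence |a c| <= 1. In the case of equality the line at
    [w0] touches [B] on the other axis too, which forces a = 1 / c; the sign of c then comes from
    projecting (-1, -1). *)
Lemma reflection_dichotomy : set_B_condition d -> projection_condition d ->
  `|d 0 1 0 * d 1 0 0| < 1 \/
  [/\ d 0 1 0 * d 1 0 0 = 1, 0 < d 0 1 0 & 0 < d 1 0 0].
Proof.
move=> [delta [B [delta0 [cptB cvxB symB B0] hB]]] [pi [pi_ge0 _ hpi]].
have r0 : rev_ord (0 : 'I_2) = 1 by exact: val_inj.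
have r1 : rev_ord (1 : 'I_2) = 0 by exact: val_inj.
have [w0 [w00 Bw0 w0max]] := axis_radius 0 cptB B0.
have [w1 [w10 Bw1 w1max]] := axis_radius 1 cptB B0.
have l0 := support_line delta0 cvxB B0 hB Bw0 w0max; rewrite r0 in l0.
have l1 := support_line delta0 cvxB B0 hB Bw1 w1max; rewrite r1 in l1.
have Nw0 := symB _ Bw0; have Nw1 := symB _ Bw1.
set a := d 0 1 0 in l1 *; set c := d 1 0 0 in l0 *.
have h0 : `|c| * w1 <= w0.
  have := l0 _ Bw1; have := l0 _ Nw1; rewrite !mxE /= => ? ?.
  by rewrite -[w1]gtr0_norm// -normrM ler_norml; lra.
have h1 : `|a| * w0 <= w1.
  have := l1 _ Bw0; have := l1 _ Nw0; rewrite !mxE /= => ? ?.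
  by rewrite -[w0]gtr0_norm// -normrM ler_norml; lra.
have [ac1|ac1] := ltP `|a * c| 1; [by left|right].
rewrite normrM in ac1.
have cw : `|c| * w1 = w0.
  apply/eqP; rewrite eq_le h0/=.
  have := ler_wpM2l (normr_ge0 c) h1.
  have := ler_wpM2r (ltW w00) ac1; lra.
have c0 : c != 0 by apply: contraTneq w00 => c0; rewrite -cw c0 normr0 mul0r ltxx.
have ca : c^-1 = a.
  have -> : a = d (rev_ord 1) 1 0 by rewrite r1.
  (* As |c| w1 = w0, the supporting line at [w0], or its mirror image, passes through w1 e_1; seen
     from the axis 1 its slope is 1 / c. *)
  apply: (support_slope hB Bw1); rewrite r1 !mxE /= ?mulr0 ?normr0// => y By.
  rewrite mulr1 subr0 -(ler_pM2l (_ : 0 < `|c|)) ?normr_gt0// cw mulrBr mulrA.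
  have [cgt|clt|c00] := ltgtP c 0.
  - have := l0 _ By; rewrite (ltr0_norm cgt) (_ : - c / c = -1) ?mulNr ?divff//; lra.
  - have := l0 _ (symB _ By); rewrite (gtr0_norm clt) divff// !mxE; lra.
  - by rewrite c00 eqxx in c0.
have ac : a * c = 1 by rewrite -ca mulVf.
suff cpos : 0 < c by split => //; rewrite -ca invr_gt0.
rewrite ltNge; apply/negP => cle.
pose x : 'cV[R]_2 := - (basisv 0 + basisv 1).
have nqx : ~ quadrant x by move=> /(_ 0); rewrite !mxE /= addr0; lra.
have [al [_ _ px]] := refl_cone_push (hpi _ nqx).
have p0 := pi_ge0 x 0; have p1 := pi_ge0 x 1.
(* The functional y_0 - c y_1 vanishes on both directions when a c = 1, but not on [pi x - x] if c
   <= 0. *)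
have := congr1 (fun y : 'cV[R]_2 => y 0 0 - c * y 1 0) px.
rewrite (sum_ord2 0) r0 !mxE /= !d1 -/a -/c.
rewrite (_ : _ - c * (al 0 * a + _) = al 0 * (1 - a * c)); last by ring.
rewrite ac subrr mulr0; move: cle p0 p1; rewrite -!/(pi x).
by move=> ? ? ? ?; nra.
Qed.

End SetB.

(** * Lipschitz continuity of the Skorokhod map *)

Section Regulator.
Context {R : realType}.
Implicit Types psi L : R -> R.

(* At the last zero s of psi + L before t one has
   L t = L s = - psi s <= - psi' s + D <= L' s + D <= L' t + D. *)
Lemma regulator_le psi psi' L L' (T D : R) :
  path_continuous psi -> path_continuous L ->
  (0 < psi 0 + L 0 -> L 0 <= 0) ->
  (forall s t : R, 0 <= s < t -> (forall u : R, s < u <= t -> psi u + L u != 0) -> L t <= L s) ->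
  (forall t : R, 0 <= t -> 0 <= psi t + L t) ->
  0 <= L' 0 -> (forall s t : R, 0 <= s <= t -> L' s <= L' t) ->
  (forall t : R, 0 <= t -> 0 <= psi' t + L' t) ->
  (forall t : R, 0 <= t <= T -> `|psi t - psi' t| <= D) ->
  forall t, 0 <= t <= T -> L t <= L' t + D.
Proof.
move=> cpsi cL L0 Lc z0 L'0 L'm z'0 hD t /andP[t0 tT].
have [hz|hz] := pselect (exists2 u, 0 <= u <= t & psi u + L u = 0).
  have [s [/andP[s0 st] zs] hs] := last_zero (path_continuousD cpsi cL) (lexx 0) hz.
  have Lts : L t <= L s.
    have [->//|lt_st] := eqVneq s t.
    by apply: Lc => //; rewrite s0 lt_neqAle lt_st.
  have := hD s; rewrite ler_norml => /(_ _)/andP[|h1 h2]; first lra.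
  have := z'0 s s0; have := L'm s t; lra.
have zn u : 0 <= u <= t -> psi u + L u != 0.
  by move=> ut; apply/eqP => zu; apply: hz; exists u.
have L0' : L 0 <= 0.
  by apply: L0; rewrite lt_neqAle eq_sym zn ?z0 ?lexx//=.
have Lt0 : L t <= L 0.
  have [->//|t_neq0] := eqVneq t 0.
  by apply: Lc => [|u ut]; [rewrite lexx lt_neqAle eq_sym t_neq0|apply: zn; lra].
have := L'm 0 t; have := hD 0; have := normr_ge0 (psi 0 - psi' 0); lra.
Qed.

Lemma regulator_dist psi psi' L L' (T D : R) :
  path_continuous psi -> path_continuous L ->
  path_continuous psi' -> path_continuous L' ->
  (0 < psi 0 + L 0 -> L 0 <= 0) -> (0 < psi' 0 + L' 0 -> L' 0 <= 0) ->
  (forall s t : R, 0 <= s < t -> (forall u : R, s < u <= t -> psi u + L u != 0) -> L t <= L s) ->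
  (forall s t : R, 0 <= s < t -> (forall u : R, s < u <= t -> psi' u + L' u != 0) -> L' t <= L' s) ->
  (forall t : R, 0 <= t -> 0 <= psi t + L t) ->
  (forall t : R, 0 <= t -> 0 <= psi' t + L' t) ->
  0 <= L 0 -> (forall s t : R, 0 <= s <= t -> L s <= L t) ->
  0 <= L' 0 -> (forall s t : R, 0 <= s <= t -> L' s <= L' t) ->
  (forall t : R, 0 <= t <= T -> `|psi t - psi' t| <= D) ->
  forall t : R, 0 <= t <= T -> `|L t - L' t| <= D.
Proof.
move=> cp cL cp' cL' i0 i0' c c' z z' n m n' m' hD t tT.
have h1 := regulator_le cp cL i0 c z n' m' z' hD tT.
have h2 : L' t <= L t + D.
  apply: (regulator_le cp' cL' i0' c' z' n m z _ tT) => u.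
  by rewrite distrC; exact: hD.
by rewrite ler_norml; lra.
Qed.

End Regulator.

Section LipschitzSkorokhod.
Context {R : realType}.
Variable d : 'I_2 -> 'cV[R]_2.
Hypothesis d1 : forall i, d i i 0 = 1.
Implicit Types X Z : R -> 'cV[R]_2.

Lemma face_push_coord (Q : 'I_2 -> Prop) y : face_push d Q y ->
  exists al : 'I_2 -> R, [/\ forall i, 0 <= al i, forall i, 0 < al i -> Q i
  & forall i, y i 0 = al i + al (rev_ord i) * d (rev_ord i) i 0].
Proof.
move=> [al [al0 alQ ->]]; exists al; split => // i.
by rewrite (sum_ord2 i) !mxE d1 mulr1.
Qed.

Definition pushing X Z t i := Z t i 0 - X t i 0.

Lemma pushing0 X Z : sp_solution d X Z -> exists al : 'I_2 -> R,
  [/\ forall i, 0 <= al i, forall i, 0 < al i -> Z 0 i 0 = 0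
  & forall i, pushing X Z 0 i = al i + al (rev_ord i) * d (rev_ord i) i 0].
Proof.
move=> /sp_init/face_push_coord[al [? ? h]]; exists al; split => // i.
by rewrite -h !mxE.
Qed.

Lemma pushing_incr X Z (s t : R) : sp_solution d X Z -> 0 <= s < t -> exists al : 'I_2 -> R,
  [/\ forall i, 0 <= al i, forall i, 0 < al i -> exists2 u : R, s < u <= t & Z u i 0 = 0
  & forall i, pushing X Z t i - pushing X Z s i = al i + al (rev_ord i) * d (rev_ord i) i 0].
Proof.
move=> /sp_push h /h/face_push_coord[al [? ? {}h]]; exists al; split => // i.
by rewrite -h !mxE.
Qed.

Lemma path_continuous_pushing X Z i : sp_solution d X Z ->
  path_continuous (fun t => pushing X Z t i).
Proof. by move=> h; apply: path_continuousB; [exact: sp_cont h _|exact: sp_cont_in h _]. Qed.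

(** What a unit push by the opposite face adds to coordinate i. *)
Let D i := d (rev_ord i) i 0.

Section Contraction.
Let det := 1 - D 0 * D (rev_ord 0).
Hypothesis det0 : `|D 0 * D (rev_ord 0)| < 1.

Let detE i : det = 1 - D i * D (rev_ord i).
Proof. by rewrite /det; case: (ord2P 0 i) => -> //; rewrite rev_ordK mulrC. Qed.

Let det_gt0 : 0 < det.
Proof. by move: det0; rewrite ltr_norml /det; lra. Qed.

(** Cramer's rule applied to the pushing: the amount contributed by face i. It is nondecreasing and
    grows only while [Z] meets face i, which makes it a one-dimensional regulator. *)
Let L X Z i t := (pushing X Z t i - D i * pushing X Z t (rev_ord i)) / det.

Let L_al (al : 'I_2 -> R) i : (al i + al (rev_ord i) * D i -
   D i * (al (rev_ord i) + al (rev_ord (rev_ord i)) * D (rev_ord i))) / det = al i.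
Proof.
rewrite rev_ordK (_ : _ - _ = al i * det); first by rewrite mulfK// gt_eqF.
by rewrite (detE i); ring.
Qed.

Let pushingL X Z i t : pushing X Z t i = L X Z i t + D i * L X Z (rev_ord i) t.
Proof.
rewrite /L rev_ordK mulrA -mulrDl; apply: (canRL (mulfK _)); rewrite ?gt_eqF//.
by rewrite (detE i); ring.
Qed.

Let L0 X Z i : sp_solution d X Z -> 0 <= L X Z i 0 /\ (0 < Z 0 i 0 -> L X Z i 0 <= 0).
Proof.
move=> /pushing0[al [al0 alQ h]]; rewrite /L !h -/(D i) -/(D (rev_ord i)) L_al; split => // zi.
by rewrite leNgt; apply/negP => /alQ zi0; rewrite zi0 ltxx in zi.
Qed.

Let L_incr X Z i (s t : R) : sp_solution d X Z -> 0 <= s < t -> L X Z i s <= L X Z i t /\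
  ((forall u : R, s < u <= t -> Z u i 0 != 0) -> L X Z i t <= L X Z i s).
Proof.
move=> sol st; have [al [al0 alQ h]] := pushing_incr sol st.
have e : L X Z i t - L X Z i s = al i.
  rewrite -[RHS]L_al -!h /L -mulrBl; congr (_ / _).
  by rewrite -!/(pushing _ _ _ _); ring.
split; first by have := al0 i; lra.
move=> zi; suff : al i <= 0 by lra.
by rewrite leNgt; apply/negP => /alQ[u su zu]; have := zi u su; rewrite zu eqxx.
Qed.

Let cL X Z i : sp_solution d X Z -> path_continuous (L X Z i).
Proof.
move=> sol; rewrite /L.
have h := path_continuousB (path_continuous_pushing i sol)
  (path_continuousZ (D i) (path_continuous_pushing (rev_ord i) sol)).
have := path_continuousZ (det^-1) h.
by congr path_continuous; apply/funext => t; rewrite mulrC.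
Qed.

(** The input of coordinate i once the push of the other face is regarded as given; coordinate i of
    [Z] is its one-dimensional reflection. *)
Let psi X Z i t := X t i 0 + D i * L X Z (rev_ord i) t.

Let psiE X Z i t : psi X Z i t + L X Z i t = Z t i 0.
Proof.
have := pushingL X Z i t; rewrite /pushing /psi; lra.
Qed.

Let cpsi X Z i : sp_solution d X Z -> path_continuous (psi X Z i).
Proof.
move=> sol; apply: path_continuousD; first exact: sp_cont_in sol _.
exact/path_continuousZ/cL.
Qed.

Let L_dist X Z X' Z' (T e : R) i : sp_solution d X Z -> sp_solution d X' Z' ->
  (forall t : R, 0 <= t <= T -> `|psi X Z i t - psi X' Z' i t| <= e) ->
  forall t : R, 0 <= t <= T -> `|L X Z i t - L X' Z' i t| <= e.
Proof.
move=> sol sol'; apply: regulator_dist.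
- exact: cpsi.
- exact: cL.
- exact: cpsi.
- exact: cL.
- by rewrite psiE; have [] := L0 i sol.
- by rewrite psiE; have [] := L0 i sol'.
- move=> s t st h; have [_] := L_incr i sol st; apply => u /h.
  by rewrite psiE.
- move=> s t st h; have [_] := L_incr i sol' st; apply => u /h.
  by rewrite psiE.
- by move=> t t0; rewrite psiE; exact: sp_ge0 sol _ t0 i.
- by move=> t t0; rewrite psiE; exact: sp_ge0 sol' _ t0 i.
- by have [] := L0 i sol.
- move=> s t /andP[s0]; rewrite le_eqVlt => /predU1P[->//|st].
  by have [|]// := L_incr i sol (_ : 0 <= s < t); rewrite s0.
- by have [] := L0 i sol'.
- move=> s t /andP[s0]; rewrite le_eqVlt => /predU1P[->//|st].
  by have [|]// := L_incr i sol' (_ : 0 <= s < t); rewrite s0.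
Qed.

(** The maxima S_0 and S_1 over [0, T] of the differences of the regulators satisfy S_i <= e + |D i|
    S_(1-i). They are finite by continuity, so one inequality can be substituted into the other, and
    |D 0 * D 1| < 1 closes the estimate. *)
Lemma skorokhod_lipschitz_contraction : exists2 K : R, 0 < K &
  forall X Z X' Z' (T e : R), sp_solution d X Z -> sp_solution d X' Z' ->
  (forall (t : R) i, 0 <= t <= T -> `|X t i 0 - X' t i 0| <= e) ->
  forall (t : R) i, 0 <= t <= T -> `|Z t i 0 - Z' t i 0| <= K * e.
Proof.
pose m := `|D 0| + `|D (rev_ord 0)|.
pose q := `|D 0 * D (rev_ord 0)|.
have m0 : 0 <= m by apply: addr_ge0.
have Dm i : `|D i| <= m.
  by rewrite /m; have := normr_ge0 (D 0); have := normr_ge0 (D (rev_ord 0));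
    case: (ord2P 0 i) => ->; lra.
have q1 : 0 < 1 - q by rewrite subr_gt0.
exists (1 + (1 + m) * ((1 + m) / (1 - q))).
  by rewrite ltr_pwDl// mulr_ge0 ?divr_ge0//; lra.
move=> X Z X' Z' T e sol sol' hX t i tT.
have T0 : 0 <= T by lra.
have e0 : 0 <= e by apply: le_trans (hX t i tT).
pose l i t := `|L X Z i t - L X' Z' i t|.
have cl k : path_continuous (l k).
  have cB := path_continuousB (cL k sol) (cL k sol').
  move=> s s0 a a0; have [del del0 h] := cB s s0 a a0.
  exists del => // u u0 us; apply: le_lt_trans (h u u0 us).
  exact: ler_dist_dist.
have hmax k : exists2 S, 0 <= S /\ (forall t : R, 0 <= t <= T -> l k t <= S) &
    exists2 c, 0 <= c <= T & S = l k c.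
  have [|c cT hc] := path_argmax (cl k) (_ : 0 <= 0 <= T); first by rewrite lexx.
  by exists (l k c); [split => //; exact: normr_ge0|exists c].
have step k S : (forall t : R, 0 <= t <= T -> l (rev_ord k) t <= S) ->
    forall t, 0 <= t <= T -> l k t <= e + `|D k| * S.
  move=> hS; apply: L_dist => // s sT.
  rewrite (_ : psi _ _ _ _ - _ = (X s k 0 - X' s k 0) +
     D k * (L X Z (rev_ord k) s - L X' Z' (rev_ord k) s)); last by rewrite /psi; ring.
  rewrite (le_trans (ler_normD _ _))// lerD ?hX// normrM.
  by rewrite ler_wpM2l//; exact: hS.
have bound k s : 0 <= s <= T -> l k s <= (1 + m) / (1 - q) * e.
  move=> sT; have [S [S0 hS] [c cT Sc]] := hmax k.
  have [S' [S'0 hS'] [c' cT' Sc']] := hmax (rev_ord k).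
  have h1 := step k S' hS' c cT.
  have h2 := step (rev_ord k) S; rewrite rev_ordK in h2.
  have {}h2 := h2 hS c' cT'.
  rewrite -Sc in h1; rewrite -Sc' in h2.
  have qE : q = `|D k| * `|D (rev_ord k)|.
    by rewrite /q normrM; case: (ord2P 0 k) => ->; rewrite ?rev_ordK// mulrC.
  apply: (le_trans (hS s sT)).
  rewrite mulrAC ler_pdivlMr//.
  have := Dm k; have := normr_ge0 (D k) => Dk0 Dkm.
  have h3 := ler_wpM2l Dk0 h2.
  have h4 : `|D k| * e <= m * e by rewrite ler_wpM2r.
  by rewrite qE; lra.
have lb k : l k t <= (1 + m) / (1 - q) * e by exact: bound.
rewrite (_ : _ - _ = (X t i 0 - X' t i 0) + ((L X Z i t - L X' Z' i t) +
   D i * (L X Z (rev_ord i) t - L X' Z' (rev_ord i) t))); last first.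
  have := pushingL X Z i t; have := pushingL X' Z' i t; rewrite /pushing; lra.
have n1 := ler_normD (X t i 0 - X' t i 0) ((L X Z i t - L X' Z' i t) +
   D i * (L X Z (rev_ord i) t - L X' Z' (rev_ord i) t)).
have n2 := ler_normD (L X Z i t - L X' Z' i t)
   (D i * (L X Z (rev_ord i) t - L X' Z' (rev_ord i) t)).
have n3 : `|D i * (L X Z (rev_ord i) t - L X' Z' (rev_ord i) t)| <=
    m * ((1 + m) / (1 - q) * e).
  by rewrite normrM ler_pM//; exact: lb.
rewrite (_ : (1 + _) * e = e + (1 + m) * ((1 + m) / (1 - q) * e)); last by ring.
have := hX t i tT; have := lb i; rewrite /l.
by move: n3; set G := (1 + m) / (1 - q) * e => n3 h1 h2; lra.
Qed.

End Contraction.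

(** Here [d 1] is c times [d 0], so the pushing is a nonnegative multiple of (1, a), determined by
    its coordinate 0, called [L]. As a c = 1, [L] is the one-dimensional regulator that reflects
    min(X_0, c X_1) into min(Z_0, c Z_1), however the push is shared between the faces. *)
Lemma skorokhod_lipschitz_parallel : D 0 * D (rev_ord 0) = 1 ->
  0 < D 0 -> 0 < D (rev_ord 0) -> exists2 K : R, 0 < K &
  forall X Z X' Z' (T e : R), sp_solution d X Z -> sp_solution d X' Z' ->
  (forall (t : R) i, 0 <= t <= T -> `|X t i 0 - X' t i 0| <= e) ->
  forall (t : R) i, 0 <= t <= T -> `|Z t i 0 - Z' t i 0| <= K * e.
Proof.
have [c cE] : exists c, c = D 0 by exists (D 0).
have [a aE] : exists a, a = D (rev_ord 0) by exists (D (rev_ord 0)).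
rewrite -cE -aE => ca c0 a0.
set j : 'I_2 := rev_ord 0.
have jj : rev_ord j = 0 by rewrite rev_ordK.
pose psi (X : R -> 'cV[R]_2) t := Num.min (X t 0 0) (c * X t j 0).
pose L X Z t := pushing X Z t 0.
have al_j (al : 'I_2 -> R) : al j + al (rev_ord j) * d (rev_ord j) j 0 =
    a * (al 0 + al (rev_ord 0) * d (rev_ord 0) 0 0).
  rewrite jj -/j -/(D 0) -cE (_ : d 0 j 0 = a); last by rewrite aE /D rev_ordK.
  rewrite -{1}[al j]mulr1 -ca; ring.
have pj0 X Z : sp_solution d X Z -> pushing X Z 0 j = a * L X Z 0.
  by move=> /pushing0[al [_ _ h]]; rewrite /L !h al_j.
have pj X Z t : sp_solution d X Z -> 0 <= t -> pushing X Z t j = a * L X Z t.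
  move=> sol; rewrite le_eqVlt => /predU1P[<-|t0]; first exact: pj0.
  have [|al [_ _ h]] := pushing_incr sol (_ : 0 <= 0 < t); first by rewrite lexx.
  have := h j; rewrite al_j -h pj0// /L; lra.
have psiE X Z t : sp_solution d X Z -> 0 <= t ->
    psi X t + L X Z t = Num.min (Z t 0 0) (c * Z t j 0).
  move=> sol t0; have := pj X Z t sol t0; rewrite /psi /L /pushing => h.
  rewrite addr_minl; congr Num.min; first by ring.
  rewrite (_ : Z t j 0 = X t j 0 + a * (Z t 0 0 - X t 0 0)); last by lra.
  by rewrite mulrDr mulrA ca mul1r.
have min0 X Z t i : sp_solution d X Z -> 0 <= t -> Z t i 0 = 0 -> psi X t + L X Z t = 0.
  move=> sol t0 zi; rewrite psiE//; apply/eqP; rewrite eq_le.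
  have q0 := sp_ge0 sol t0 0; have qj := sp_ge0 sol t0 j.
  rewrite ge_min le_min q0 mulr_ge0 ?(ltW c0)//= andbT.
  by case: (ord2P 0 i) zi => -> ->; rewrite ?mulr0 lexx ?orbT.
have L00 X Z : sp_solution d X Z -> 0 <= L X Z 0 /\ (0 < psi X 0 + L X Z 0 -> L X Z 0 <= 0).
  move=> sol; have [al [al0 alQ h]] := pushing0 sol; rewrite {1 3}/L !h -/(D 0) -cE.
  split; first by rewrite addr_ge0// mulr_ge0// ltW.
  move=> z0; have al_eq0 i : al i = 0.
    apply/eqP; rewrite eq_le al0 andbT leNgt; apply/negP => /alQ zi.
    by move: z0; rewrite (min0 _ _ _ i)// ltxx.
  by rewrite !al_eq0 mul0r addr0.
have L_incr X Z (s t : R) : sp_solution d X Z -> 0 <= s < t -> L X Z s <= L X Z t /\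
  ((forall u : R, s < u <= t -> psi X u + L X Z u != 0) -> L X Z t <= L X Z s).
  move=> sol st; have [al [al0 alQ h]] := pushing_incr sol st.
  have := h 0; rewrite -/(D 0) -cE -/(L X Z t) -/(L X Z s) => e; split.
    have : 0 <= al 0 + al (rev_ord 0) * c by rewrite addr_ge0// mulr_ge0// ltW.
    by lra.
  move=> hz; have al_eq0 i : al i = 0.
    apply/eqP; rewrite eq_le al0 andbT leNgt; apply/negP => /alQ[u su zi].
    by have := hz u su; rewrite (min0 _ _ _ i) ?eqxx//; lra.
  by move: e; rewrite !al_eq0; lra.
have cpsi X Z : sp_solution d X Z -> path_continuous (psi X).
  move=> sol; apply: path_continuous_min; first exact: sp_cont_in sol _.
  exact/path_continuousZ/(sp_cont_in sol).
have zpos X Z t : sp_solution d X Z -> 0 <= t -> 0 <= psi X t + L X Z t.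
  by move=> sol t0; rewrite psiE// le_min !(sp_ge0 sol)//= mulr_ge0 ?(ltW c0)// (sp_ge0 sol).
exists (1 + (1 + a) * (1 + c)).
  have ac0 : 0 < (1 + a) * (1 + c) by apply: mulr_gt0; lra.
  by lra.
move=> X Z X' Z' T e sol sol' hX t i tT.
have e0 : 0 <= e by apply: le_trans (hX t i tT).
have LL : `|L X Z t - L X' Z' t| <= (1 + c) * e.
  apply: (@regulator_dist _ (psi X) (psi X') _ _ T).
  - exact: cpsi sol.
  - exact: path_continuous_pushing sol.
  - exact: cpsi sol'.
  - exact: path_continuous_pushing sol'.
  - by have [] := L00 _ _ sol.
  - by have [] := L00 _ _ sol'.
  - by move=> s u /(L_incr _ _ _ _ sol)[].
  - by move=> s u /(L_incr _ _ _ _ sol')[].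
  - by move=> s; exact: zpos.
  - by move=> s; exact: zpos.
  - by have [] := L00 _ _ sol.
  - move=> s u /andP[s0]; rewrite le_eqVlt => /predU1P[->//|su].
    by have [|]// := L_incr _ _ s u sol; rewrite s0.
  - by have [] := L00 _ _ sol'.
  - move=> s u /andP[s0]; rewrite le_eqVlt => /predU1P[->//|su].
    by have [|]// := L_incr _ _ s u sol'; rewrite s0.
  - move=> s sT; have := hX s 0 sT; have := hX s j sT; rewrite /psi !ler_norml => hj h0.
    have ce : 0 <= c * e by rewrite mulr_ge0// ltW.
    have hj1 : c * (X s j 0 - X' s j 0) <= c * e by apply: (ler_wpM2l (ltW c0)); lra.
    have hj2 : c * (- e) <= c * (X s j 0 - X' s j 0) by apply: (ler_wpM2l (ltW c0)); lra.
    rewrite /Num.min; case: (ltP (X s 0 0) _) => ?; case: (ltP (X' s 0 0) _) => ?; lra.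
  - by [].
have aLL : `|a * L X Z t - a * L X' Z' t| <= a * ((1 + c) * e).
  by rewrite -mulrBr normrM gtr0_norm// ler_wpM2l// ltW.
have ce : 0 <= (1 + c) * e by apply: mulr_ge0; lra.
have ace : 0 <= a * ((1 + c) * e) by rewrite mulr_ge0// ltW.
have t0 : 0 <= t by lra.
have := hX t i tT.
case: (ord2P 0 i) => ->.
  rewrite (_ : Z t 0 0 - Z' t 0 0 = (X t 0 0 - X' t 0 0) + (L X Z t - L X' Z' t)); last first.
    by rewrite /L /pushing; ring.
  by move=> h; rewrite (le_trans (ler_normD _ _))//; lra.
have := pj _ _ _ sol t0; have := pj _ _ _ sol' t0; rewrite /pushing -/j => h h'.
rewrite (_ : Z t j 0 - Z' t j 0 = (X t j 0 - X' t j 0) + (a * L X Z t - a * L X' Z' t)); last lra.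
by move=> {}h; rewrite (le_trans (ler_normD _ _))//; lra.
Qed.

End LipschitzSkorokhod.

(** * Geometry of the reflection; deterministic tubes *)

Section ReflectionGeometry.
Context {R : realType}.
Variable d : 'I_2 -> 'cV[R]_2.
Hypothesis d1 : forall i, d i i 0 = 1.
Hypothesis dichotomy : `|d 0 1 0 * d 1 0 0| < 1 \/
  [/\ d 0 1 0 * d 1 0 0 = 1, 0 < d 0 1 0 & 0 < d 1 0 0].

Let r0 : rev_ord (0 : 'I_2) = 1. Proof. exact: val_inj. Qed.
Let r1 : rev_ord (1 : 'I_2) = 0. Proof. exact: val_inj. Qed.

Lemma skorokhod_lipschitz : exists2 K : R, 0 < K &
  forall X Z X' Z' (T e : R), sp_solution d X Z -> sp_solution d X' Z' ->
  (forall (t : R) i, 0 <= t <= T -> `|X t i 0 - X' t i 0| <= e) ->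
  forall (t : R) i, 0 <= t <= T -> `|Z t i 0 - Z' t i 0| <= K * e.
Proof.
case: dichotomy => [h|[h ? ?]].
  by apply: skorokhod_lipschitz_contraction => //; rewrite r0 r1 mulrC.
by apply: skorokhod_lipschitz_parallel => //; rewrite r0 ?r1// mulrC.
Qed.

Lemma inward_halfplane : exists2 v : 'I_2 -> R, forall i, 0 < v i &
  forall i, 0 <= v i + v (rev_ord i) * d i (rev_ord i) 0.
Proof.
set a := d 0 1 0; set c := d 1 0 0.
(* For v = (1, s) the conditions read s + c >= 0 and 1 + s a >= 0. In the first case s exceeds |c|,
   hence is positive, while s |a| stays at most 1; in the parallel case a and c are positive. *)
pose s : R := if `|a * c| < 1 then `|c| + (1 - `|a * c|) / (1 + `|a|) else 1.
have a1 : 0 < 1 + `|a| by rewrite ltr_pwDl.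
have [s0 cs sa] : [/\ 0 < s, 0 <= s + c & 0 <= 1 + s * a].
  rewrite /s; case: ifPn => [ac|/negP ac]; last first.
    by case: dichotomy => [//|[_ ? ?]]; split; rewrite /a /c; lra.
  have p : 0 < (1 - `|a * c|) / (1 + `|a|) by rewrite divr_gt0// subr_gt0.
  have c0 := normr_ge0 c.
  have /ler_normlP[? ?] : `|c| <= `|c| by [].
  split; [lra|lra|].
  have : `|(`|c| + (1 - `|a * c|) / (1 + `|a|)) * a| <= 1.
    rewrite normrM ger0_norm; last lra.
    rewrite mulrDl -mulrA [`|a * c|]normrM (mulrC `|c|).
    have : (1 + `|a|)^-1 * `|a| <= 1.
      by rewrite mulrC ler_pdivrMr//; lra.
    have := ac; rewrite normrM => h1 h2.
    have h3 : (1 - `|a| * `|c|) * ((1 + `|a|)^-1 * `|a|) <= (1 - `|a| * `|c|) * 1.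
      by apply: ler_wpM2l => //; lra.
    by lra.
  by rewrite ler_norml; lra.
exists (fun i => if i == 0 then 1 else s).
  by move=> i; case: ifP.
by move=> i; case: (ord2P 0 i) => ->; rewrite ?r0 ?r1/= -?/a -?/c ?mul1r.
Qed.

(* The pushing moves along a direction v with <v, d_i> >= 0, so that
   <v, Z> - <v, X> is nondecreasing while <v, Z> is minimal at the corner. *)
Lemma corner_running_min (v : 'I_2 -> R) X Z (s t : R) : (forall i, 0 < v i) ->
  (forall i, 0 <= v i + v (rev_ord i) * d i (rev_ord i) 0) ->
  sp_solution d X Z -> 0 <= s <= t -> Z t = 0 ->
  \sum_i v i * X t i 0 <= \sum_i v i * X s i 0.
Proof.
move=> v0 vd sol /andP[s0]; rewrite le_eqVlt => /predU1P[->//|st] Zt.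
have [|al [al0 _ h]] := pushing_incr d1 sol (_ : 0 <= s < t); first by rewrite s0.
have := h 0; have := h (rev_ord 0); rewrite /pushing Zt !mxE rev_ordK => h1 h0.
rewrite !(sum_ord2 0).
have z0 := sp_ge0 sol s0 0; have z1 := sp_ge0 sol s0 (rev_ord 0).
have := vd 0; have := vd (rev_ord 0); rewrite rev_ordK => k1 k0.
have p0 := mulr_ge0 (al0 0) k0; have p1 := mulr_ge0 (al0 (rev_ord 0)) k1.
have q0 := mulr_ge0 (ltW (v0 0)) z0; have q1 := mulr_ge0 (ltW (v0 (rev_ord 0))) z1.
have e0 : v 0 * X t 0 0 = v 0 * (X s 0 0 - Z s 0 0 -
  (al 0 + al (rev_ord 0) * d (rev_ord 0) 0 0)) by congr (_ * _); lra.
have e1 : v (rev_ord 0) * X t (rev_ord 0) 0 = v (rev_ord 0) * (X s (rev_ord 0) 0 - Z s (rev_ord 0) 0 -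
  (al (rev_ord 0) + al 0 * d 0 (rev_ord 0) 0)) by congr (_ * _); lra.
by rewrite e0 e1; lra.
Qed.

Variable i : 'I_2.
Let j := rev_ord i.
Let c := d j i 0.

(** Face i is idle, so coordinate j is a one-dimensional reflection: after its last zero u the push
    is constant, and Z_j(u) = 0 bounds it by X_j(s) - X_j(u) <= m. *)
Lemma single_face_pushing X Z (s t m : R) : sp_solution d X Z -> 0 <= s < t ->
  (forall u : R, s < u <= t -> 0 < Z u i 0) -> 0 <= m ->
  (forall u : R, s <= u <= t -> - m <= X u j 0 - X s j 0) ->
  exists2 l, 0 <= l <= m &
    Z t i 0 = Z s i 0 + (X t i 0 - X s i 0) + c * l /\
    Z t j 0 = Z s j 0 + (X t j 0 - X s j 0) + l.
Proof.
move=> sol st zi m0 hm.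
have only_j a b : s <= a < b -> b <= t -> exists2 l, 0 <= l &
    [/\ 0 < l -> exists2 u, a < u <= b & Z u j 0 = 0,
      pushing X Z b i - pushing X Z a i = c * l &
      pushing X Z b j - pushing X Z a j = l].
  move=> ab bt; have [|al [al0 alQ h]] := pushing_incr d1 sol (_ : 0 <= a < b); first lra.
  have ali : al i = 0.
    apply/eqP; rewrite eq_le al0 andbT leNgt; apply/negP => /alQ[u ub zu].
    by have := zi u; rewrite zu ltxx => h'; suff : false by []; apply: h'; lra.
  exists (al j) => //; split; first exact: alQ.
    by rewrite h ali add0r mulrC.
  by rewrite h /j rev_ordK ali mul0r addr0.
have [|l l0 [lQ hi hj]] := only_j s t _ (lexx t); first lra.
exists l; last by move: hi hj; rewrite /pushing; lra.
rewrite l0 leNgt; apply/negP => ml.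
have {}lQ : exists2 u : R, s <= u <= t & Z u j 0 = 0.
  by have [|u ut zu] := lQ; [lra|exists u => //; lra].
have s0 : 0 <= s by lra.
have [u [/andP[su ut] zu] hu] := last_zero (sp_cont sol j) s0 lQ.
have ptu : pushing X Z t j = pushing X Z u j.
  have [->//|u_neq] := eqVneq u t.
  have [|l' l'0 [l'Q _ hl]] := only_j u t _ (lexx t).
    by rewrite su lt_neqAle u_neq.
  suff : l' <= 0 by lra.
  rewrite leNgt; apply/negP => /l'Q[w /hu wn zw].
  by rewrite zw eqxx in wn.
have := hm u; have := sp_ge0 sol s0 j.
move: hj ptu; rewrite /pushing zu => hj ptu zs hu'.
have := hu' _.
lra.
Qed.

(** Each of the n windows has size eta ^+ 2 in time and eta in space, so that by Brownian scaling
    the probability of a tube does not degenerate as eta tends to 0. The rise of coordinate j is at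
    least half the fall of coordinate i. *)
Definition tube (M eta : R) n (s : R) (X : R -> 'cV[R]_2) :=
  forall l, (l < n)%N ->
    let u := s + l%:R * eta ^+ 2 in
    [/\ - (2 * eta) <= X (u + eta ^+ 2) i 0 - X u i 0 <= - eta,
        eta <= X (u + eta ^+ 2) j 0 - X u j 0 <= 2 * eta
      & forall w : R, u <= w <= u + eta ^+ 2 -> forall k,
          `|X w k 0 - X u k 0| <= M * eta].

Lemma tube_nodes M eta n s X : tube M eta n s X -> forall l, (l <= n)%N ->
  let u := s + l%:R * eta ^+ 2 in
  - (2 * l%:R * eta) <= X u i 0 - X s i 0 <= - (l%:R * eta) /\
  l%:R * eta <= X u j 0 - X s j 0 <= 2 * l%:R * eta.
Proof.
move=> tb; elim=> [_|l IH ln] /=; first by rewrite !mul0r mulr0 addr0 mul0r; lra.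
have [hi hj _] := tb l ln; have [ki kj] := IH (ltnW ln).
rewrite -(natr1 l) (_ : s + (l%:R + 1) * eta ^+ 2 = s + l%:R * eta ^+ 2 + eta ^+ 2); last by ring.
move: hi hj ki kj => /=.
by rewrite !mulrDr !mulrDl !mul1r; lra.
Qed.

(** At the nodes X_j + X_i / 2 has not decreased, since each window raises X_j by at least eta and
    lowers X_i by at most 2 * eta; inside a window the oscillation costs at most M * eta per
    coordinate. *)
Lemma tube_bounds M eta n s X (u : R) : 0 < eta -> 0 <= M -> tube M eta n s X ->
  s <= u <= s + n%:R * eta ^+ 2 ->
  - (M * eta) <= X u j 0 - X s j 0 /\
  - (2 * (M * eta)) <= (X u j 0 - X s j 0) + (X u i 0 - X s i 0) / 2.
Proof.
move=> eta0 M0 tb /andP[su un].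
have Me : 0 <= M * eta by rewrite mulr_ge0// ltW.
have [->|s_neq] := eqVneq u s; first by rewrite !subrr mul0r; lra.
have e2 : 0 < eta ^+ 2 by rewrite exprn_gt0.
pose l := Num.truncn ((u - s) / eta ^+ 2).
have us0 : 0 <= (u - s) / eta ^+ 2 by rewrite divr_ge0 ?ltW//; lra.
have /andP[l1 l2] := truncn_itv us0.
rewrite -/l ler_pdivlMr// in l1; rewrite -/l ltr_pdivrMr// in l2.
have core k : (k < n)%N -> s + k%:R * eta ^+ 2 <= u <= s + k%:R * eta ^+ 2 + eta ^+ 2 ->
  - (M * eta) <= X u j 0 - X s j 0 /\
  - (2 * (M * eta)) <= (X u j 0 - X s j 0) + (X u i 0 - X s i 0) / 2.
  move=> kn uk; have [_ _ /(_ u uk) h] := tb k kn.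
  have [hi hj] := tube_nodes tb (ltnW kn).
  have ke : 0 <= k%:R * eta by rewrite mulr_ge0// ltW.
  by move: (h i) (h j) hi hj; rewrite !ler_norml -mulrA /=; lra.
have [ln|nl] := ltnP l n.
  by apply: (core l ln); rewrite -(natr1 l) mulrDl mul1r in l2; lra.
have n0 : (0 < n)%N.
  rewrite lt0n; apply/eqP => n0; move: un s_neq; rewrite n0 mul0r addr0 => us.
  by rewrite eq_le us su.
(* An index beyond the last window occurs only at the right end of the tube, which belongs to that
   window. *)
apply: (core n.-1); first by rewrite prednK.
have : n%:R * eta ^+ 2 <= l%:R * eta ^+ 2 by apply: ler_wpM2r; rewrite ?ler_nat// ltW.
have : n%:R = n.-1%:R + 1 :> R by rewrite natr1 prednK.
by move=> nE; rewrite nE mulrDl mul1r in un *; lra.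
Qed.

(* While Z_i stays positive only face j pushes, by at most M * eta; as the tube
   lowers X_i by n * eta altogether, Z_i cannot remain positive to its end. *)
Lemma tube_exit M eta n s t X Z : 0 < eta -> 0 <= M -> tube M eta n s X ->
  sp_solution d X Z -> 0 <= s < t -> (forall u : R, s < u <= t -> 0 < Z u i 0) ->
  Z s i 0 + `|c| * (M * eta) < n%:R * eta ->
  t < s + n%:R * eta ^+ 2 /\
  (Z s i 0 + Z s j 0) / 2 - (2 + `|c|) * (M * eta) <= Z t i 0 + Z t j 0.
Proof.
move=> eta0 M0 tb sol st zi hn.
have Me : 0 <= M * eta by rewrite mulr_ge0// ltW.
have push b : s < b <= t -> b <= s + n%:R * eta ^+ 2 -> exists2 l, 0 <= l <= M * eta &
    Z b i 0 = Z s i 0 + (X b i 0 - X s i 0) + c * l /\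
    Z b j 0 = Z s j 0 + (X b j 0 - X s j 0) + l.
  move=> sb bn; apply: single_face_pushing => //; first lra.
    by move=> u ub; apply: zi; lra.
  by move=> u ub; have [] := @tube_bounds M eta n s X u eta0 M0 tb; lra.
have cl l : 0 <= l <= M * eta -> `|c * l| <= `|c| * (M * eta).
  by move=> lM; rewrite normrM ler_wpM2l// ger0_norm; lra.
have tn : t < s + n%:R * eta ^+ 2.
  rewrite ltNge; apply/negP => nt.
  have n0 : 0 < n%:R * eta ^+ 2 :> R.
    rewrite expr2 mulrA mulr_gt0//; apply: le_lt_trans hn.
    have s0 : 0 <= s by lra.
    by rewrite addr_ge0 ?(sp_ge0 sol s0)// mulr_ge0.
  have [||l lM [zbi _]] := push (s + n%:R * eta ^+ 2); [lra|lra|].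
  have := zi (s + n%:R * eta ^+ 2); rewrite zbi => h.
  have /andP[_ xb] := (tube_nodes tb (leqnn n)).1.
  have := cl l lM; rewrite ler_norml => hl.
  have := h _.
  lra.
split => //.
have [||l lM [zti ztj]] := push t; [lra|lra|].
(* The sum is bounded through Z_j + Z_i / 2, along which the tube has no net descent; the push adds
   l + c * l / 2 with 0 <= l <= M * eta. *)
have [_ h2] := @tube_bounds M eta n s X t eta0 M0 tb ltac:(lra).
have zt0 := zi t ltac:(lra).
have zsi : 0 <= Z s i 0 by apply: (sp_ge0 sol); lra.
have := cl l lM; rewrite ler_norml => hl.
have cM : 0 <= `|c| * (M * eta) by rewrite mulr_ge0.
have zsj : 0 <= Z s j 0 by apply: (sp_ge0 sol); lra.
lra.
Qed.

End ReflectionGeometry.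

(** * Filtrations and adapted events *)

Section Filtration.
Context {disp : measure_display} {T : measurableType disp} {R : realType}.
Variables (P : probability T R) (F : R -> set (set T)).
Hypothesis hF : usual_filtration P F.
Implicit Types (A B : set T) (s t : R).

Lemma filtration_measurable t A : 0 <= t -> F t A -> measurable A.
Proof. by move=> t0; case: hF => /(_ t t0)[_ h] _ _ _; exact: h. Qed.

Lemma filtration_le s t A : 0 <= s <= t -> F s A -> F t A.
Proof. by move=> st; case: hF => _ /(_ s t st) h _ _; exact: h. Qed.

Lemma filtration_setC t A : 0 <= t -> F t A -> F t (~` A).
Proof. by move=> t0; case: hF => /(_ t t0)[[_ h _] _] _ _ _ /h; rewrite setTD. Qed.

Lemma filtration_bigcup t (A : (set T)^nat) : 0 <= t -> (forall n, F t (A n)) ->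
  F t (\bigcup_n A n).
Proof. by move=> t0; case: hF => /(_ t t0)[[_ _ h] _] _ _ _; exact: h. Qed.

Lemma filtration_negligible t A : 0 <= t -> P.-negligible A -> F t A.
Proof.
move=> t0 nA; case: (hF) => _ _ _ /(_ A nA).
by apply: filtration_le; rewrite lexx t0.
Qed.

Lemma filtration_right_cont t A : 0 <= t -> (forall s, t < s -> F s A) -> F t A.
Proof.
move=> t0 h; case: hF => _ _ /(_ t t0) -> _ s /=.
by rewrite in_itv/= andbT; exact: h.
Qed.

Lemma filtration_set0 t : 0 <= t -> F t set0.
Proof. by move=> t0; apply: filtration_negligible => //; exact: negligible_set0. Qed.

Lemma filtration_setT t : 0 <= t -> F t setT.
Proof. by move=> t0; rewrite -setC0; apply: filtration_setC => //; exact: filtration_set0. Qed.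

Lemma filtration_countable_union t (I : countType) (A : I -> set T) : 0 <= t ->
  (forall i, F t (A i)) -> F t (\bigcup_i A i).
Proof.
move=> t0 FA.
rewrite (_ : \bigcup_i A i = \bigcup_n oapp A set0 (unpickle n)).
  apply: filtration_bigcup => // n; case: unpickle => //=.
  exact: filtration_set0.
apply/seteqP; split=> w [i _ Aiw]; first by exists (pickle i) => //; rewrite pickleK.
by move: Aiw; case: unpickle => //= k Ak; exists k.
Qed.

Lemma filtration_countable_inter t (I : countType) (A : I -> set T) : 0 <= t ->
  (forall i, F t (A i)) -> F t (\bigcap_i A i).
Proof.
move=> t0 FA; rewrite -[X in F t X]setCK; apply: filtration_setC => //.
rewrite setC_bigcap; apply: filtration_countable_union => // i.
exact: filtration_setC.
Qed.

Lemma filtration_setU t A B : 0 <= t -> F t A -> F t B -> F t (A `|` B).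
Proof.
move=> t0 FA FB; rewrite (_ : A `|` B = \bigcup_(b : bool) (if b then A else B)).
  by apply: filtration_countable_union => // -[].
apply/seteqP; split=> w; first by case=> ?; [exists true|exists false].
by case=> -[] _ ?; [left|right].
Qed.

Lemma filtration_setI t A B : 0 <= t -> F t A -> F t B -> F t (A `&` B).
Proof.
move=> t0 FA FB; rewrite (_ : A `&` B = \bigcap_(b : bool) (if b then A else B)).
  by apply: filtration_countable_inter => // -[].
apply/seteqP; split=> w; first by case=> ? ? [].
by move=> h; split; [exact: (h true)|exact: (h false)].
Qed.

(** Since [F 0] contains the negligible sets, events need only be described off the exceptional
    set. *)
Lemma filtration_eq_ae t A B N : 0 <= t -> P.-negligible N -> F t A ->
  A `\` N = B `\` N -> F t B.
Proof.
move=> t0 nN FA AB.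
have FN := filtration_negligible t0 nN.
rewrite (_ : B = (A `\` N) `|` (B `&` N)).
  apply: filtration_setU => //.
    by rewrite setDE; apply: filtration_setI => //; exact: filtration_setC.
  by apply: filtration_negligible => //; apply: negligibleS nN; exact: subIsetr.
by rewrite AB setUC setUIDK.
Qed.

End Filtration.

Section OpenEvents.
Context {disp : measure_display} {T : measurableType disp} {R : realType}.
Variables (P : probability T R) (F : R -> set (set T)).
Hypothesis hF : usual_filtration P F.
Variable X : R -> T -> 'cV[R]_2.
Hypothesis adapted : forall (t c e : R) i, 0 <= t ->
  F t [set w | `|X t w i 0 - c| <= e].
Variable N : set T.
Hypothesis negN : P.-negligible N.
Hypothesis contX : forall w, ~ N w -> forall i, path_continuous (fun t => X t w i 0).

Let lerq1 (q : rat) : (ratr q <= 1 :> R) = (q <= 1).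
Proof. by rewrite -[1 in LHS](rmorph1 (ratr : rat -> R)) ler_rat. Qed.

(* A set of paths that is open for the uniform distance on [0, s] is a countable
   union of tubes around rational step functions. *)
Lemma open_event_adapted (s : R) (O : set T) : 0 <= s ->
  (forall w, ~ N w -> O w -> exists2 e : R, 0 < e & forall w', ~ N w' ->
     (forall (u : R) i, 0 <= u <= s -> `|X u w' i 0 - X u w i 0| <= e) -> O w') ->
  F s O.
Proof.
move=> s0 hO.
(* A code (n, m, values) stands for a rational step function with cells of length s / (n + 1), and
   for the tube of radius 1 / (m + 1) around it. *)
pose step (p : nat * nat * seq (rat * rat)) (q : rat) (i : 'I_2) : R :=
  let v := nth (0, 0) p.2 (Num.truncn (ratr q * p.1.1.+1%:R : R)) in
  ratr (if i == 0 then v.1 else v.2).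
pose B (p : nat * nat * seq (rat * rat)) := [set w | forall (q : rat), 0 <= q <= 1 ->
  forall i, `|X (s * ratr q) w i 0 - step p q i| <= p.1.2.+1%:R^-1].
have FB p : F s (B p).
  rewrite (_ : B p = \bigcap_(q : rat) \bigcap_(i : 'I_2) (if 0 <= q <= 1 then
    [set w | `|X (s * ratr q) w i 0 - step p q i| <= p.1.2.+1%:R^-1] else setT)).
    apply: (filtration_countable_inter hF) => // q; apply: (filtration_countable_inter hF) => // i.
    case: ifPn => [/andP[q0 q1]|_]; last exact: (filtration_setT hF).
    have sq0 : 0 <= s * ratr q by rewrite mulr_ge0// ler0q.
    apply: (filtration_le hF (s := s * ratr q)); last exact: adapted.
    by rewrite sq0/= ler_piMr// lerq1.
  apply/seteqP; split=> w Bw.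
    by move=> q _ i _; case: ifPn => // q01; exact: (Bw q q01 i).
  by move=> q q01 i; have := Bw q I i I; rewrite q01.
(* Only the codes whose tube lies in [O] off [N] are kept; there are countably many. *)
pose U := \bigcup_(p : nat * nat * seq (rat * rat))
  (if `[< B p `\` N `<=` O >] then B p else set0).
have FU : F s U.
  apply: (filtration_countable_union hF) => // p; case: ifPn => // _.
  exact: (filtration_set0 hF).
apply: (filtration_eq_ae hF s0 negN FU).
apply/seteqP; split=> w [Aw nw]; split => //.
  by case: Aw => p _; case: ifPn => // /asboolP h Bw; exact: h.
have [e e0 he] := hO w nw Aw.
have e20 : 0 < e / 2 by lra.
pose m := Num.truncn ((e / 2)^-1).
have m1 : m.+1%:R^-1 < e / 2.
  rewrite invf_plt ?posrE//; exact: truncnS_gt.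
set r : R := m.+1%:R^-1 in m1.
have r0 : 0 < r by rewrite invr_gt0.
have r20 : 0 < r / 2 by lra.
have [d0 d00 hd0] := path_uniformly_continuous s (contX nw 0) r20.
have [d1 d10 hd1] := path_uniformly_continuous s (contX nw (rev_ord 0)) r20.
pose del := Num.min d0 d1.
have del0 : 0 < del by rewrite lt_min d00.
pose n := Num.truncn (s / del).
have n0 : 0 < n.+1%:R :> R by [].
have sn : s / n.+1%:R < del.
  by rewrite ltr_pdivrMr// mulrC -ltr_pdivrMr//; exact: truncnS_gt.
have /choice[appr apprP] : forall y : R, exists q : rat, `|ratr q - y| < r / 2.
  move=> y; have /rat_in_itvoo[q] : y - r / 2 < y + r / 2 by lra.
  by rewrite in_itv/= => qy; exists q; rewrite ltr_norml; lra.
pose g (l : nat) := s * (l%:R / n.+1%:R).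
(* At q = 1 the cell index equals n + 1, hence n + 2 values. *)
pose N2 := n.+2.
pose p : nat * nat * seq (rat * rat) := (n, m,
  [seq (appr (X (g l) w 0 0), appr (X (g l) w (rev_ord 0) 0)) | l <- iota 0 N2]).
have Bpw : B p w.
  move=> q /andP[q0 q1] i.
  have qR0 : 0 <= (ratr q : R) by rewrite ler0q.
  have qR1 : (ratr q : R) <= 1 by rewrite lerq1.
  pose l := Num.truncn (ratr q * n.+1%:R : R).
  have qn0 : 0 <= ratr q * n.+1%:R :> R by rewrite mulr_ge0.
  have /andP[l1 l2] := truncn_itv qn0.
  rewrite -/l in l1 l2.
  have ln : (l < N2)%N.
    rewrite -(ltr_nat R); apply: le_lt_trans l1 _.
    apply: (@le_lt_trans _ _ n.+1%:R); last by rewrite ltr_nat.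
    by rewrite ler_piMl.
  have gl : 0 <= g l <= s.
    rewrite /g mulr_ge0 ?divr_ge0//= ler_piMr// ler_pdivrMr// mul1r.
    by apply: le_trans l1 _; rewrite ler_piMl.
  have sq : 0 <= s * ratr q <= s by rewrite mulr_ge0//= ler_piMr.
  have close : `|s * ratr q - g l| < del.
    apply: le_lt_trans sn; rewrite /g -mulrBr normrM ger0_norm//.
    rewrite ler_wpM2l// ger0_norm.
      rewrite lerBlDr (_ : _ + _ = l.+1%:R / n.+1%:R); last first.
        by rewrite -(natr1 l) mulrDl mul1r addrC.
      by rewrite ler_pdivlMr// ltW.
    by rewrite subr_ge0 ler_pdivrMr.
  have stepE : step p q i = ratr (appr (X (g l) w i 0)).
    rewrite /step -[Num.truncn _]/l -[p.2]/[seq _ | _ <- iota 0 N2].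
    rewrite (nth_map 0%N) ?size_iota// nth_iota// add0n.
    by case: (ord2P 0 i) => ->.
  rewrite stepE.
  have a1 := apprP (X (g l) w i 0).
  have a2 : `|X (s * ratr q) w i 0 - X (g l) w i 0| < r / 2.
    move: close; rewrite lt_min => /andP[c0 c1].
    by case: (ord2P 0 i) => ->; [exact: hd0|exact: hd1].
  rewrite (_ : _ - _ = (X (s * ratr q) w i 0 - X (g l) w i 0) -
    (ratr (appr (X (g l) w i 0)) - X (g l) w i 0)); last by ring.
  by rewrite (le_trans (ler_normB _ _))// -/r; lra.
exists p => //; rewrite ifT//; apply/asboolP => w' [Bpw' nw'].
apply: he => // u i us.
have cB := path_continuousB (contX nw' i) (contX nw i).
suff h (q : rat) : (0 <= q <= 1)%R ->
    `|X (s * ratr q) w' i 0 - X (s * ratr q) w i 0| <= e.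
  rewrite ler_norml lerNl opprB; apply/andP; split.
    apply: (rational_dense_le (path_continuousB (contX nw i) (contX nw' i)) s0 _ us).
    by move=> q /h; rewrite ler_norml; lra.
  by apply: (rational_dense_le cB s0 _ us) => q /h; rewrite ler_norml; lra.
move=> q01.
have b1 := Bpw q q01 i; have b2 := Bpw' q q01 i.
rewrite (_ : _ - _ = (X (s * ratr q) w' i 0 - step p q i) -
  (X (s * ratr q) w i 0 - step p q i)); last by ring.
by rewrite (le_trans (ler_normB _ _))//; move: b1 b2; rewrite /= -/r; lra.
Qed.

End OpenEvents.

(** * Gaussian increments *)

Section NormalScaling.
Context {R : realType}.

(** Normalised increments have one law whatever the time step, which makes the probabilities below
    uniform in the scale. *)
Lemma normal_prob_scale (s a b : R) : 0 < s -> a < b ->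
  normal_prob 0 s `[s * a, s * b] = normal_prob 0 1 `[a, b].
Proof.
move=> s0 ab; rewrite /normal_prob.
have F'E : ((fun x : R => s * x)^`())%classic = cst s.
  apply/funext => x; rewrite derive1E deriveM// derive_cst derive_id.
  rewrite !scaler0 addr0 /GRing.scale/= mulr1//.
rewrite (@integration_by_substitution_increasing _ (fun x : R => s * x) (normal_pdf 0 s) a b).
- apply: eq_integral => x _; congr EFin.
  rewrite F'E !fctE /= !normal_pdfE ?gt_eqF// /normal_peak /normal_fun !subr0 expr1n mul1r.
  rewrite -mulrnAr sqrtrM ?sqr_ge0// sqrtr_sqr gtr0_norm//.
  rewrite (_ : - (s * x) ^+ 2 / _ = - x ^+ 2 / (1 *+ 2)); last first.
    by field; rewrite gt_eqF.
  rewrite invfM; field.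
  by rewrite !gt_eqF// sqrtr_gt0 pmulrn_lgt0// pi_gt0.
- exact: ltW.
- by move=> x y _ _ xy; rewrite ltr_pM2l.
- by rewrite F'E => x _; exact: cst_continuous.
- by rewrite F'E; exact: is_cvg_cst.
- by rewrite F'E; exact: is_cvg_cst.
- split.
  + by move=> x _; exact: derivableM.
  + by apply: cvg_at_right_filter; apply: cvgM; [exact: cvg_cst|exact: cvg_id].
  + by apply: cvg_at_left_filter; apply: cvgM; [exact: cvg_cst|exact: cvg_id].
- by apply: continuous_subspaceT => x; apply: continuous_normal_pdf; rewrite gt_eqF.
Qed.

Lemma normal_prob_itv_gt0 (a b : R) : a < b -> (0 < normal_prob 0 1 `[a, b])%E.
Proof.
move=> ab; pose m : R := `|a| + `|b|.
pose k : R := normal_peak 1 * expR (- m ^+ 2 / 2).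
have k0 : 0 < k by rewrite mulr_gt0 ?expR_gt0// normal_peak_gt0// oner_neq0.
apply: (@lt_le_trans _ _ (\int[lebesgue_measure]_(x in `[a, b]) k%:E)%E).
  rewrite integral_cst//= lebesgue_measure_itv/= lte_fin ab -EFinB -EFinM lte_fin.
  by rewrite mulr_gt0// subr_gt0.
rewrite /normal_prob; apply: ge0_le_integral => //.
- by move=> x _; rewrite lee_fin ltW.
- by apply/measurable_EFinP/measurable_funTS; exact: measurable_normal_pdf.
- move=> x; rewrite /= in_itv/= => /andP[ax xb].
  rewrite lee_fin normal_pdfE ?oner_neq0// /k ler_pM2l ?normal_peak_gt0 ?oner_neq0//.
  rewrite /normal_fun ler_expR subr0 expr1n ler_pM2r ?invr_gt0// lerN2.
  have xm : `|x| <= m.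
    have h1 := ler_norm b; have h2 := ler_norm (- a); rewrite normrN in h2.
    have h3 := normr_ge0 a; have h4 := normr_ge0 b.
    by rewrite ler_norml /m; lra.
  by rewrite -real_normK ?num_real// ler_sqr ?nnegrE// (le_trans _ xm).
Qed.

Lemma normal_prob_tail (e : R) : 0 < e ->
  exists2 M : R, 0 < M & ((1 - e)%:E <= normal_prob 0 1 `[(- M)%R, M])%E.
Proof.
move=> e0.
pose A (n : nat) := `[- n%:R, n%:R]%classic : set R.
have AT : \bigcup_n A n = setT.
  apply/seteqP; split=> // x _; exists (Num.bound `|x|) => //.
  by rewrite /A /= in_itv/= -ler_norml ltW// archi_boundP.
have ndA : nondecreasing_seq A.
  move=> m n mn; rewrite subsetEset => x; rewrite /A/= !in_itv/= => /andP[h1 h2].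
  have : m%:R <= n%:R :> R by rewrite ler_nat.
  by lra.
have mA n : measurable (A n : set (measurableTypeR R)) by exact: measurable_itv.
have := @nondecreasing_cvg_mu _ _ _ (normal_prob (0 : R) 1) A mA _ ndA.
rewrite AT => /(_ measurableT) cvgA.
have NT : normal_prob (0 : R) 1 setT = 1%E by exact: probability_setT.
have : normal_prob (0 : R) 1 \o A @ \oo --> (1%E : \bar R) by rewrite -NT.
move=> /fine_cvgP[finA /cvgrPdist_lt/(_ e e0) [n _ hn]].
have [n1 _ hn1] := finA.
pose k := maxn 1 (maxn n n1).
have kn : (n <= k)%N by rewrite /k leq_max leq_maxl orbT.
have kn1 : (n1 <= k)%N by rewrite /k leq_max leq_maxr orbT.
exists k%:R; first by rewrite ltr0n leq_max.
have := hn k kn; have := hn1 k kn1 => /= finAk; rewrite -[X in (_ <= X)%E]fineK//.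
by rewrite lee_fin ltr_norml => /andP[_]; rewrite /A /=; lra.
Qed.

End NormalScaling.

(** * Real-valued probabilities and null sets *)

Section RealProbability.
Context {disp : measure_display} {T : measurableType disp} {R : realType}.
Variable P : probability T R.
Implicit Types A B : set T.

Definition pr A : R := fine (P A).

Lemma prE A : measurable A -> P A = (pr A)%:E.
Proof. by move=> mA; rewrite fineK// fin_num_measure. Qed.

Lemma pr_ge0 A : 0 <= pr A.
Proof. exact/fine_ge0/measure_ge0. Qed.

Lemma pr_le A B : measurable A -> measurable B -> A `<=` B -> pr A <= pr B.
Proof. by move=> mA mB AB; rewrite -lee_fin -!prE// le_measure ?inE. Qed.

Lemma pr_le1 A : measurable A -> pr A <= 1.
Proof. by move=> mA; rewrite -lee_fin -prE// probability_le1. Qed.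

Lemma pr_split A B : measurable A -> measurable B -> pr A = pr (A `&` B) + pr (A `\` B).
Proof.
move=> mA mB; apply: EFin_inj; rewrite EFinD -!prE//; first by rewrite addeC -measureDI.
  exact: measurableD.
exact: measurableI.
Qed.

Lemma prU_le A B : measurable A -> measurable B -> pr (A `|` B) <= pr A + pr B.
Proof.
move=> mA mB; rewrite (pr_split (measurableU _ _ mA mB) mA) setUK; apply: lerD => //.
apply: pr_le => //; first by apply: measurableD => //; exact: measurableU.
by move=> w [[]].
Qed.

Lemma pr_negligible A : measurable A -> pr A = 0 -> P.-negligible A.
Proof.
move=> mA A0; apply/(negligibleP P mA).
by have := prE mA; rewrite A0.
Qed.

Lemma pr_bigsetU (A : (set T)^nat) n : (forall l, (l < n)%N -> measurable (A l)) ->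
  trivIset [set: nat] A -> pr (\big[setU/set0]_(l < n) A l) = \sum_(l < n) pr (A l).
Proof.
elim: n => [|n IH] mA tA; first by rewrite !big_ord0 /pr measure0.
have mU : measurable (\big[setU/set0]_(l < n) A l).
  by apply: bigsetU_measurable => l _; apply: mA; apply: ltnW; rewrite ltnS.
have mn : measurable (A n) by exact: mA.
rewrite !big_ord_recr /= -IH// => [|l ln]; last by apply: mA; exact: ltnW.
rewrite (pr_split (measurableU _ _ mU mn) mU) setUK; congr (_ + pr _).
apply/seteqP; split=> w; first by case=> -[].
move=> Aw; split; [by right|move=> /=; rewrite -bigcup_mkord => -[l /= ln Al]].
have := tA l n I I; rewrite (_ : l = n :> nat) ?ltnn in ln *; last first.
  by apply: tA => //; exists w.
by [].
Qed.

Lemma pr_bigcup_le (A : (set T)^nat) (a : R) : (forall n, measurable (A n)) ->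
  nondecreasing_seq A -> (forall n, pr (A n) <= a) -> pr (\bigcup_n A n) <= a.
Proof.
move=> mA ndA h; have mU := bigcupT_measurable A mA.
rewrite -lee_fin -prE//.
have /cvg_lim <- // := nondecreasing_cvg_mu (mu := P) mA mU ndA.
apply: lime_le.
  apply: ereal_nondecreasing_is_cvgn => m n mn; apply: le_measure; rewrite ?inE//; apply/subsetPset; exact: ndA.
by apply: nearW => n /=; rewrite prE// lee_fin.
Qed.

Lemma negligible_countable_bigcup (I : countType) (A : I -> set T) :
  (forall i, P.-negligible (A i)) -> P.-negligible (\bigcup_i A i).
Proof.
move=> nA; have nB n : P.-negligible (oapp A set0 (unpickle n)).
  by case: unpickle => //=; exact: negligible_set0.
apply: negligibleS (negligible_bigcup nB) => w [i _ Aiw].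
by exists (pickle i) => //; rewrite pickleK.
Qed.

(** The index m stands for the fineness of a grid. The rank from which [D m] contains a point may
    depend on the point, so it is the liminf of the [D m] that contains [E]; as an increasing union
    of intersections it still has probability at most e. No measurability of [E] is assumed. *)
Lemma negligible_liminf (E : set T) :
  (forall e : R, 0 < e -> exists D : (set T)^nat,
     (forall m, measurable (D m) /\ pr (D m) <= e) /\
     (forall w, E w -> exists M, forall m, (M <= m)%N -> D m w)) ->
  P.-negligible E.
Proof.
move=> h.
pose eps (n : nat) : R := n.+1%:R^-1.
have eps0 n : 0 < eps n by rewrite invr_gt0.
have /choice[D hD] : forall n, exists D : (set T)^nat,
     (forall m, measurable (D m) /\ pr (D m) <= eps n) /\
     (forall w, E w -> exists M, forall m, (M <= m)%N -> D m w).
  by move=> n; exact: h.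
pose L n := \bigcup_M \bigcap_(m in [set m | (M <= m)%N]) D n m.
have mC n M : measurable (\bigcap_(m in [set m | (M <= m)%N]) D n m).
  by apply: bigcap_measurableType => m _; exact: ((hD n).1 m).1.
have mL n : measurable (L n) by exact: bigcupT_measurable.
have pL n : pr (L n) <= eps n.
  apply: pr_bigcup_le => //.
    move=> M M' MM; rewrite subsetEset => w hw m /= Mm; apply: hw.
    exact: leq_trans MM Mm.
  move=> M; apply: le_trans ((hD n).1 M).2; apply: pr_le => //.
    exact: ((hD n).1 M).1.
  by move=> w hw; apply: hw => /=.
have mI : measurable (\bigcap_n L n) by exact: bigcapT_measurable.
have : P.-negligible (\bigcap_n L n).
  apply: pr_negligible => //; apply/eqP; rewrite eq_le pr_ge0 andbT.
  rewrite leNgt; apply/negP => hp.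
  have := archi_boundP (ltac:(by rewrite invr_ge0 ltW) : 0 <= (pr (\bigcap_n L n))^-1).
  set n := Num.bound _ => hn.
  have h1 : pr (\bigcap_n L n) <= eps n.
    by apply: le_trans (pL n); apply: pr_le => // w hw; exact: hw.
  have h2 : eps n < pr (\bigcap_n L n).
    rewrite /eps invf_plt ?posrE//; apply: lt_trans hn _.
    by rewrite ltr_nat.
  by lra.
apply: negligibleS => w Ew n _.
by have [M hM] := (hD n).2 w Ew; exists M.
Qed.

Definition first_hit (B : (set T)^nat) l : set T :=
  [set w | B l w /\ forall l', (l' < l)%N -> ~ B l' w].

Lemma trivIset_first_hit (B : (set T)^nat) : trivIset [set: nat] (first_hit B).
Proof.
move=> l l' _ _ [w [[a1 a2] [a3 a4]]].
by case: (ltngtP l l') => // ll; [case: (a4 l ll)|case: (a2 l' ll)].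
Qed.

Lemma first_hit_exists (B : (set T)^nat) l w : B l w -> exists2 l', (l' <= l)%N & first_hit B l' w.
Proof.
move=> Bl; have ex : exists l, `[< B l w >] by exists l; apply/asboolP.
have := ex_minnP ex => -[l' /asboolP hl lmin].
exists l'; first by apply: lmin; apply/asboolP.
split => // k kl /asboolP/lmin; by rewrite leqNgt kl.
Qed.

End RealProbability.

(** Tonelli for the indicator of [C]: integrating the sections in either order gives the product
    measure, here 0. *)
Lemma null_section_swap d1 d2 (T1 : measurableType d1) (T2 : measurableType d2)
    (R : realType) (m1 : {sigma_finite_measure set T1 -> \bar R})
    (m2 : {sigma_finite_measure set T2 -> \bar R}) (C : set (T1 * T2)) :
  measurable C -> (forall t, m2 (xsection C t) = 0%E) ->
  m2.-negligible [set w | m1 (ysection C w) != 0%E].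
Proof.
move=> mC h.
have e : (m1 \x^ m2)%E C = 0%E.
  rewrite -[LHS](_ : (m1 \x m2)%E C = _).
    by rewrite /product_measure1 integral0_eq// => t _ /=.
  by apply: product_measure_unique => //= ? ? ? ?; rewrite product_measure2E.
have mf := measurable_fun_ysection m1 mC.
have : (\int[m2]_y `|(m1 \o ysection C) y| = 0)%E.
  rewrite -[RHS]e /product_measure2; apply: eq_integral => y _.
  by rewrite gee0_abs//=.
move=> /(ae_eq_integral_abs m2 measurableT mf); apply: negligibleS => w /= hw.
by move=> /(_ I)/= h0; rewrite h0 eqxx in hw.
Qed.

(** * Increments of the drifted Brownian motion *)

Section DriftedBrownian.
Context {disp : measure_display} {T : measurableType disp} {R : realType}.
Variables (P : probability T R) (F : R -> set (set T)).
Hypothesis hF : usual_filtration P F.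
Variable W : R -> T -> 'cV[R]_2.
Hypothesis hW : brownian_motion P F W.
Variables (x b : 'cV[R]_2) (sigma : 'M[R]_2).
Hypothesis hsigma : sigma *m sigma^T \in unitmx.
Variable X : R -> T -> 'cV[R]_2.
Hypothesis hX : forall t w, 0 <= t -> X t w = x + t *: b + sigma *m W t w.
Variable N : set T.
Hypothesis negN : P.-negligible N.
Hypothesis contX : forall w, ~ N w -> forall i, path_continuous (fun t => X t w i 0).
Local Notation pr := (pr P).

Let W_F t (B : set (R * R)) : 0 <= t -> measurable B ->
  F t [set w | B (coord_pair (W t w))].
Proof. by case: hW => + _ _ _ _; exact. Qed.

Let X_coord t w i : 0 <= t -> X t w i 0 = x i 0 + t * b i 0 +
  (sigma i 0 * W t w 0 0 + sigma i 1 * W t w 1 0).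
Proof.
move=> t0; rewrite hX// !mxE; congr (_ + _).
by rewrite (sum_ord2 0) (_ : rev_ord 0 = 1)//; exact: val_inj.
Qed.

Lemma drifted_adapted (t c e : R) i : 0 <= t -> F t [set w | `|X t w i 0 - c| <= e].
Proof.
move=> t0.
pose f (p : R * R) : R := x i 0 + t * b i 0 - c + (sigma i 0 * p.1 + sigma i 1 * p.2).
have mf : measurable_fun setT f.
  apply: measurable_funD => //; apply: measurable_funD; apply: measurable_funM => //.
have mB : measurable (f @^-1` `[- e, e]).
  by rewrite -[X in measurable X]setTI; exact: mf.
rewrite (_ : [set w | _] = [set w | (f @^-1` `[- e, e]) (coord_pair (W t w))]).
  exact: W_F.
have fE w : f (coord_pair (W t w)) = X t w i 0 - c.
  by rewrite X_coord// /f /coord_pair /=; ring.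
by apply/seteqP; split=> w /=; rewrite in_itv/= ler_norml fE.
Qed.

Lemma open_event (s : R) (O : set T) : 0 <= s ->
  (forall w, ~ N w -> O w -> exists2 e : R, 0 < e & forall w', ~ N w' ->
     (forall (u : R) i, 0 <= u <= s -> `|X u w' i 0 - X u w i 0| <= e) -> O w') ->
  F s O.
Proof. exact: (open_event_adapted hF drifted_adapted negN contX). Qed.

Let W_measurable t k : 0 <= t -> measurable_fun setT (fun w => W t w k 0).
Proof.
move=> t0 _ B mB; rewrite setTI.
pose B' : set (R * R) := if k == 0 then fst @^-1` B else snd @^-1` B.
have mB' : measurable B'.
  rewrite /B'; case: ifP => _; rewrite -[X in measurable X]setTI.
    exact: measurable_fst.
  exact: measurable_snd.
have := W_F t0 mB'.
move=> /(filtration_measurable hF t0); congr measurable.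
rewrite /B'; case: (ord2P 0 k) => -> //=.
by rewrite (_ : rev_ord 0 = 1)//; exact: val_inj.
Qed.

Definition rect (s t : R) (a c : 'I_2 -> R) : set T :=
  [set w | forall k, Num.sqrt (t - s) * a k <= W t w k 0 - W s w k 0 <= Num.sqrt (t - s) * c k].

Lemma rect_measurable s t a c : 0 <= s < t -> measurable (rect s t a c).
Proof.
move=> st; have s0 : 0 <= s by lra. have t0 : 0 <= t by lra.
rewrite (_ : rect s t a c = \bigcap_(k : 'I_2)
  (fun w => W t w k 0 - W s w k 0) @^-1` `[Num.sqrt (t - s) * a k, Num.sqrt (t - s) * c k]).
  apply: fin_bigcap_measurable => // k _; rewrite -[X in measurable X]setTI.
  by apply: measurable_funB => //; exact: W_measurable.
apply/seteqP; split=> w /= h k.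
  by move=> _; rewrite /= in_itv/=; exact: h.
by have := h k I; rewrite /= in_itv/=.
Qed.

(** Independence of the past, independence of the coordinates and scaling combined: given [F s], the
    normalised increment falls in the box with a probability that depends on neither s nor t. *)
Lemma pr_rect (s t : R) a c A : 0 <= s < t -> F s A -> (forall k, a k < c k) ->
  pr (A `&` rect s t a c) = pr A *
    (fine (normal_prob 0 1 `[a 0, c 0]) * fine (normal_prob 0 1 `[a 1, c 1])).
Proof.
move=> st FA ac; have eta0 : 0 < Num.sqrt (t - s) by rewrite sqrtr_gt0; lra.
set eta := Num.sqrt (t - s) in eta0.
pose B : set (R * R) := `[eta * a 0, eta * c 0] `*` `[eta * a 1, eta * c 1].
have mB : measurable B by exact: measurableX.
have rectE : rect s t a c = [set w | B (coord_pair (W t w - W s w))].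
  apply/seteqP; split=> w /=; rewrite /B /coord_pair /= !in_itv/= !mxE.
    by move=> h; split; exact: h.
  move=> [h0 h1] k; case: (ord2P 0 k) => ->; first exact: h0.
  by rewrite (_ : rev_ord 0 = 1)//; exact: val_inj.
case: hW => _ _ _ /(_ s t A B st FA mB) hind /(_ s t B st mB) hlaw.
have mA : measurable A by apply: (filtration_measurable hF _ FA); lra.
have finN a' c' : normal_prob (0 : R) 1 `[a', c'] \is a fin_num.
  exact: (@fin_num_measure _ _ _ (normal_prob (0 : R) 1) _ (measurable_itv _)).
have e : P (A `&` rect s t a c) =
    (P A * (normal_prob 0 1 `[a 0%R, c 0%R] * normal_prob 0 1 `[a 1%R, c 1%R]))%E.
  rewrite rectE hind hlaw.
  transitivity (P A * (normal_prob 0%R eta `[(eta * a 0)%R, (eta * c 0)%R] *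
    normal_prob 0%R eta `[(eta * a 1)%R, (eta * c 1)%R]))%E.
    congr (_ * _)%E.
    by apply: product_measure1E.
  congr (_ * (_ * _))%E.
    exact: (normal_prob_scale eta0 (ac 0)).
  exact: (normal_prob_scale eta0 (ac 1)).
by rewrite /pr e !fineM// ?fin_numM// fin_num_measure.
Qed.

Let sigma_unit : sigma \in unitmx.
Proof.
move: hsigma; rewrite !unitmxE det_mulmx unitrM det_tr.
by case/andP.
Qed.

Let X_incr s t w i : 0 <= s -> 0 <= t -> X t w i 0 - X s w i 0 = (t - s) * b i 0 +
  (sigma i 0 * (W t w 0 0 - W s w 0 0) + sigma i 1 * (W t w 1 0 - W s w 1 0)).
Proof. by move=> s0 t0; rewrite !X_coord//; ring. Qed.

Let S : R := `|sigma 0 0| + `|sigma 0 1| + `|sigma 1 0| + `|sigma 1 1|.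
Let S0 : 0 <= S. Proof. by rewrite /S !addr_ge0. Qed.
Let beta : R := `|b 0 0| + `|b 1 0|.
Let beta0 : 0 <= beta. Proof. by rewrite addr_ge0. Qed.

Let rev01 : rev_ord (0 : 'I_2) = 1. Proof. exact: val_inj. Qed.

Let row_bound i (p q r : R) : `|p| <= r -> `|q| <= r ->
  `|sigma i 0 * p + sigma i 1 * q| <= S * r.
Proof.
move=> pr qr; have r0 : 0 <= r by apply: le_trans pr.
rewrite (le_trans (ler_normD _ _))// !normrM.
have h1 : `|sigma i 0| * `|p| <= `|sigma i 0| * r by rewrite ler_wpM2l.
have h2 : `|sigma i 1| * `|q| <= `|sigma i 1| * r by rewrite ler_wpM2l.
apply: le_trans (lerD h1 h2) _; rewrite -mulrDl ler_wpM2r// /S.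
have := normr_ge0 (sigma 0 0); have := normr_ge0 (sigma 0 1).
have := normr_ge0 (sigma 1 0); have := normr_ge0 (sigma 1 1).
by case: (ord2P 0 i) => ->; rewrite ?rev01; lra.
Qed.

Let b_bound i : `|b i 0| <= beta.
Proof.
rewrite /beta; have := normr_ge0 (b 0 0); have := normr_ge0 (b 1 0).
by case: (ord2P 0 i) => ->; rewrite ?rev01; lra.
Qed.

Lemma open_pair_event (s t : R) (Q : 'cV[R]_2 -> 'cV[R]_2 -> Prop) : 0 <= s <= t ->
  (forall y z : 'cV[R]_2, Q y z -> exists2 e : R, 0 < e & forall y' z' : 'cV[R]_2,
    (forall i, `|y' i 0 - y i 0| <= e) -> (forall i, `|z' i 0 - z i 0| <= e) -> Q y' z') ->
  F t [set w | Q (X s w) (X t w)].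
Proof.
move=> /andP[s0 st] hQ; apply: open_event; first lra.
move=> w _ /hQ[e e0 h]; exists e => // w' _ hw'.
by apply: h => i; apply: hw'; lra.
Qed.

Definition near_incr (s t : R) (y : 'cV[R]_2) (r : R) : set T :=
  [set w | forall i, `|X t w i 0 - X s w i 0 - Num.sqrt (t - s) * y i 0| < Num.sqrt (t - s) * r].

Lemma near_incr_adapted s t y r : 0 <= s <= t -> F t (near_incr s t y r).
Proof.
move=> st; set eta := Num.sqrt (t - s).
apply: (open_pair_event (Q := fun u v => forall i,
  `|v i 0 - u i 0 - eta * y i 0| < eta * r)) => // u v h.
pose e i := (eta * r - `|v i 0 - u i 0 - eta * y i 0|) / 3.
have e0 i : 0 < e i by rewrite divr_gt0// subr_gt0.
exists (Num.min (e 0) (e 1)); first by rewrite lt_min !e0.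
move=> u' v' hu hv i.
have ei : Num.min (e 0) (e 1) <= e i.
  by rewrite ge_min; case: (ord2P 0 i) => ->; rewrite ?rev01 lexx ?orbT.
have hu' := le_trans (hu i) ei; have hv' := le_trans (hv i) ei.
rewrite (_ : _ - _ - _ = (v i 0 - u i 0 - eta * y i 0) +
  ((v' i 0 - v i 0) - (u' i 0 - u i 0))); last by ring.
apply: le_lt_trans (ler_normD _ _) _.
have := ler_normB (v' i 0 - v i 0) (u' i 0 - u i 0).
by have := e0 i; rewrite /e in hu' hv' *; lra.
Qed.

(** Nondegeneracy enters here: [sigma] is invertible, so the target y comes from a target u for the
    Brownian increment. Over short steps the drift, of order t - s, is small compared with the
    square root of t - s. *)
Lemma pr_near_incr (y : 'cV[R]_2) (r : R) : 0 < r ->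
  exists2 p : R, 0 < p <= 1 & exists2 h0 : R, 0 < h0 &
    forall (s t : R) A, 0 <= s < t -> t - s <= h0 -> F s A ->
      p * pr A <= pr (A `&` near_incr s t y r).
Proof.
move=> r0; pose u := invmx sigma *m y.
have su : sigma *m u = y by rewrite mulKVmx.
(* Half of the tolerance r goes to the Brownian part, which [sigma] magnifies by at most [S], the
   other half to the drift. *)
pose rho := r / 2 / (S + 1).
have S1 : 0 < S + 1 by have := S0; lra.
have rho0 : 0 < rho by rewrite !divr_gt0.
pose a k := u k 0 - rho; pose c k := u k 0 + rho.
have ac k : a k < c k by rewrite /a /c; lra.
pose p := fine (normal_prob 0 1 `[a 0, c 0]) * fine (normal_prob 0 1 `[a 1, c 1]).
have fine_itv k : 0 < fine (normal_prob 0 1 `[a k, c k]) <= 1.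
  rewrite fine_gt0 ?normal_prob_itv_gt0//=; last first.
    by rewrite ltey_eq (@fin_num_measure _ _ _ (normal_prob (0 : R) 1) _ (measurable_itv _)).
  have := @probability_le1 _ _ _ (normal_prob (0 : R) 1) _ (measurable_itv `[a k, c k]).
  by rewrite -lee_fin fineK// (@fin_num_measure _ _ _ (normal_prob (0 : R) 1) _ (measurable_itv _)).
have /andP[f0 f01] := fine_itv 0; have /andP[f1 f11] := fine_itv 1.
exists p; first by rewrite /p mulr_gt0//= mulr_ile1// ltW.
pose q := r / 2 / (beta + 1).
have B1 : 0 < beta + 1 by have := beta0; lra.
have q0 : 0 < q by rewrite !divr_gt0.
exists (q ^+ 2 / 2); first by rewrite divr_gt0// exprn_gt0.
move=> s t A st th FA; rewrite mulrC -(pr_rect st FA ac).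
have s0 : 0 <= s by lra. have t0 : 0 <= t by lra.
have mA := filtration_measurable hF s0 FA.
apply: pr_le.
- by apply: measurableI => //; exact: rect_measurable.
- apply: measurableI => //; apply: (filtration_measurable hF t0).
  by apply: near_incr_adapted; lra.
move=> w [Aw hw]; split => // i; rewrite X_incr//.
set eta := Num.sqrt (t - s) in hw *.
have eta0 : 0 < eta by rewrite sqrtr_gt0; lra.
have etaE : t - s = eta ^+ 2 by rewrite sqr_sqrtr//; lra.
have etaq : eta < q.
  rewrite -ltr_sqr ?nnegrE ?(ltW eta0) ?(ltW q0)// -etaE.
  have q20 : 0 < q ^+ 2 by rewrite exprn_gt0.
  by lra.
have hw' k : `|(W t w k 0 - W s w k 0) - eta * u k 0| <= eta * rho.
  have := hw k; rewrite -/eta /a /c ler_norml mulrBr mulrDr; lra.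
have yi : y i 0 = sigma i 0 * u 0 0 + sigma i 1 * u 1 0.
  by rewrite -su mxE (sum_ord2 0) rev01.
rewrite (_ : _ + _ - _ = eta ^+ 2 * b i 0 +
  (sigma i 0 * (W t w 0 0 - W s w 0 0 - eta * u 0 0) +
   sigma i 1 * (W t w 1 0 - W s w 1 0 - eta * u 1 0))); last by rewrite yi etaE; ring.
have h1 := row_bound i (hw' 0) (hw' 1).
have h2 : `|eta ^+ 2 * b i 0| <= eta * (q * beta).
  rewrite normrM ger0_norm ?sqr_ge0// expr2 -mulrA ler_pM2l//.
  by apply: ler_pM => //; exact: ltW.
have h3 : S * (eta * rho) < eta * (r / 2).
  rewrite mulrCA ltr_pM2l// /rho mulrCA gtr_pMr ?divr_gt0// ltr_pdivrMr//; lra.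
have h4 : eta * (q * beta) <= eta * (r / 2).
  rewrite ler_pM2l// /q -mulrA ler_piMr//; first by apply: ltW; rewrite divr_gt0.
  by rewrite mulrC ler_pdivrMr//; lra.
apply: le_lt_trans (ler_normD _ _) _; lra.
Qed.

Lemma pr_far_incr (e : R) : 0 < e -> exists2 M : R, 0 < M &
  forall (s t : R) A, 0 <= s < t -> t - s <= 1 -> F s A ->
    pr (A `\` [set w | forall i, `|X t w i 0 - X s w i 0| <= Num.sqrt (t - s) * M]) <= e * pr A.
Proof.
(* Keeping two coordinates within [M0] costs at most 2 * e' <= e; the cap at 1 keeps 1 - e'
   nonnegative before squaring. *)
move=> e0; pose e' := Num.min (e / 2) 1.
have e'0 : 0 < e' by rewrite lt_min ltr01 andbT; lra.
have e'e : e' <= e / 2 by rewrite ge_min lexx.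
have e'1 : e' <= 1 by rewrite ge_min lexx orbT.
have [M0 M00 hM0] := normal_prob_tail e'0.
exists (beta + S * M0 + 1); first by rewrite ltr_wpDl// addr_ge0// mulr_ge0// ltW.
move=> s t A st t1 FA.
have s0 : 0 <= s by lra. have t0 : 0 <= t by lra.
have mA := filtration_measurable hF s0 FA.
set G := [set w | _].
have FG : F t (~` G).
  set M := _ + 1 in G *.
  apply: (open_pair_event (Q := fun u v => ~ forall i, `|v i 0 - u i 0| <= Num.sqrt (t - s) * M)).
    by lra.
  move=> y z /existsNP[i /negP]; rewrite -ltNge => hi.
  pose e1 := (`|z i 0 - y i 0| - Num.sqrt (t - s) * M) / 3.
  have e10 : 0 < e1 by rewrite divr_gt0// subr_gt0.
  exists e1 => // y' z' /(_ i) hy /(_ i) hz /(_ i).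
  rewrite leNgt => /negP; apply.
  have := ler_normD (z' i 0 - y' i 0) ((z i 0 - z' i 0) - (y i 0 - y' i 0)).
  rewrite (_ : _ - _ + (_ - _) = z i 0 - y i 0); last by ring.
  have := ler_normB (z i 0 - z' i 0) (y i 0 - y' i 0).
  by rewrite [`|z i 0 - z' i 0|]distrC [`|y i 0 - y' i 0|]distrC; rewrite /e1 in hy hz e10; lra.
have mG : measurable G.
  by rewrite -[G]setCK; apply: measurableC; exact: (filtration_measurable hF t0 FG).
pose a (k : 'I_2) : R := - M0; pose c (k : 'I_2) : R := M0.
have ac k : a k < c k by rewrite /a /c; lra.
have hr := pr_rect st FA ac.
have mr : measurable (A `&` rect s t a c) by apply: measurableI => //; exact: rect_measurable.
have sub : A `&` rect s t a c `<=` A `&` G.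
  move=> w [Aw hw]; split => // i; rewrite X_incr//.
  set eta := Num.sqrt (t - s) in hw *.
  have eta0 : 0 < eta by rewrite sqrtr_gt0; lra.
  have etaE : t - s = eta ^+ 2 by rewrite sqr_sqrtr//; lra.
  have eta1 : eta <= 1.
    by rewrite -(@ler_sqr R) ?nnegrE ?(ltW eta0)// -etaE expr1n.
  have hw' k : `|W t w k 0 - W s w k 0| <= eta * M0.
    by have := hw k; rewrite -/eta /a /c ler_norml mulrN.
  have h1 := row_bound i (hw' 0) (hw' 1).
  have h2 : `|eta ^+ 2 * b i 0| <= eta * beta.
    rewrite normrM ger0_norm ?sqr_ge0// expr2 -mulrA ler_pM2l//.
    by rewrite -[leRHS]mul1r; apply: ler_pM => //; exact: ltW.
  rewrite etaE; apply: le_trans (ler_normD _ _) _.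
  rewrite (_ : eta * _ = eta * beta + S * (eta * M0) + eta); last by ring.
  by lra.
have h1 := pr_le P mr (measurableI _ _ mA mG) sub.
rewrite hr /a /c in h1.
have mN := @fin_num_measure _ _ _ (normal_prob (0 : R) 1) _ (measurable_itv `[- M0, M0]).
have h2 : 1 - e' <= fine (normal_prob 0 1 `[- M0, M0]) by rewrite -lee_fin fineK.
have h3 : (1 - e') * (1 - e') <= fine (normal_prob 0 1 `[- M0, M0]) * fine (normal_prob 0 1 `[- M0, M0]).
  by apply: ler_pM => //; lra.
have h4 := ler_wpM2l (pr_ge0 P A) h3.
have h5 := pr_split P mA mG.
have h6 : e' * pr A <= e / 2 * pr A by rewrite ler_wpM2r// pr_ge0.
have h7 : 0 <= e' * e' * pr A by rewrite !mulr_ge0 ?pr_ge0// ltW.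
lra.
Qed.

Definition small_incr (s t a : R) : set T :=
  [set w | forall i, `|X t w i 0 - X s w i 0| <= a].

Lemma small_incr_adapted (s t a : R) : 0 <= s <= t -> F t (small_incr s t a).
Proof.
move=> st; have t0 : 0 <= t by lra.
rewrite -[small_incr _ _ _]setCK; apply: (filtration_setC hF) => //.
apply: (open_pair_event (Q := fun u v => ~ forall i, `|v i 0 - u i 0| <= a)) => //.
move=> y z /existsNP[i /negP]; rewrite -ltNge => hi.
pose e1 := (`|z i 0 - y i 0| - a) / 3.
have e10 : 0 < e1 by rewrite divr_gt0// subr_gt0.
exists e1 => // y' z' /(_ i) hy /(_ i) hz /(_ i).
rewrite leNgt => /negP; apply.
have := ler_normD (z' i 0 - y' i 0) ((z i 0 - z' i 0) - (y i 0 - y' i 0)).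
rewrite (_ : _ - _ + (_ - _) = z i 0 - y i 0); last by ring.
have := ler_normB (z i 0 - z' i 0) (y i 0 - y' i 0).
by rewrite [`|z i 0 - z' i 0|]distrC [`|y i 0 - y' i 0|]distrC; rewrite /e1 in hy hz e10; lra.
Qed.

Definition miss (u : nat -> R) (y : 'cV[R]_2) (r : R) K : set T :=
  [set w | forall j, (j < K)%N -> ~ near_incr (u j) (u j.+1) y r w].

Lemma missS u y r K : miss u y r K.+1 =
  miss u y r K `&` ~` near_incr (u K) (u K.+1) y r.
Proof.
apply/seteqP; split=> w.
  by move=> h; split; [move=> j jK; apply: h; exact: ltnW|exact: (h K)].
by move=> [h hK] j; rewrite ltnS leq_eqVlt => /predU1P[->//|]; exact: h.
Qed.

Lemma miss_adapted u y r K : (forall j, (j < K)%N -> 0 <= u j <= u j.+1) ->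
  0 <= u 0%N -> F (u K) (miss u y r K).
Proof.
move=> + u0; elim: K => [|K IH] hu.
  rewrite (_ : miss _ _ _ _ = setT); first exact: (filtration_setT hF).
  by apply/seteqP; split.
have uK := hu K (ltnSn K); have u1 : 0 <= u K.+1 by lra.
rewrite missS; apply: (filtration_setI hF) => //.
  by apply: (filtration_le hF uK); apply: IH => j jK; apply: hu; exact: ltnW.
by apply: (filtration_setC hF) => //; exact: near_incr_adapted.
Qed.

(** The earlier misses belong to the past of each window, so conditioning at its left end gives a
    factor 1 - p per window. *)
Lemma pr_miss (y : 'cV[R]_2) (r p h0 : R) : 0 <= p <= 1 ->
  (forall (s t : R) A, 0 <= s < t -> t - s <= h0 -> F s A ->
      p * pr A <= pr (A `&` near_incr s t y r)) ->
  forall (u : nat -> R) K A, (forall j, (j < K)%N -> 0 <= u j < u j.+1 /\ u j.+1 - u j <= h0) ->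
  0 <= u 0%N -> F (u 0%N) A -> pr (A `&` miss u y r K) <= (1 - p) ^+ K * pr A.
Proof.
move=> p01 hp u K A + u0 FA; elim: K => [|K IH] hu.
  rewrite expr0 mul1r (_ : miss _ _ _ _ = setT) ?setIT//.
  by apply/seteqP; split.
have [uK uK1] := hu K (ltnSn K).
have hu' j : (j < K)%N -> 0 <= u j < u j.+1 /\ u j.+1 - u j <= h0.
  by move=> jK; apply: hu; exact: ltnW.
have {}IH := IH hu'.
have uK0 : 0 <= u K by lra. have uK10 : 0 <= u K.+1 by lra.
have FM : F (u K) (A `&` miss u y r K).
  apply: (filtration_setI hF) => //; last first.
    by apply: miss_adapted => // j /hu'; lra.
  apply: (filtration_le hF _ FA); rewrite u0/=.
  elim: (K) hu' => // k IHk hk; apply: (@le_trans _ _ (u k)).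
    by apply: IHk => j jk; apply: hk; exact: ltnW.
  by have := hk k (ltnSn k); lra.
have h := hp _ _ _ uK uK1 FM.
have mM := filtration_measurable hF uK0 FM.
have mnear : measurable (near_incr (u K) (u K.+1) y r).
  by apply: (filtration_measurable hF uK10); apply: near_incr_adapted; lra.
have := pr_split P mM mnear; rewrite missS setIA -setDE => e.
rewrite exprS -mulrA; apply: le_trans (_ : (1 - p) * pr (A `&` miss u y r K) <= _).
  by lra.
by apply: ler_wpM2l => //; lra.
Qed.

(* The windows [u j, u j.+1] are missed with probability (1 - p)^K <= e / 2, while
   the companion intervals [v j, z j] are so short that a large increment over
   one of the K of them has probability at most e / 2. *)
Lemma pr_scales (y : 'cV[R]_2) (r theta e : R) : 0 < r -> 0 < theta -> 0 < e ->
  exists K : nat, exists2 h0 : R, 0 < h0 & exists2 kappa : R, 0 < kappa <= 1 &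
  forall (u v z : nat -> R) A,
  (forall j, (j < K)%N -> [/\ 0 <= u j < u j.+1, u j.+1 - u j <= h0, 0 <= v j < z j,
      z j - v j <= kappa * (u j.+1 - u j) & F (v j) A]) -> 0 <= u 0%N -> F (u 0%N) A ->
  pr (A `&` [set w | forall j, (j < K)%N -> ~ (near_incr (u j) (u j.+1) y r w /\
      small_incr (v j) (z j) (Num.sqrt (u j.+1 - u j) * theta) w)]) <= e * pr A.
Proof.
move=> r0 theta0 e0.
have [p /andP[p0 p1] [h0 h00 hp]] := pr_near_incr y r0.
have e20 : 0 < e / 2 by lra.
have [K hK] : exists K : nat, (1 - p) ^+ K < e / 2.
  have : (1 - p) ^+ n @[n --> \oo] --> (0 : R).
    by apply: cvg_expr; rewrite ger0_norm; lra.
  move=> /cvgrPdist_lt/(_ _ e20)[n _ /(_ n (leqnn n))]/=.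
  rewrite sub0r normrN ger0_norm; last by rewrite exprn_ge0; lra.
  by exists n.
have K1 : 0 < K.+1%:R :> R by [].
have e30 : 0 < e / 2 / K.+1%:R by rewrite divr_gt0.
have [M M0 hM] := pr_far_incr e30.
exists K; exists (Num.min h0 1); first by rewrite lt_min h00/=.
(* With this ratio of lengths, [M] times the square root of the companion length is at most theta
   times that of the window; the cap at 1 keeps the companion within the unit time that
   [pr_far_incr] asks for. *)
exists (Num.min 1 ((theta / M) ^+ 2)).
  by rewrite lt_min ltr01 exprn_gt0 ?divr_gt0//= ge_min lexx.
move=> u v z A hu u0 FA.
have mA := filtration_measurable hF u0 FA.
have hu1 j : (j < K)%N -> 0 <= u j < u j.+1 /\ u j.+1 - u j <= h0.
  by move=> /hu[? + _ _ _]; rewrite le_min => /andP[? _].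
have uK0 : 0 <= u K.
  by case: (K) hu1 => // k /(_ k (ltnSn k)); lra.
have mmiss : measurable (miss u y r K).
  apply: (filtration_measurable hF uK0); apply: miss_adapted => // j /hu1.
  by lra.
pose sm j := small_incr (v j) (z j) (Num.sqrt (u j.+1 - u j) * theta).
have msm j : (j < K)%N -> measurable (sm j).
  move=> /hu[_ _ vz _ _]; apply: (@filtration_measurable _ _ _ _ _ hF (z j)); first lra.
  by apply: small_incr_adapted; lra.
have mnear j : (j < K)%N -> measurable (near_incr (u j) (u j.+1) y r).
  move=> /hu[uj _ _ _ _]; apply: (@filtration_measurable _ _ _ _ _ hF (u j.+1)); first lra.
  by apply: near_incr_adapted; lra.
have psm j : (j < K)%N -> pr (A `\` sm j) <= e / 2 / K.+1%:R * pr A.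
  move=> jK; have [uj ujh vz kap FvA] := hu j jK.
  have ujh1 : u j.+1 - u j <= 1 by apply: le_trans ujh _; rewrite ge_min lexx orbT.
  have k1 : Num.min 1 ((theta / M) ^+ 2) <= 1 by rewrite ge_min lexx.
  have ud0 : 0 <= u j.+1 - u j by lra.
  have kap1 : Num.min 1 ((theta / M) ^+ 2) * (u j.+1 - u j) <= u j.+1 - u j by rewrite ler_piMl.
  have vz1 : z j - v j <= 1 by lra.
  apply: le_trans (hM _ _ _ vz vz1 FvA).
  apply: pr_le.
  - by apply: measurableD => //; exact: msm.
  - apply: measurableD => //; apply: (@filtration_measurable _ _ _ _ _ hF (z j)); first lra.
    by apply: small_incr_adapted; lra.
  move=> w [Aw hw]; split => // hw'; apply: hw => i; apply: le_trans (hw' i) _.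
  have : Num.sqrt (z j - v j) <= Num.sqrt ((theta / M) ^+ 2 * (u j.+1 - u j)).
    apply: ler_wsqrtr; apply: le_trans kap _.
    by apply: ler_wpM2r => //; rewrite ge_min lexx orbT.
  rewrite sqrtrM ?sqr_ge0// sqrtr_sqr gtr0_norm ?divr_gt0// => h.
  apply: (@le_trans _ _ (theta / M * Num.sqrt (u j.+1 - u j) * M)).
    by apply: ler_wpM2r => //; exact: ltW.
  by rewrite mulrAC divfK ?gt_eqF// mulrC.
pose Bad n := \big[setU/set0]_(j < n) (A `\` sm j).
have mBad n : (n <= K)%N -> measurable (Bad n).
  move=> nK; apply: bigsetU_measurable => j _; apply: measurableD => //.
  by apply: msm; exact: leq_trans nK.
have pBad n : (n <= K)%N -> pr (Bad n) <= n%:R * (e / 2 / K.+1%:R * pr A).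
  elim: n => [|n IH] nK; first by rewrite /Bad big_ord0 mul0r /pr measure0.
  rewrite /Bad big_ord_recr /= -/(Bad n) -(natr1 n) mulrDl mul1r.
  apply: le_trans (prU_le P _ _) _; first by apply: mBad; exact: ltnW.
    by apply: measurableD => //; exact: msm.
  by apply: lerD; [apply: IH; exact: ltnW|exact: psm].
have mI : measurable [set w | forall j, (j < K)%N ->
    ~ (near_incr (u j) (u j.+1) y r w /\ sm j w)].
  rewrite (_ : [set w | _] = \bigcap_(j in `I_K) ~` (near_incr (u j) (u j.+1) y r `&` sm j)).
    apply: bigcap_measurableType => j jK; apply: measurableC; apply: measurableI.
      exact: mnear.
    exact: msm.
  by apply/seteqP; split=> w.
apply: (@le_trans _ _ (pr ((A `&` miss u y r K) `|` Bad K))).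
  apply: pr_le.
  - exact: measurableI.
  - by apply: measurableU; [exact: measurableI|exact: mBad].
  move=> w [Aw hw]; have [hb|hb] := pselect (Bad K w); [by right|left].
  split => // j jK hn; apply: (hw j jK); split => //.
  apply: contrapT => nsm; apply: hb.
  by rewrite /Bad -(bigcup_mkord K (fun j => A `\` sm j)); exists j.
apply: le_trans (prU_le P _ _) _; [exact: measurableI|exact: mBad|].
have h1 := pr_miss (ltac:(lra) : 0 <= p <= 1) hp hu1 u0 FA.
have h2 := pBad K (leqnn K).
have h3 : K%:R * (e / 2 / K.+1%:R * pr A) <= e / 2 * pr A.
  rewrite mulrA; apply: ler_wpM2r; first exact: pr_ge0.
  rewrite mulrCA ler_piMr ?(ltW e20)// ler_pdivrMr// mul1r ler_nat; exact: leqnSn.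
have h4 : (1 - p) ^+ K * pr A <= e / 2 * pr A by apply: ler_wpM2r; [exact: pr_ge0|exact: ltW].
by apply: le_trans (lerD (le_trans h1 h4) (le_trans h2 h3)) _; rewrite -mulrDl -splitr.
Qed.

Definition linform (c : 'I_2 -> R) (t : R) (w : T) := \sum_i c i * X t w i 0.

Lemma linform_pair_adapted (c : 'I_2 -> R) (s t a : R) : 0 <= s <= t ->
  F t [set w | a < linform c t w - linform c s w].
Proof.
move=> st.
apply: (open_pair_event (Q := fun u v => a < \sum_i c i * v i 0 - \sum_i c i * u i 0)) => //.
move=> y z; rewrite !(sum_ord2 0) !rev01 => h.
pose C := `|c 0| + `|c 1| + 1.
have C0 : 0 < C by rewrite ltr_wpDl// addr_ge0.
exists ((c 0 * z 0 0 + c 1 * z 1 0 - (c 0 * y 0 0 + c 1 * y 1 0) - a) / (3 * C)).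
  by rewrite divr_gt0 ?mulr_gt0// subr_gt0.
set e := _ / _ => y' z' hy hz; rewrite !(sum_ord2 0) !rev01.
have e0 : 0 <= e by apply: le_trans (hy 0).
have bd k (p : R) : `|p| <= e -> `|c k * p| <= `|c k| * e by move=> ?; rewrite normrM ler_wpM2l.
have := bd 0 _ (hy 0); have := bd 1 _ (hy 1); have := bd 0 _ (hz 0); have := bd 1 _ (hz 1).
rewrite !ler_norml.
have eE : e * (3 * C) = c 0 * z 0 0 + c 1 * z 1 0 - (c 0 * y 0 0 + c 1 * y 1 0) - a.
  by rewrite /e divfK// gt_eqF// mulr_gt0.
have C1 : `|c 0| * e + `|c 1| * e <= C * e.
  by rewrite -mulrDl ler_wpM2r// /C lerDl.
have Ce : C * e * 3 = e * (3 * C) by ring.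
have := mulr_ge0 (ltW C0) e0.
have : 0 < e * (3 * C) by rewrite eE; lra.
by lra.
Qed.

(** * Oscillation of a linear form of the path *)

Section Direction.
Variable c : 'I_2 -> R.
Hypothesis c_neq0 : exists i, c i != 0.
Local Notation xi := (linform c).

Let C := `|c 0| + `|c 1|.
Let C0 : 0 < C.
Proof.
have [i ci] := c_neq0; have h := normr_gt0 (c i); rewrite ci in h.
rewrite /C; have := normr_ge0 (c 0); have := normr_ge0 (c 1).
by case: (ord2P 0 i) h => ->; rewrite ?rev01 => h; lra.
Qed.

Let n2 := c 0 ^+ 2 + c 1 ^+ 2.
Let n20 : 0 < n2.
Proof.
have [i ci] := c_neq0; have h : 0 < c i ^+ 2 by rewrite exprn_even_gt0.
rewrite /n2; have := sqr_ge0 (c 0); have := sqr_ge0 (c 1).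
by case: (ord2P 0 i) h => ->; rewrite ?rev01 => h; lra.
Qed.

(** On y the form takes the value -2, and a tolerance r in each coordinate changes it by at most
    1/2. A window near y together with a small companion increment therefore lowers the form by at
    least the square root of the window length. *)
Let y : 'cV[R]_2 := \col_i (- (2 / n2) * c i).
Let r := (2 * C)^-1.
Let r0 : 0 < r. Proof. by rewrite invr_gt0 mulr_gt0. Qed.

Let descent (s t v z : R) w : near_incr s t y r w ->
  small_incr v z (Num.sqrt (t - s) * r) w ->
  xi t w - xi s w + (xi z w - xi v w) <= - Num.sqrt (t - s).
Proof.
set eta := Num.sqrt (t - s) => hn hs; rewrite /linform !(sum_ord2 0) rev01.
have eta0 : 0 <= eta by exact: sqrtr_ge0.
have bd k (p : R) : `|p| <= eta * r -> c k * p <= `|c k| * (eta * r).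
  by move=> h; apply: le_trans (ler_norm _) _; rewrite normrM ler_wpM2l.
have {}hn i : `|X t w i 0 - X s w i 0 - eta * y i 0| < eta * r := hn i.
have {}hs i : `|X z w i 0 - X v w i 0| <= eta * r := hs i.
have h0 := bd 0 _ (ltW (hn 0)); have h1 := bd 1 _ (ltW (hn 1)).
have k0 := bd 0 _ (hs 0); have k1 := bd 1 _ (hs 1).
have Cr : (`|c 0| + `|c 1|) * (eta * r) = eta / 2.
  by rewrite -/C /r invfM; field; rewrite gt_eqF.
have cy : c 0 * (eta * y 0 0) + c 1 * (eta * y 1 0) = - (2 * eta).
  rewrite !mxE (_ : _ + _ = - (2 * eta) * ((c 0 ^+ 2 + c 1 ^+ 2) / n2)); last by ring.
  by rewrite -/n2 divff ?mulr1// gt_eqF.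
lra.
Qed.

(** The windows are cut by the times s + d0 q^(K - j), and the companion interval of each is all the
    time elapsed since s; a success at any scale thus brings the form below its value at s by at
    least [rho]. Many scales make failure as unlikely as desired, with [rho] and the lags chosen
    before s. *)
Lemma pr_no_descent (del e : R) : 0 < del -> 0 < e ->
  exists2 rho : R, 0 < rho & exists K (lag : nat -> R),
  (forall l, (l < K)%N -> 0 < lag l <= del) /\
  forall s A, 0 <= s -> F s A ->
  pr (A `&` [set w | forall l, (l < K)%N -> - rho < xi (s + lag l) w - xi s w]) <= e * pr A.
Proof.
move=> del0 e0.
have [K [h0 h00 [kappa /andP[kap0 kap1] hK]]] := pr_scales y r0 r0 e0.
(* For this q the time from s to the start of a window is exactly [kappa] times the length of the
   window. *)
pose q := kappa / (1 + kappa).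
have kp : 0 < 1 + kappa by lra.
have q0 : 0 < q by rewrite divr_gt0.
have qE : 1 - q = (1 + kappa)^-1 by rewrite /q; field; rewrite gt_eqF.
have q1 : 0 < 1 - q by rewrite qE invr_gt0.
have qk : q = kappa * (1 - q) by rewrite qE.
pose d0 := Num.min del h0.
have d00 : 0 < d0 by rewrite lt_min del0.
have ddel : d0 <= del by rewrite ge_min lexx.
have dh0 : d0 <= h0 by rewrite ge_min lexx orbT.
pose rho := Num.sqrt (d0 * (q ^+ K * (1 - q))).
have qn n : 0 < q ^+ n <= 1 by rewrite exprn_gt0//= exprn_ile1//; lra.
have rho0 : 0 < rho by rewrite sqrtr_gt0 !mulr_gt0 ?exprn_gt0.
exists rho => //; exists K, (fun l => d0 * q ^+ (K - l.+1)); split.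
  move=> l _; have /andP[a1 a2] := qn (K - l.+1)%N.
  by rewrite mulr_gt0//= (le_trans _ ddel)// ler_piMr// ltW.
move=> s A s0 FA.
have mA := filtration_measurable hF s0 FA.
pose u j := s + d0 * q ^+ (K - j).
have uS j : (j < K)%N -> u j.+1 - u j = d0 * (q ^+ (K - j.+1) * (1 - q)).
  move=> jK; rewrite /u -(subnSK jK) exprS; ring.
have uj0 j : 0 < d0 * q ^+ (K - j) by rewrite mulr_gt0// exprn_gt0.
apply: le_trans (hK u (fun=> s) u A _ _ _).
- apply: pr_le.
  + apply: measurableI => //.
    rewrite (_ : [set w | _] = \bigcap_(l in `I_K)
      [set w | - rho < xi (s + d0 * q ^+ (K - l.+1)) w - xi s w]); last by apply/seteqP; split.
    apply: bigcap_measurableType => l lK.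
    apply: (@filtration_measurable _ _ _ _ _ hF (s + d0 * q ^+ (K - l.+1))).
      by have := uj0 l.+1; lra.
    by apply: linform_pair_adapted; have := uj0 l.+1; lra.
  + apply: measurableI => //.
    rewrite (_ : [set w | _] = \bigcap_(j in `I_K) ~` (near_incr (u j) (u j.+1) y r `&`
      small_incr s (u j) (Num.sqrt (u j.+1 - u j) * r))); last by apply/seteqP; split.
    apply: bigcap_measurableType => j jK; apply: measurableC.
    have uj := uS j jK; have ujp : 0 < u j.+1 - u j.
      by rewrite uj !mulr_gt0// exprn_gt0.
    have := uj0 j; rewrite -/(u j) => uj0'.
    apply: measurableI.
      apply: (@filtration_measurable _ _ _ _ _ hF (u j.+1)); first by rewrite /u; have := uj0 j.+1; lra.
      by apply: near_incr_adapted; rewrite /u in ujp *; lra.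
    apply: (@filtration_measurable _ _ _ _ _ hF (u j)); first by rewrite /u; lra.
    by apply: small_incr_adapted; rewrite /u; lra.
  move=> w [Aw hw]; split => // j jK [hn hs].
  have := descent hn hs; have := hw j jK; rewrite -/(u j.+1).
  have -> : xi (u j.+1) w - xi (u j) w + (xi (u j) w - xi s w) = xi (u j.+1) w - xi s w by ring.
  have : rho <= Num.sqrt (u j.+1 - u j).
    apply: ler_wsqrtr; rewrite uS// ler_pM2l// ler_pM2r//.
    by apply: ler_wiXn2l; rewrite ?leq_subr//; lra.
  lra.
- move=> j jK; have uj := uS j jK; have /andP[a1 a2] := qn (K - j.+1)%N.
  have ujp : 0 < u j.+1 - u j by rewrite uj !mulr_gt0.
  have := uj0 j => uj0'.
  split => //.
  + by rewrite /u in ujp *; lra.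
  + rewrite uj; apply: le_trans dh0; rewrite ler_piMr ?(ltW d00)//.
    by apply: mulr_ile1; lra.
  + by rewrite /u; lra.
  + rewrite uj /u addrAC subrr add0r -(subnSK jK) exprS {1}qk.
    rewrite le_eqVlt; apply/orP; left; apply/eqP; ring.
- by rewrite /u; have := uj0 0%N; lra.
- by apply: (filtration_le hF _ FA); rewrite /u; have := uj0 0%N; lra.
Qed.

(** The mirror image: the windows accumulate at t from the left, and the companion interval of each
    runs from its end to t. A success makes the form smaller at t than at the start of the window,
    so t is no running maximum. *)
Lemma pr_running_max (t e : R) : 0 < t -> 0 < e ->
  exists K (u : nat -> R), (forall j, 0 <= u j < t) /\
  pr [set w | forall j, (j < K)%N -> ~ 0 < xi (u j) w - xi t w] <= e.
Proof.
move=> t0 e0.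
have [K [h0 h00 [kappa /andP[kap0 kap1] hK]]] := pr_scales y r0 r0 e0.
pose q := kappa / (1 + kappa).
have kp : 0 < 1 + kappa by lra.
have q0 : 0 < q by rewrite divr_gt0.
have qE : 1 - q = (1 + kappa)^-1 by rewrite /q; field; rewrite gt_eqF.
have q1 : 0 < 1 - q by rewrite qE invr_gt0.
have qk : q = kappa * (1 - q) by rewrite qE.
pose d0 := Num.min t h0.
have d00 : 0 < d0 by rewrite lt_min t0.
have dt : d0 <= t by rewrite ge_min lexx.
have dh0 : d0 <= h0 by rewrite ge_min lexx orbT.
have qn n : 0 < q ^+ n <= 1 by rewrite exprn_gt0//= exprn_ile1//; lra.
pose u j := t - d0 * q ^+ j.
have ujt j : 0 <= u j < t.
  have /andP[a1 a2] := qn j; rewrite /u subr_ge0 (le_trans _ dt) ?ler_piMr ?(ltW d00)//=.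
  by rewrite ltrBlDr ltrDl mulr_gt0.
have uS j : u j.+1 - u j = d0 * (q ^+ j * (1 - q)) by rewrite /u exprS; ring.
have ujp j : 0 < u j.+1 - u j by rewrite uS !mulr_gt0// exprn_gt0.
exists K, u; split => //.
have FT : F 0 setT by exact: (filtration_setT hF).
have mT : measurable [set w | forall j, (j < K)%N -> ~ 0 < xi (u j) w - xi t w].
  rewrite (_ : [set w | _] = \bigcap_(j in `I_K) ~` [set w | - 0 < xi (u j) w - xi t w]).
    apply: bigcap_measurableType => j jK; apply: measurableC.
    rewrite (_ : [set w | _] = [set w | 0 <
      linform (fun i => - c i) t w - linform (fun i => - c i) (u j) w]).
      apply: (@filtration_measurable _ _ _ _ _ hF t); first exact: ltW.
      by apply: linform_pair_adapted; have := ujt j; lra.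
    apply/seteqP; split=> w /=; rewrite /linform !(sum_ord2 0); lra.
  by apply/seteqP; split => w /=; rewrite oppr0.
have sub v A : 0 <= v -> F 0 A -> F v A.
  by move=> v0; apply: (filtration_le hF); rewrite lexx.
apply: le_trans (_ : e * pr setT <= e); last first.
  by rewrite ler_piMr ?(ltW e0)//; apply: pr_le1.
apply: le_trans (hK u (fun j => u j.+1) (fun=> t) setT _ _ _).
- apply: pr_le => //.
    apply: measurableI => //.
    rewrite (_ : [set w | _] = \bigcap_(j in `I_K) ~` (near_incr (u j) (u j.+1) y r `&`
      small_incr (u j.+1) t (Num.sqrt (u j.+1 - u j) * r))); last by apply/seteqP; split.
    apply: bigcap_measurableType => j jK; apply: measurableC.
    have := ujt j; have := ujt j.+1; have := ujp j => h1 h2 h3.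
    apply: measurableI.
      apply: (@filtration_measurable _ _ _ _ _ hF (u j.+1)); first lra.
      by apply: near_incr_adapted; lra.
    apply: (@filtration_measurable _ _ _ _ _ hF t); first lra.
    by apply: small_incr_adapted; lra.
  move=> w hw; split => // j jK [hn hs]; apply: (hw j jK).
  have := descent hn hs; have : 0 < Num.sqrt (u j.+1 - u j) by rewrite sqrtr_gt0.
  lra.
- move=> j jK; have := ujt j; have := ujt j.+1; have := ujp j => h1 h2 h3.
  have /andP[a1 a2] := qn j.
  split => //.
  + by lra.
  + rewrite uS; apply: le_trans dh0; rewrite ler_piMr ?(ltW d00)//.
    by apply: mulr_ile1; lra.
  + rewrite uS /u opprB addrC subrK exprS {1}qk.
    rewrite le_eqVlt; apply/orP; left; apply/eqP; ring.
  + by apply: sub => //; lra.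
- by have := ujt 0%N; lra.
- by apply: sub => //; have := ujt 0%N; lra.
Qed.

End Direction.

(* Ottaviani's inequality: after the first grid point at which the path has
   moved by 2 * M * sqrt h, it stays with probability at least 1/2 within
   M * sqrt h of its position there. *)
Lemma pr_max_grid (e : R) : 0 < e -> exists2 M : R, 0 < M &
  forall (s h : R) A n, 0 <= s -> 0 < h <= 1 -> F s A ->
  pr (A `&` [set w | exists2 l, (l <= n.+1)%N &
    ~ small_incr s (s + h * (l%:R / n.+1%:R)) (Num.sqrt h * M) w]) <= e * pr A.
Proof.
(* The bound 1/2 serves the return estimate after the first exit, and e / 2 the increment over the
   whole interval. *)
move=> e0; pose e1 := Num.min (e / 2) (2^-1).
have e10 : 0 < e1 by rewrite lt_min; apply/andP; split; lra.
have e1e : e1 <= e / 2 by rewrite ge_min lexx.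
have e1h : e1 <= 2^-1 by rewrite ge_min lexx orbT.
have [M M0 hM] := pr_far_incr e10.
exists (2 * M); first by rewrite mulr_gt0.
move=> s h A n s0 /andP[h0 h1] FA.
have mA := filtration_measurable hF s0 FA.
pose tl l := s + h * (l%:R / n.+1%:R).
pose a := Num.sqrt h * (2 * M).
have eta0 : 0 < Num.sqrt h by rewrite sqrtr_gt0.
have tls l : s <= tl l by rewrite /tl lerDl mulr_ge0// ?divr_ge0// ltW.
have tlm l l' : (l <= l')%N -> tl l <= tl l'.
  by move=> ll; rewrite lerD2l ler_pM2l// ler_pM2r ?invr_gt0// ler_nat.
have tlend : tl n.+1 = s + h by rewrite /tl divff ?mulr1.
have tl0 l : 0 <= tl l by apply: le_trans (tls l).
pose B l := A `&` [set w | ~ small_incr s (tl l) a w /\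
  forall l', (l' < l)%N -> small_incr s (tl l') a w].
have FB l : F (tl l) (B l).
  apply: (filtration_setI hF) => //; first by apply: (filtration_le hF _ FA); rewrite s0 tls.
  rewrite (_ : [set w | _] = ~` small_incr s (tl l) a `&`
    \bigcap_(l' : nat) (if (l' < l)%N then small_incr s (tl l') a else setT)).
    apply: (filtration_setI hF) => //.
      by apply: (filtration_setC hF) => //; apply: small_incr_adapted; rewrite s0 tls.
    apply: (filtration_countable_inter hF) => // l'; case: ifPn => ll; last exact: (filtration_setT hF).
    apply: (filtration_le hF (s := tl l')); first by rewrite tl0 tlm// ltnW.
    by apply: small_incr_adapted; rewrite s0 tls.
  apply/seteqP; split=> w [h2 h3]; split => //.
    by move=> l' _; case: ifPn => // /h3.
  by move=> l' ll; have := h3 l' I; rewrite ll.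
have mB l : measurable (B l) := filtration_measurable hF (tl0 l) (FB l).
have tB : trivIset [set: nat] B.
  move=> l l' _ _ [w [[_ [b1 b2]] [_ [b3 b4]]]].
  by case: (ltngtP l l') => // ll; [case: b1; exact: b4|case: b3; exact: b2].
pose Far := ~` small_incr s (s + h) (Num.sqrt h * M).
have mFar : measurable Far.
  apply: measurableC; apply: (@filtration_measurable _ _ _ _ _ hF (s + h)); first lra.
  by apply: small_incr_adapted; lra.
have half l : (l < n.+2)%N -> pr (B l) <= 2 * pr (B l `&` Far).
  rewrite ltnS leq_eqVlt => /predU1P[->|ln].
    suff -> : B n.+1 `&` Far = B n.+1 by have := pr_ge0 P (B n.+1); lra.
    apply/setIidl => w [_ [+ _]]; rewrite tlend; apply: contra_not => hs i.
    apply: le_trans (hs i) _; rewrite /a ler_pM2l//; lra.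
  have tlt : tl l < s + h.
    rewrite -tlend ltrD2l ltr_pM2l// ltr_pM2r ?invr_gt0// ltr_nat.
    exact: ln.
  have tlst : 0 <= tl l < s + h by rewrite tl0.
  have tlst1 : s + h - tl l <= 1 by have := tls l; lra.
  have := hM _ _ _ tlst tlst1 (FB l).
  set G := [set w | _] => hG.
  have mG : measurable G.
    apply: (@filtration_measurable _ _ _ _ _ hF (s + h)); first lra.
    by apply: small_incr_adapted; lra.
  have sub : B l `&` G `<=` B l `&` Far.
    move=> w [Bw Gw]; split => // hs; case: Bw => _ [+ _]; apply => i.
    have h2 := Gw i; have h3 := hs i.
    have h4 : Num.sqrt (s + h - tl l) <= Num.sqrt h by apply: ler_wsqrtr; have := tls l; lra.
    have h5 : Num.sqrt (s + h - tl l) * M <= Num.sqrt h * M by rewrite ler_pM2r.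
    rewrite (_ : _ - _ = (X (s + h) w i 0 - X s w i 0) -
      (X (s + h) w i 0 - X (tl l) w i 0)); last by ring.
    by apply: le_trans (ler_normB _ _) _; rewrite /a; lra.
  have h2 := pr_le P (measurableI _ _ (mB l) mG) (measurableI _ _ (mB l) mFar) sub.
  have := pr_split P (mB l) mG => h3.
  have h4 : e1 * pr (B l) <= 2^-1 * pr (B l) by rewrite ler_wpM2r// pr_ge0.
  by lra.
have -> : A `&` [set w | exists2 l, (l <= n.+1)%N & ~ small_incr s (s + h * (l%:R / n.+1%:R)) a w]
    = \big[setU/set0]_(l < n.+2) B l.
  rewrite -(bigcup_mkord n.+2 B); apply/seteqP; split=> w.
    move=> [Aw [l ln hl]].
    have ex : exists l, `[< ~ small_incr s (tl l) a w >] by exists l; apply/asboolP.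
    have := ex_minnP ex => -[k /asboolP hk kmin].
    exists k; first by apply: leq_ltn_trans (kmin l _) _; [apply/asboolP|].
    split => //; split => // l' lk; apply: contrapT => hl'.
    by have := kmin l' (asboolT hl'); rewrite leqNgt lk.
  by move=> [l /= ln [Aw [hl _]]]; split => //; exists l.
rewrite pr_bigsetU//.
apply: (@le_trans _ _ (2 * \sum_(l < n.+2) pr (B l `&` Far))).
  by rewrite mulr_sumr; apply: ler_sum => l _; exact: half.
rewrite -(pr_bigsetU P (A := fun l => B l `&` Far)); last 2 first.
- by move=> l _; exact: measurableI.
- by apply: trivIset_setIr.
have h2 : pr (A `\` small_incr s (s + h) (Num.sqrt h * M)) <= e1 * pr A.
  have := hM s (s + h) A; rewrite (_ : s + h - s = h); last by ring.
  by move=> hh; apply: hh => //; lra.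
have h3 : pr (\big[setU/set0]_(l < n.+2) (B l `&` Far)) <=
    pr (A `\` small_incr s (s + h) (Num.sqrt h * M)).
  apply: pr_le.
  - by apply: bigsetU_measurable => l _; exact: measurableI.
  - by rewrite setDE; exact: measurableI.
  rewrite -(bigcup_mkord n.+2 (fun l => B l `&` Far)) => w [l _ [[Aw _] fw]].
  by split.
have h4 : 2 * (e1 * pr A) <= e * pr A.
  by rewrite mulrA ler_wpM2r ?pr_ge0//; lra.
by lra.
Qed.

Definition dyadic_excursion (s h a : R) m : set T :=
  [set w | exists2 l, (l <= 2 ^ m)%N &
    ~ small_incr s (s + h * (l%:R / (2 ^ m)%:R)) a w].

Lemma dyadic_excursion_adapted s h a m : 0 <= s -> 0 < h ->
  F (s + h) (dyadic_excursion s h a m).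
Proof.
move=> s0 h0; have sh0 : 0 <= s + h by lra.
rewrite (_ : dyadic_excursion s h a m = \bigcup_(l : nat) (if (l <= 2 ^ m)%N then
   ~` small_incr s (s + h * (l%:R / (2 ^ m)%:R)) a else set0)).
  apply: (filtration_countable_union hF) => // l; case: ifPn => lm; last exact: (filtration_set0 hF).
  have q0 : 0 <= h * (l%:R / (2 ^ m)%:R) by rewrite mulr_ge0// ?divr_ge0// ltW.
  apply: (filtration_setC hF) => //.
  apply: (filtration_le hF (s := s + h * (l%:R / (2 ^ m)%:R))).
    rewrite addr_ge0//= lerD2l ler_piMr ?(ltW h0)// ler_pdivrMr ?mul1r ?ler_nat//.
  by apply: small_incr_adapted; lra.
apply/seteqP; split=> w; first by move=> [l lm hl]; exists l => //; rewrite lm.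
by move=> [l _]; case: ifPn => // lm hl; exists l.
Qed.

Lemma pr_dyadic_excursion (e : R) : 0 < e -> exists2 M : R, 0 < M &
  forall (s h : R) A, 0 <= s -> 0 < h <= 1 -> F s A ->
  pr (A `&` \bigcup_m dyadic_excursion s h (Num.sqrt h * M) m) <= e * pr A.
Proof.
move=> e0; have [M M0 hM] := pr_max_grid e0.
exists M => // s h A s0 h01 FA; have h0 : 0 < h by lra.
have mA := filtration_measurable hF s0 FA.
rewrite setI_bigcupr; apply: pr_bigcup_le.
- move=> m; apply: measurableI => //.
  apply: (@filtration_measurable _ _ _ _ _ hF (s + h)); first lra.
  exact: dyadic_excursion_adapted.
- move=> m n mn; rewrite subsetEset; apply: setIS => w [l lm hl].
  exists (l * 2 ^ (n - m))%N.
    by rewrite -[in X in (_ <= X)%N](subnKC mn) expnD leq_mul2r lm orbT.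
  rewrite (_ : (l * 2 ^ (n - m))%:R / (2 ^ n)%:R = l%:R / (2 ^ m)%:R :> R)//.
  rewrite -[in X in _ / X = _](subnKC mn) expnD !natrM -mulf_div divff ?mulr1//.
- move=> m; have := hM s h A (2 ^ m).-1 s0 h01 FA.
  by rewrite prednK ?expn_gt0.
Qed.

(** * Tubes are followed with positive conditional probability *)

Section Tube.
Variable i : 'I_2.
Let j := rev_ord i.

(** The centre of the ranges [-2, -1] and [1, 2] required by [tube]; the tolerance 1/2 in [window]
    keeps the normalised increments inside them. *)
Let corner_dir : 'cV[R]_2 := \col_k (if k == i then - (3 / 2) else 3 / 2).

Definition window (M s eta : R) : set T :=
  near_incr s (s + eta ^+ 2) corner_dir (2^-1) `\`
  \bigcup_m dyadic_excursion s (eta ^+ 2) (eta * M) m.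

Lemma window_adapted M s eta : 0 <= s -> 0 < eta -> F (s + eta ^+ 2) (window M s eta).
Proof.
move=> s0 eta0; have e20 : 0 < eta ^+ 2 by rewrite exprn_gt0.
have t0 : 0 <= s + eta ^+ 2 by lra.
rewrite /window setDE; apply: (filtration_setI hF) => //.
  by apply: near_incr_adapted; lra.
apply: (filtration_setC hF) => //; apply: (filtration_bigcup hF) => // m.
exact: dyadic_excursion_adapted.
Qed.

Lemma pr_window : exists2 M : R, 0 < M & exists2 p : R, 0 < p <= 1 & exists2 eta0 : R, 0 < eta0 &
  forall (s eta : R) A, 0 <= s -> 0 < eta <= eta0 -> F s A ->
    p * pr A <= pr (A `&` window M s eta).
Proof.
have h2 : 0 < 2^-1 :> R by lra.
have [p /andP[p0 p1] [h0 h00 hp]] := pr_near_incr corner_dir h2.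
have p20 : 0 < p / 2 by lra.
(* Excursions may use up half of the probability p; the other half remains. *)
have [M M0 hM] := pr_dyadic_excursion p20.
exists M => //; exists (p / 2); first lra.
exists (Num.min 1 h0); first by rewrite lt_min h00 ltr01.
move=> s eta A s0 /andP[eta0]; rewrite le_min => /andP[eta1 etah] FA.
have e20 : 0 < eta ^+ 2 by rewrite exprn_gt0.
have e2e : eta ^+ 2 <= eta by rewrite expr2 ler_piMr// ltW.
have mA := filtration_measurable hF s0 FA.
have ss : 0 <= s < s + eta ^+ 2 by lra.
have mN : measurable (near_incr s (s + eta ^+ 2) corner_dir (2^-1)).
  by apply: (@filtration_measurable _ _ _ _ _ hF (s + eta ^+ 2)); [lra|apply: near_incr_adapted; lra].
have h := hp _ _ A ss (ltac:(lra) : s + eta ^+ 2 - s <= h0) FA.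
have e21 : 0 < eta ^+ 2 <= 1 by lra.
have := hM s (eta ^+ 2) A s0 e21 FA; rewrite sqrtr_sqr gtr0_norm//.
set D := \bigcup_m _ => hD.
have mD : measurable D.
  apply: bigcupT_measurable => m; apply: (@filtration_measurable _ _ _ _ _ hF (s + eta ^+ 2)); first lra.
  exact: dyadic_excursion_adapted.
have mAN := measurableI _ _ mA mN.
have := pr_split P mAN mD.
rewrite /window [in X in _ <= X]setDE [in X in _ <= X]setIA -[in X in _ <= X]setDE -/D.
have : pr (A `&` near_incr s (s + eta ^+ 2) corner_dir 2^-1 `&` D) <= pr (A `&` D).
  by apply: pr_le; [exact: measurableI|exact: measurableI|move=> w [[]]].
lra.
Qed.

Definition tube_event (M eta : R) n (s : R) : set T :=
  [set w | forall l, (l < n)%N -> window M (s + l%:R * eta ^+ 2) eta w].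

Lemma tube_eventS M eta n s : tube_event M eta n.+1 s =
  tube_event M eta n s `&` window M (s + n%:R * eta ^+ 2) eta.
Proof.
apply/seteqP; split=> w.
  by move=> h; split; [move=> l ln; apply: h; exact: ltnW|exact: h].
by move=> [h hn] l; rewrite ltnS leq_eqVlt => /predU1P[->//|]; exact: h.
Qed.

Lemma tube_event_adapted M eta n s : 0 <= s -> 0 < eta ->
  F (s + n%:R * eta ^+ 2) (tube_event M eta n s).
Proof.
move=> s0 eta0; have e20 : 0 < eta ^+ 2 by rewrite exprn_gt0.
elim: n => [|n IH].
  rewrite mul0r addr0 (_ : tube_event _ _ _ _ = setT); first exact: (filtration_setT hF).
  by apply/seteqP; split.
have sn : 0 <= s + n%:R * eta ^+ 2 by rewrite addr_ge0// mulr_ge0// ltW.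
have sn1 : s + n.+1%:R * eta ^+ 2 = s + n%:R * eta ^+ 2 + eta ^+ 2.
  by rewrite -(natr1 n); ring.
rewrite tube_eventS sn1; apply: (filtration_setI hF); first lra.
  by apply: (filtration_le hF _ IH); lra.
exact: window_adapted.
Qed.

(** [M] is fixed before n, because the number of windows needed to bring [Z] to face i depends on
    [M]. Conditioning window after window, the probability is a power with exponent n. *)
Lemma pr_tube : exists2 M : R, 0 < M & forall n, exists2 p : R, 0 < p <= 1 &
  exists2 eta0 : R, 0 < eta0 &
  forall (s eta : R) A, 0 <= s -> 0 < eta <= eta0 -> F s A ->
    p * pr A <= pr (A `&` tube_event M eta n s).
Proof.
have [M M0 [p /andP[p0 p1] [eta0 eta00 hp]]] := pr_window.
exists M => // n; exists (p ^+ n); first by rewrite exprn_gt0//= exprn_ile1// ltW.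
exists eta0 => // s eta A s0 /[dup] etab /andP[e0 _] FA.
have e20 : 0 < eta ^+ 2 by rewrite exprn_gt0.
elim: n => [|n IH].
  rewrite expr0 mul1r (_ : tube_event _ _ _ _ = setT) ?setIT//.
  by apply/seteqP; split.
have sn : 0 <= s + n%:R * eta ^+ 2 by rewrite addr_ge0// mulr_ge0// ltW.
have FT : F (s + n%:R * eta ^+ 2) (A `&` tube_event M eta n s).
  apply: (filtration_setI hF) => //; last exact: tube_event_adapted.
  by apply: (filtration_le hF _ FA); rewrite s0 lerDl mulr_ge0// ltW.
have := hp _ _ _ sn etab FT; rewrite tube_eventS setIA (exprS p n) -mulrA.
by apply: le_trans; rewrite ler_pM2l.
Qed.

(** Excursions are controlled at dyadic fractions of a window only; by continuity an excess over
    [M * eta] at v persists near v, hence at such a time. *)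
Lemma tube_event_tube M eta n s w : 0 <= s -> 0 < eta -> 0 < M -> ~ N w ->
  tube_event M eta n s w -> tube i M eta n s (X^~ w).
Proof.
move=> s0 eta0 M0 nw h l ln /=; have e20 : 0 < eta ^+ 2 by rewrite exprn_gt0.
set u := s + _; have u0 : 0 <= u by rewrite addr_ge0// mulr_ge0// ltW.
have [hn hd] := h l ln; rewrite -/u in hn hd.
have ni k : `|X (u + eta ^+ 2) w k 0 - X u w k 0 - eta * corner_dir k 0| < eta * 2^-1.
  have := hn k; rewrite (_ : u + eta ^+ 2 - u = eta ^+ 2); last by ring.
  by rewrite sqrtr_sqr (gtr0_norm eta0).
split.
- by have := ni i; rewrite mxE eqxx ltr_norml; lra.
- by have := ni j; rewrite mxE (negbTE (rev_ord_neq i)) ltr_norml; lra.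
move=> v uv k; rewrite mulrC leNgt; apply/negP => hv.
have cX := path_continuousB (contX nw k) (path_continuous_cst (X u w k 0)).
have v0 : 0 <= v by lra.
have gap : 0 < `|X v w k 0 - X u w k 0| - eta * M by lra.
have [del del0 hdel] := cX v v0 _ gap.
have [m hm] : exists m, eta ^+ 2 / (2 ^ m)%:R < del.
  exists (Num.bound (eta ^+ 2 / del)).
  rewrite ltr_pdivrMr ?ltr0n ?expn_gt0// mulrC -ltr_pdivrMr//.
  apply: lt_le_trans (archi_boundP _) _; first by rewrite divr_ge0// ltW.
  by rewrite ler_nat ltnW// ltn_expl.
have m0 : 0 < (2 ^ m)%:R :> R by rewrite ltr0n expn_gt0.
pose x0 := (v - u) / eta ^+ 2 * (2 ^ m)%:R.
have x00 : 0 <= x0.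
  by apply: mulr_ge0; [apply: divr_ge0; [lra|exact: ltW]|exact: ltW].
have /andP[l1 l2] := truncn_itv x00.
set k0 := Num.truncn x0 in l1 l2.
have k0m : (k0 <= 2 ^ m)%N.
  rewrite -(ler_nat R); apply: le_trans l1 _.
  rewrite /x0; apply: ler_piMl; first exact: ltW.
  by rewrite ler_pdivrMr// mul1r; lra.
apply: hd; exists m => //; exists k0 => // hsm.
have := hsm k; set t := u + _ => ht.
have tv : `|t - v| < del.
  have e1 : t - v = eta ^+ 2 / (2 ^ m)%:R * (k0%:R - x0).
    rewrite /t /x0; field.
    by rewrite !gt_eqF.
  rewrite e1 normrM gtr0_norm ?divr_gt0//; apply: le_lt_trans hm.
  apply: ler_piMr; first by apply/ltW/divr_gt0.
  by rewrite ler_norml; rewrite -(natr1 k0) in l2; lra.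
have t0 : 0 <= t by rewrite /t addr_ge0// mulr_ge0 ?(ltW e20)// divr_ge0.
have := hdel t t0 tv.
have := ler_normB (X t w k 0 - X u w k 0)
  ((X t w k 0 - X u w k 0) - (X v w k 0 - X u w k 0)).
by rewrite [X in `|X| <= _]subKr; lra.
Qed.

End Tube.

(** * Times of running maximum of a linear form *)

Section RunningMax.
Variable c : 'I_2 -> R.
Hypothesis c_neq0 : exists i, c i != 0.

(** A version of the form that vanishes on [N] and is frozen at negative times: all its paths are
    continuous on the half-line, so it is jointly measurable as the limit of its values at grid
    times. *)
Let V (p : R * T) : R := linform c (Num.max 0 p.1) p.2 * \1_(~` N) p.2.

Let max0 (t : R) : 0 <= Num.max 0 t. Proof. by rewrite le_max lexx. Qed.

Let mN : measurable N.
Proof. exact: (filtration_measurable hF (lexx 0) (filtration_negligible hF (lexx 0) negN)). Qed.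

Let V_section (t : R) : measurable_fun setT (fun w => V (t, w)).
Proof.
apply: measurable_funM; last by apply: measurable_indic; exact: measurableC.
apply: (@measurable_sum _ _ _ _ _ (index_enum 'I_2) (fun i w => c i * X (Num.max 0 t) w i 0)) => i.
apply: measurable_funM => //.
rewrite (_ : (fun w => _) = fun w => x i 0 + Num.max 0 t * b i 0 +
  (sigma i 0 * W (Num.max 0 t) w 0 0 + sigma i 1 * W (Num.max 0 t) w 1 0)).
  apply: measurable_funD => //; apply: measurable_funD; apply: measurable_funM => //;
    exact: W_measurable.
by apply/funext => w; rewrite X_coord.
Qed.

Let grid m (t : R) := Num.truncn (Num.max 0 t * m.+1%:R).

Let V_grid m (p : R * T) := V ((grid m p.1)%:R / m.+1%:R, p.2).

Let measurable_V_grid m : measurable_fun setT (V_grid m).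
Proof.
move=> _ B mB; rewrite setTI.
rewrite (_ : V_grid m @^-1` B = \bigcup_k ((grid m @^-1` [set k]) `*`
  ((fun w => V (k%:R / m.+1%:R, w)) @^-1` B))).
  apply: bigcupT_measurable => k; apply: measurableX.
    rewrite (_ : grid m @^-1` [set k] =
      (fun t : R => Num.max 0 t * m.+1%:R) @^-1` `[k%:R, k.+1%:R[).
      rewrite -[X in measurable X]setTI.
      have mf : measurable_fun setT (fun t : R => Num.max 0 t * m.+1%:R).
        by apply: measurable_funM => //; exact: measurable_maxr.
      exact: mf.
    apply/seteqP; split=> t /=; rewrite in_itv/= -truncn_eq ?mulr_ge0//.
      by move=> <-.
    by move=> /eqP.
  by rewrite -[X in measurable X]setTI; exact: V_section.
apply/seteqP; split=> [[t w] /= h|[t w] [k _ [/= tk h]]].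
  by exists (grid m t).
by rewrite /V_grid /= tk.
Qed.

Let V_cont w : path_continuous (fun t => V (t, w)).
Proof.
rewrite /V /= indicE; have [nw|nw] := pselect (N w).
  rewrite memNset/=; last by rewrite /setC/=.
  rewrite (_ : (fun t => _) = fun=> 0); first exact: path_continuous_cst.
  by apply/funext => t; rewrite mulr0.
rewrite mem_set//= => t t0 e e0.
have cl : path_continuous (fun t => linform c t w).
  rewrite (_ : (fun t => _) = fun t => c 0 * X t w 0 0 + c 1 * X t w 1 0).
    by apply: path_continuousD; apply: path_continuousZ; exact: contX.
  by apply/funext => u; rewrite /linform (sum_ord2 0) rev01.
have [del del0 h] := cl t t0 e e0; exists del => // u u0 ut.
by rewrite !mulr1 !max_r//; exact: h.
Qed.

Let measurable_V : measurable_fun setT V.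
Proof.
apply: (measurable_fun_cvg (h := V_grid) measurable_V_grid) => -[t w] _.
have VE : V (t, w) = V (Num.max 0 t, w) by rewrite /V /= maxA maxxx.
rewrite VE; apply/cvgrPdist_lt => e e0.
have [del del0 h] := V_cont w (max0 t) e0.
near=> m; rewrite distrC; apply: h; first by rewrite divr_ge0.
have m0 : 0 < m.+1%:R :> R by [].
have tm : 0 <= Num.max 0 t * m.+1%:R by rewrite mulr_ge0.
have /andP[l1 l2] := truncn_itv tm.
have dm : del^-1 < m.+1%:R.
  near: m; exists (Num.bound del^-1) => // m /= hm.
  apply: lt_le_trans (archi_boundP _) _; first by rewrite invr_ge0 ltW.
  by rewrite ler_nat; apply: leq_trans hm _.
have md : m.+1%:R^-1 < del by rewrite invf_plt ?posrE.
apply: le_lt_trans md.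
rewrite ler_norml /grid /=; apply/andP; split.
  rewrite -(ler_pM2r m0) mulrBl mulNr divfK ?gt_eqF// mulVf ?gt_eqF//.
  by rewrite -(natr1 (Num.truncn _)) in l2; lra.
rewrite -(ler_pM2r m0) mulrBl divfK ?gt_eqF// mulVf ?gt_eqF//.
by lra.
Unshelve. all: by end_near. Qed.

Lemma ae_running_max_null : {ae P, forall w, lebesgue_measure.-negligible
  [set t : R | 0 <= t /\ forall s : R, 0 <= s <= t -> linform c s w <= linform c t w]}.
Proof.
(* Rational fractions of t turn the condition into a countable intersection of measurable subsets of
   the product. Time 0, always a running maximum, is left out and added back at the end. *)
pose C : set (R * T) := [set p | 0 < p.1] `&`
  \bigcap_(q : rat) (if 0 <= q <= 1 then [set p | V (p.1 * ratr q, p.2) <= V p] else setT).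
have mC : measurable (C : set (measurableTypeR R * T)).
  apply: measurableI.
    rewrite (_ : [set p | _] = fst @^-1` `]0, +oo[).
      by rewrite -[X in measurable X]setTI; exact: measurable_fst.
    by apply/seteqP; split=> p /=; rewrite in_itv/= andbT.
  rewrite -[X in measurable X]setCK setC_bigcap; apply: measurableC.
  apply: bigcupT_measurable_rat => q; apply: measurableC; case: ifPn => // _.
  have mf : measurable_fun setT (fun p : R * T => V p - V (p.1 * ratr q, p.2)).
    apply: measurable_funB; first exact: measurable_V.
    apply: (measurableT_comp measurable_V).
    apply: measurable_fun_pair => //; apply: measurable_funM => //.
  rewrite (_ : [set p | _] = (fun p : R * T => V p - V (p.1 * ratr q, p.2)) @^-1` `[0, +oo[).
    by rewrite -[X in measurable X]setTI; exact: mf.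
  by apply/seteqP; split=> p /=; rewrite in_itv/= andbT subr_ge0.
have sec0 t : P (xsection C t) = 0%E.
  have mS := measurable_xsection t mC.
  have [t0|t0] := ltP 0 t; last first.
    rewrite (_ : xsection C t = set0) ?measure0//.
    apply/seteqP; split=> // w; rewrite /xsection/= inE => -[/= ]; lra.
  suff : pr (xsection C t) = 0 by rewrite (prE P)// => ->.
  apply/eqP; rewrite eq_le pr_ge0 andbT; apply/ler_addgt0Pl => e e0; rewrite addr0.
  have [K [u [hu hpr]]] := pr_running_max c_neq0 t0 e0.
  set G := [set w | _] in hpr.
  have mG : measurable G.
    rewrite (_ : G = \bigcap_(j in `I_K) ~` [set w | 0 < linform c (u j) w - linform c t w]).
      apply: bigcap_measurableType => j jK; apply: measurableC.
      rewrite (_ : [set w | _] = [set w | 0 <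
        linform (fun i => - c i) t w - linform (fun i => - c i) (u j) w]).
        apply: (@filtration_measurable _ _ _ _ _ hF t); first exact: ltW.
        by apply: linform_pair_adapted; have := hu j; lra.
      apply/seteqP; split=> w /=; rewrite /linform !(sum_ord2 0); lra.
    by apply/seteqP; split.
  have prN : pr N = 0.
    by have := prE P mN; rewrite (measure_negligible mN negN) => -[].
  apply: (@le_trans _ _ (pr (G `|` N))).
    apply: pr_le => //; first exact: measurableU.
    move=> w; rewrite /xsection /= inE => -[/= _ hq].
    have [nw|nw] := pselect (N w); [by right|left] => j jK.
    have h : V (u j, w) <= V (t, w).
      apply: (rational_dense_le (V_cont w) (ltW t0)); last by have := hu j; lra.
      by move=> q q01; have := hq q I; rewrite q01.
    move: h; rewrite /V /= indicE mem_set//= !mulr1 !max_r ?(ltW t0)//; last by have := hu j; lra.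
    lra.
  by apply: le_trans (prU_le P mG mN) _; rewrite prN addr0.
have := null_section_swap (@lebesgue_measure R) mC sec0.
move=> nC; have := negligibleU negN nC; apply: negligibleS => w /= hw.
apply: contrapT => /not_orP[nw /negP]; rewrite negbK => /eqP h0; apply: hw.
have mY := measurable_ysection w mC.
have : lebesgue_measure.-negligible ([set 0] `|` ysection C w).
  by apply: negligibleU; [apply/negligibleP => //; exact: lebesgue_measure_set1|exact/negligibleP].
apply: negligibleS => t [t0 ht].
have [->|t_neq0] := eqVneq t 0; [by left|right].
have tp : 0 < t by rewrite lt_neqAle eq_sym t_neq0.
rewrite /ysection /= inE; split => // q _; case: ifPn => // /andP[q0 q1] /=.
rewrite /V /= indicE mem_set//= !mulr1 !max_r//; last by rewrite mulr_ge0// ler0q.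
apply: ht; rewrite mulr_ge0 ?ler0q//= ler_piMr//.
by rewrite -[1 in leRHS](rmorph1 (ratr : rat -> R)) ler_rat.
Qed.

End RunningMax.

Lemma first_hit_adapted B (tm : nat -> R) : (forall l, 0 <= tm l) ->
  (forall l l', (l <= l')%N -> tm l <= tm l') ->
  (forall l, F (tm l) (B l)) -> forall l, F (tm l) (first_hit B l).
Proof.
move=> tm0 tmm FB l.
rewrite (_ : first_hit B l = B l `&` \bigcap_(l' : nat)
   (if (l' < l)%N then ~` B l' else setT)).
  apply: (filtration_setI hF) => //.
  apply: (filtration_countable_inter hF) => // l'; case: ifPn => ll; last exact: (filtration_setT hF).
  apply: (filtration_setC hF) => //; apply: (filtration_le hF _ (FB l')).
  by rewrite tm0 tmm// ltnW.
apply/seteqP; split=> w [h2 h3]; split => //.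
  by move=> l' _; case: ifPn => // /h3.
by move=> l' ll; have := h3 l' I; rewrite ll.
Qed.

(** * Behaviour of the reflected process at the faces and the corner *)

Section Reflected.
Variable d : 'I_2 -> 'cV[R]_2.
Hypothesis d1 : forall i, d i i 0 = 1.
Hypothesis dichotomy : `|d 0 1 0 * d 1 0 0| < 1 \/
  [/\ d 0 1 0 * d 1 0 0 = 1, 0 < d 0 1 0 & 0 < d 1 0 0].
Variable Z : R -> T -> 'cV[R]_2.
Hypothesis solN : forall w, ~ N w -> sp_solution d (X^~ w) (Z^~ w).

Lemma reflected_open_event (s : R) (O : set T) : 0 <= s ->
  (forall w, ~ N w -> O w -> exists2 e : R, 0 < e & forall w', ~ N w' ->
     (forall (u : R) i, 0 <= u <= s -> `|X u w' i 0 - X u w i 0| <= e) ->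
     (forall (u : R) i, 0 <= u <= s -> `|Z u w' i 0 - Z u w i 0| <= e) -> O w') ->
  F s O.
Proof.
move=> s0 hO; have [K K0 hK] := skorokhod_lipschitz d1 dichotomy.
apply: open_event => // w nw Ow; have [e e0 he] := hO w nw Ow.
exists (Num.min e (e / K)); first by rewrite lt_min e0 divr_gt0.
move=> w' nw' hX'; apply: he => // u i us.
  by apply: le_trans (hX' u i us) _; rewrite ge_min lexx.
have := hK _ _ _ _ s _ (solN nw') (solN nw) hX' u i us.
move=> /le_trans; apply; apply: (@le_trans _ _ (K * (e / K))).
  by rewrite ler_pM2l// ge_min lexx orbT.
by rewrite mulrC divfK ?gt_eqF.
Qed.

Let coordinate (i : 'I_2) : 'I_2 -> R := fun k => (k == i)%:R.

Let coordinate_neq0 i : exists k, coordinate i k != 0.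
Proof. by exists i; rewrite /coordinate eqxx oner_neq0. Qed.

Let linform_coordinate i t w : linform (coordinate i) t w = X t w i 0.
Proof.
rewrite /linform (sum_ord2 i) /coordinate eqxx (negbTE (rev_ord_neq i)).
by rewrite mul1r mul0r addr0.
Qed.

(** Excludes a constant pushing near time 0 when the path starts on face i: [X] would then stay
    above its initial coordinate, as [Z] does. *)
Lemma ae_initial_descent i (del : R) : 0 < del ->
  P.-negligible [set w | forall r : R, 0 < r < del -> 0 <= X r w i 0 - X 0 w i 0].
Proof.
move=> del0; apply: negligible_liminf => e e0.
have del20 : 0 < del / 2 by lra.
have [rho rho0 [K [lag [hlag hpr]]]] := pr_no_descent (coordinate_neq0 i) del20 e0.
exists (fun=> [set w | forall l, (l < K)%N ->
  - rho < linform (coordinate i) (0 + lag l) w - linform (coordinate i) 0 w]).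
split.
  move=> _; split.
    rewrite (_ : [set w | _] = \bigcap_(l in `I_K) [set w | - rho <
      linform (coordinate i) (0 + lag l) w - linform (coordinate i) 0 w]); last by apply/seteqP; split.
    apply: bigcap_measurableType => l lK; have := hlag l lK => hl.
    apply: (@filtration_measurable _ _ _ _ _ hF (0 + lag l)); first lra.
    by apply: linform_pair_adapted; lra.
  have := hpr 0 setT (lexx 0) (filtration_setT hF (lexx 0)).
  rewrite setTI => /le_trans; apply; rewrite ler_piMr ?(ltW e0)//.
  exact: pr_le1.
move=> w hw; exists 0%N => _ _ l lK; have := hlag l lK => hl.
rewrite !linform_coordinate add0r.
have := hw (lag l); lra.
Qed.

(* At the first grid time where the free path Z q + X - X q is below rho at
   coordinate i, a descent by rho within time del takes it through face i. *)
Lemma ae_no_touching i (q r del : R) : 0 <= q -> 0 < del -> q < r ->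
  P.-negligible [set w | ~ N w /\ (exists2 t : R, q <= t < r - del &
      Z q w i 0 + (X t w i 0 - X q w i 0) = 0) /\
    forall u : R, q <= u <= r -> 0 <= Z q w i 0 + (X u w i 0 - X q w i 0)].
Proof.
move=> q0 del0 qr; apply: negligible_liminf => e e0.
have [rho rho0 [K [lag [hlag hpr]]]] := pr_no_descent (coordinate_neq0 i) del0 e0.
pose V u w := Z q w i 0 + (X u w i 0 - X q w i 0).
pose tm m l : R := q + l%:R / m.+1%:R.
have tmq m l : q <= tm m l by rewrite /tm lerDl divr_ge0.
pose low u := [set w | V u w < rho].
have Flow u : q <= u -> F u (low u).
  move=> qu; have u0 : 0 <= u by lra.
  apply: reflected_open_event => // w nw; rewrite /low /= => hw.
  exists ((rho - V u w) / 4); first by rewrite divr_gt0// subr_gt0.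
  move=> w' nw' hX' hZ'.
  have := hX' u i; have := hX' q i; have := hZ' q i.
  rewrite !ler_norml /V in hw * => a1 a2 a3.
  have := a1 (ltac:(lra)); have := a2 (ltac:(lra)); have := a3 (ltac:(lra)).
  by lra.
pose A m := first_hit (fun l => low (tm m l)).
have tm0 m l : 0 <= tm m l by apply: le_trans (tmq m l).
have tmm m l l' : (l <= l')%N -> tm m l <= tm m l'.
  by move=> ll; rewrite lerD2l ler_pM2r ?invr_gt0// ler_nat.
have FA m l : F (tm m l) (A m l).
  by apply: (first_hit_adapted (tm0 m) (tmm m)) => l'; exact: Flow.
have mA m l : measurable (A m l) := filtration_measurable hF (tm0 m l) (FA m l).
have tA m : trivIset [set: nat] (A m) by exact: trivIset_first_hit.
pose stay s := [set w | forall l, (l < K)%N ->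
  - rho < linform (coordinate i) (s + lag l) w - linform (coordinate i) s w].
have mstay s : 0 <= s -> measurable (stay s).
  move=> s0; rewrite (_ : stay s = \bigcap_(l in `I_K) [set w | - rho <
      linform (coordinate i) (s + lag l) w - linform (coordinate i) s w]); last by apply/seteqP; split.
  apply: bigcap_measurableType => l lK; have := hlag l lK => hl.
  apply: (@filtration_measurable _ _ _ _ _ hF (s + lag l)); first lra.
  by apply: linform_pair_adapted; lra.
exists (fun m => \big[setU/set0]_(l < m.+1 * m.+1) (A m l `&` stay (tm m l))); split.
  move=> m; split.
    by apply: bigsetU_measurable => l _; apply: measurableI => //; exact: mstay.
  rewrite (pr_bigsetU P (A := fun l => A m l `&` stay (tm m l))); last 2 first.
  - by move=> l _; apply: measurableI => //; exact: mstay.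
  - exact: trivIset_setIr.
  apply: (@le_trans _ _ (\sum_(l < m.+1 * m.+1) e * pr (A m l))).
    by apply: ler_sum => l _; exact: hpr.
  rewrite -mulr_sumr -(pr_bigsetU P (A := A m))//.
  rewrite ler_piMr ?(ltW e0)//; apply: pr_le1.
  by apply: bigsetU_measurable => l _.
move=> w [nw [[t /andP[qt tr] Vt] Vpos]].
have t0 : 0 <= t by lra.
have sol := solN nw.
have cV : path_continuous (fun u => V u w).
  apply: path_continuousD; first exact: path_continuous_cst.
  by apply: path_continuousB; [exact: sp_cont_in sol i|exact: path_continuous_cst].
have Vt' : V t w < rho by rewrite /V Vt.
have [eta eta0 heta] := path_continuous_lt cV t0 Vt'.
pose eta' := Num.min eta (r - del - t).
have eta'0 : 0 < eta' by rewrite lt_min eta0/=; lra.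
(* The mesh must be below [eta'], and the grid must extend beyond t. *)
exists (Num.bound (eta'^-1) + Num.bound (t - q))%N => m mM.
have m1 : m.+1%:R^-1 < eta'.
  rewrite invf_plt ?posrE//; apply: lt_trans (archi_boundP _) _; first by rewrite invr_ge0 ltW.
  by rewrite ltr_nat ltnS (leq_trans _ mM)// leq_addr.
have m2 : t - q < m%:R.
  apply: lt_le_trans (archi_boundP _) _; first lra.
  by rewrite ler_nat (leq_trans _ mM)// leq_addl.
have [k km ktm] := grid_point qt m2; rewrite -/(tm m k) in ktm.
have klow : low (tm m k) w.
  rewrite /low /=; apply: heta => //.
  have : eta' <= eta by rewrite ge_min lexx.
  rewrite ltr_norml; move: ktm m1; set y := tm m k; set x1 := _^-1; lra.
have [l lk Al] := first_hit_exists (B := fun l => low (tm m l)) klow.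
have ltmk := tmm m _ _ lk.
have ktm' : tm m k < t + eta' by move: ktm m1; set y := tm m k; set x1 := _^-1; lra.
have le' : eta' <= r - del - t by rewrite ge_min lexx orbT.
rewrite -(bigcup_mkord (m.+1 * m.+1) (fun l => A m l `&` stay (tm m l))).
exists l; first exact: leq_ltn_trans lk km.
split => //; have [hl _] := Al.
move=> l' lK; rewrite !linform_coordinate; have := hlag l' lK => hl'.
have := Vpos (tm m l + lag l'); have := tmq m l.
by move: hl; rewrite /low /= /V; lra.
Qed.

(** Stages 0, ..., k are reached at strictly increasing indices, the last being l; the nested form
    makes adaptedness at l an induction. *)
Fixpoint chain (A : nat -> (set T)^nat) k l : set T :=
  if k is k'.+1 then A k l `&` \bigcup_(l' in `I_l) chain A k' l' else A 0 l.

(** [G k l] is an attempt at stage k whose success prevents stage k + 1 later on. Reaching the next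
    stage thus requires a failure, and since the events of one stage are disjoint, each stage costs
    a factor 1 - p. *)
Lemma pr_chain_le (p : R) (tm : nat -> R) (L : nat) (A G : nat -> (set T)^nat) :
  p <= 1 -> (forall l, 0 <= tm l) -> (forall l l', (l <= l')%N -> tm l <= tm l') ->
  (forall k l, F (tm l) (A k l)) -> (forall k, trivIset [set: nat] (A k)) ->
  (forall k l, measurable (G k l)) ->
  (forall k l B, F (tm l) B -> p * pr B <= pr (B `&` G k l)) ->
  (forall k l l', (l < l')%N -> A k l `&` G k l `&` A k.+1 l' = set0) ->
  forall k, measurable (\bigcup_(l in `I_L) chain A k l) /\
    pr (\bigcup_(l in `I_L) chain A k l) <= (1 - p) ^+ k.
Proof.
move=> p1 tm0 tmm FA tA mG hG AGA; pose C := chain A.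
have C0 l : C 0 l = A 0 l by [].
have CS k l : C k.+1 l = A k.+1 l `&` \bigcup_(l' in `I_l) C k l' by [].
have CA k l : C k l `<=` A k l.
  by case: k => [|k]; [rewrite C0|rewrite CS; apply: subIset; left].
have FC k l : F (tm l) (C k l).
  elim: k l => [|k IH] l; first by rewrite C0.
  rewrite CS; apply: (filtration_setI hF) => //.
  rewrite (_ : \bigcup_(l' in _) _ = \bigcup_(l' : nat)
     (if (l' < l)%N then C k l' else set0)).
    apply: (filtration_countable_union hF) => // l'; case: ifPn => ll; last exact: (filtration_set0 hF).
    by apply: (filtration_le hF _ (IH l')); rewrite tm0 tmm// ltnW.
  apply/seteqP; split=> w [l' h hw]; exists l' => //.
  - by move: h => /= ->.
  - by move: hw => /=; case: ifPn.
  - by move: hw => /=; case: ifPn.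
have mC k l : measurable (C k l) := filtration_measurable hF (tm0 l) (FC k l).
have mU k : measurable (\bigcup_(l in `I_L) C k l) by exact: bigcup_measurable.
have tC k (D : (set T)^nat) : (forall l, D l `<=` C k l) -> trivIset [set: nat] D.
  move=> DC l l' _ _ [w [Dl Dl']]; apply: (tA k) => //.
  by exists w; split; apply: CA; exact: DC.
move=> k; split; first exact: mU.
rewrite -/C; elim: k => [|k IH]; first by rewrite expr0; exact: pr_le1.
apply: (@le_trans _ _ (pr (\bigcup_(l in `I_L) (C k l `\` G k l)))).
  apply: pr_le => //; first by apply: bigcup_measurable => l _; exact: measurableD.
  move=> w [l' /= lL]; rewrite CS => -[Al [l ll Cl]].
  exists l; first exact: ltn_trans lL.
  split => // Gl; have : (A k l `&` G k l `&` A k.+1 l') w by split => //; split => //; exact: CA.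
  by rewrite AGA.
rewrite bigcup_mkord (pr_bigsetU P (A := fun l => C k l `\` G k l)); last 2 first.
- by move=> l _; exact: measurableD.
- by apply: (tC k) => l; exact: subDsetl.
apply: (@le_trans _ _ (\sum_(l < L) (1 - p) * pr (C k l))).
  apply: ler_sum => l _; have := hG k l _ (FC k l).
  have := pr_split P (mC k l) (mG k l); lra.
rewrite -mulr_sumr -(pr_bigsetU P (A := C k))//; last by apply: (tC k) => l.
rewrite -bigcup_mkord exprS; apply: ler_wpM2l => //; lra.
Qed.

(* With Z_i positive, Z_0 + Z_1 passes below each r k before vanishing; if X
   follows a tube after the first grid time below r k, then by [tube_exit] it
   cannot pass below r k.+1.  The grid is fine enough, for a given path, to have
   Z_0 + Z_1 > r k / 2 at that time. *)
Lemma ae_no_corner_hit i (q : R) : 0 <= q ->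
  P.-negligible [set w | ~ N w /\ exists2 t : R, q < t &
    Z t w = 0 /\ forall u : R, q <= u < t -> 0 < Z u w i 0].
Proof.
move=> q0; pose j := rev_ord i; pose c := d j i 0.
pose D (u : R) w := Z u w i 0 + Z u w j 0.
(* A lower bound on the initial distance to the corner allows the first scale to be fixed
   independently of the path. *)
pose E (n : nat) := [set w | [/\ ~ N w, n.+1%:R^-1 <= D q w & exists2 t : R, q < t &
    Z t w = 0 /\ forall u : R, q <= u < t -> 0 < Z u w i 0]].
suff hE n : P.-negligible (E n).
  apply: (negligibleS _ (negligible_bigcup hE)) => w [nw [t qt [Zt Zpos]]].
  have Dq : 0 < D q w.
    have := sp_ge0 (solN nw) q0 j; have := Zpos q; rewrite lexx qt => /(_ isT).
    by rewrite /D; lra.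
  have := archi_boundP (ltac:(by rewrite invr_ge0 ltW) : 0 <= (D q w)^-1).
  set n := Num.bound _ => hn; exists n => //; split => //; last by exists t.
  rewrite invf_ple ?posrE//; apply/ltW/(lt_trans hn).
  by rewrite ltr_nat.
have [M M0 hM] := pr_tube i.
(* With r k = rho * eta k the loss (2 + |c|) * M * eta k in [tube_exit] is r k / 16. Starting above
   r k / 2, the sum stays above r k / 4 - r k / 16, which exceeds r k.+1 = r k / 16. *)
pose rho : R := 16 * (2 + `|c|) * M.
have c0 : 0 <= `|c| by [].
have rho0 : 0 < rho by rewrite /rho !mulr_gt0//; lra.
have cM0 : 0 <= `|c| * M by rewrite mulr_ge0// ltW.
(* Enough windows for the tube to lower X_i by more than r k plus the largest possible contribution
   |c| * M * eta k of face j. *)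
have := archi_boundP (ltac:(by rewrite addr_ge0// ltW) : 0 <= rho + `|c| * M).
set n' := Num.bound _ => hn'.
have [p /andP[p0 p1] [eta0 eta00 hp]] := hM n'.
pose ra : R := Num.min (n.+1%:R^-1) (rho * eta0).
have ra0 : 0 < ra by rewrite lt_min invr_gt0 ltr0n/= mulr_gt0.
pose r k : R := ra / 16 ^+ k.
have r0 k : 0 < r k by rewrite divr_gt0// exprn_gt0.
have rS k : r k = 16 * r k.+1.
  by rewrite /r exprS invfM mulrCA [_ * (16^-1 * _)]mulrA divff ?mul1r// pnatr_eq0.
have rra k : r k <= ra.
  by elim: k => [|k IH]; [rewrite /r expr0 divr1|have := rS k; have := r0 k.+1; lra].
pose tm m l : R := q + l%:R / m.+1%:R.
have tmq m l : q <= tm m l by rewrite /tm lerDl divr_ge0.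
have tm0 m l : 0 <= tm m l by apply: le_trans (tmq m l).
have tmm m l l' : (l <= l')%N -> tm m l <= tm m l'.
  by move=> ll; rewrite lerD2l ler_pM2r ?invr_gt0// ler_nat.
pose low (e u : R) := [set w | D u w < e].
have Flow (e u : R) : 0 <= u -> F u (low e u).
  move=> u0; apply: reflected_open_event => // w nw; rewrite /low /= => hw.
  exists ((e - D u w) / 4); first by rewrite divr_gt0// subr_gt0.
  move=> w' nw' _ hZ'; have := hZ' u i; have := hZ' u j.
  rewrite u0 lexx => /(_ isT) + /(_ isT); rewrite !ler_norml /D in hw *.
  by move=> /andP[? ?] /andP[? ?]; lra.
pose good (e u : R) := [set w | e / 2 < D u w /\ forall v : R, q <= v <= u -> 0 < Z v w i 0].
have Fgood (e u : R) : q <= u -> F u (good e u).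
  move=> qu; have u0 : 0 <= u by lra.
  apply: reflected_open_event => // w nw [hw Zpos].
  (* A uniform lower bound on the compact interval makes strict positivity an open condition. *)
  have [e1 e10 he1] := path_pos_lb (sp_cont (solN nw) i) q0 Zpos.
  exists (Num.min ((D u w - e / 2) / 4) (e1 / 2)).
    by rewrite lt_min divr_gt0 ?subr_gt0//= divr_gt0.
  move=> w' nw' _ hZ'; split.
    have := hZ' u i; have := hZ' u j.
    rewrite u0 lexx => /(_ isT) + /(_ isT); rewrite !le_min !ler_norml /D in hw *.
    by move=> /andP[/andP[? ?] _] /andP[/andP[? ?] _]; lra.
  move=> v /andP[qv vu]; have := hZ' v i; have := he1 v.
  rewrite vu qv (le_trans q0 qv) => /(_ isT) + /(_ isT); rewrite !le_min !ler_norml.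
  by move=> ? /andP[_ /andP[? ?]]; lra.
pose A m k l := ~` N `&` (first_hit (fun l => low (r k) (tm m l)) l `&` good (r k) (tm m l)).
have FA m k l : F (tm m l) (A m k l).
  apply: (filtration_setI hF) => //.
    by apply: (filtration_setC hF) => //; exact: (filtration_negligible hF).
  apply: (filtration_setI hF) => //; last exact: Fgood.
  by apply: (first_hit_adapted (tm0 m) (tmm m)) => l'; exact: Flow.
have tA m k : trivIset [set: nat] (A m k).
  move=> l l' _ _ [w [[_ [h _]] [_ [h' _]]]].
  apply: (trivIset_first_hit (B := fun l => low (r k) (tm m l)) I I).
  by exists w.
pose eta k := r k / rho.
have etab k : 0 < eta k <= eta0.
  rewrite divr_gt0//= ler_pdivrMr// mulrC; apply: le_trans (rra k) _.
  by rewrite ge_min lexx orbT.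
have re k : r k = rho * eta k by rewrite /eta mulrC divfK ?gt_eqF.
pose G m k l := tube_event i M (eta k) n' (tm m l).
have mG m k l : measurable (G m k l).
  have /andP[e0 _] := etab k.
  apply: (@filtration_measurable _ _ _ _ _ hF (tm m l + n'%:R * eta k ^+ 2)).
    by rewrite addr_ge0// mulr_ge0// exprn_ge0// ltW.
  exact: tube_event_adapted.
have AGA m k l l' : (l < l')%N -> A m k l `&` G m k l `&` A m k.+1 l' = set0.
  move=> ll; apply/seteqP; split=> w // [[[nw [[low1 _] [D1 _]]] Gw] [_ [[low2 _] [_ Zpos]]]].
  have /andP[e0 _] := etab k.
  have tb := tube_event_tube (tm0 m l) e0 M0 nw Gw.
  have st : 0 <= tm m l < tm m l' by rewrite tm0/= ltrD2l ltr_pM2r ?invr_gt0// ltr_nat.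
  have zi (u : R) : tm m l < u <= tm m l' -> 0 < Z u w i 0.
    by move=> /andP[lu ul]; apply: Zpos; rewrite ul (le_trans (tmq m l) (ltW lu)).
  have Zj := sp_ge0 (solN nw) (tm0 m l) j.
  have ee : rho * eta k = 16 * ((2 + `|c|) * (M * eta k)) by rewrite /rho; ring.
  have hn : Z (tm m l) w i 0 + `|c| * (M * eta k) < n'%:R * eta k.
    apply: (@lt_le_trans _ _ ((rho + `|c| * M) * eta k)); last by rewrite ler_pM2r// ltW.
    rewrite mulrDl -re mulrA ltrD2r; move: low1; rewrite /low /= /D; lra.
  have [_] := tube_exit d1 e0 (ltW M0) tb (solN nw) st zi hn.
  rewrite /low /good /D /= in low1 low2 D1; have := rS k; have := re k.
  by rewrite -/c -/j; lra.
have hK m k := pr_chain_le (m.+1 * m.+1) p1 (tm0 m) (tmm m) (FA m) (tA m) (mG m)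
  (fun k l B => hp (tm m l) (eta k) B (tm0 m l) (etab k)) (AGA m) k.
apply: negligible_liminf => e e0.
have [k hk] : exists k, (1 - p) ^+ k <= e.
  have : (1 - p) ^+ n @[n --> \oo] --> (0 : R).
    by apply: cvg_expr; rewrite ger0_norm; lra.
  move=> /cvgrPdist_le/(_ _ e0)[k _ /(_ k (leqnn k))]/=.
  rewrite sub0r normrN ger0_norm; last by rewrite exprn_ge0; lra.
  by exists k.
exists (fun m => \bigcup_(l in `I_(m.+1 * m.+1)) chain (A m) k l); split.
  by move=> m; split; [exact: (hK m k).1|exact: le_trans (hK m k).2 hk].
move=> w [nw Dq [t qt [Zt Zpos]]].
have cD : path_continuous (fun u => D u w).
  by apply: path_continuousD; exact: sp_cont (solN nw) _.
(* One mesh will move the sum by less than half of the smallest threshold, so that no first passage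
   below r k' jumps past r k' / 2. *)
have rk2 : 0 < r k / 2 by rewrite divr_gt0.
have [del del0 hdel] := path_uniformly_continuous (t + 1) cD rk2.
pose h := Num.min (Num.min del (t - q)) 1 / 2.
have h0 : 0 < h by rewrite divr_gt0// !lt_min del0 subr_gt0 qt ltr01.
have [h1 h2 h3] : [/\ 2 * h <= del, 2 * h <= t - q & 2 * h <= 1].
  by rewrite /h mulrC divfK// !ge_min !lexx ?orbT.
exists (Num.bound (h^-1) + Num.bound (t - q))%N => m mM.
have m1 : m.+1%:R^-1 < h.
  rewrite invf_plt ?posrE//; apply: lt_trans (archi_boundP _) _; first by rewrite invr_ge0 ltW.
  by rewrite ltr_nat ltnS (leq_trans _ mM)// leq_addr.
have m2 : t - h - q < m%:R.
  apply: (@lt_trans _ _ (t - q)); first lra.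
  apply: lt_le_trans (archi_boundP _) _; first lra.
  by rewrite ler_nat (leq_trans _ mM)// leq_addl.
have [|a am hta] := grid_point _ m2; first lra.
rewrite -/(tm m a) in hta.
have tat : tm m a < t by move: hta m1; set y := tm m a; set x1 := _^-1; lra.
have Dt : D t w = 0 by rewrite /D Zt !mxE addr0.
have Da : D (tm m a) w < r k / 2.
  have := hdel (tm m a) t; rewrite Dt subr0 => /(_ _ _ _)/(le_lt_trans (ler_norm _)); apply.
  - by have := tm0 m a; lra.
  - by have := tm0 m a; lra.
  - by rewrite ltr_norml; lra.
have rle k' : (k' <= k)%N -> r k <= r k'.
  elim: k k' {hk rk2 hdel del del0 h h0 h1 h2 h3 m1 m2 hta Da mM} => [|k1 IH] k'.
    by rewrite leqn0 => /eqP ->.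
  rewrite leq_eqVlt => /predU1P[->//|/IH]; have := rS k1; have := r0 k1.+1; lra.
have hA k' : (k' <= k)%N -> exists2 l, (l <= a)%N & A m k' l w.
  move=> kk; have rk := rle _ kk.
  have lowa : low (r k') (tm m a) w by rewrite /low /=; have := r0 k'; lra.
  have [l la fl] := first_hit_exists (B := fun l => low (r k') (tm m l)) lowa.
  exists l => //; split => //; split => //; split; last first.
    by move=> v /andP[qv vl]; apply: Zpos; rewrite qv (le_lt_trans vl)// (le_lt_trans _ tat)// tmm.
  (* Index 0 is impossible, because at time q the sum is at least 1 / (n + 1) >= r k'; at a later
     index the preceding grid value is still at least r k'. *)
  case: l la fl => [|l] la [fl1 fl2].
    move: fl1; rewrite /low /= /tm mul0r addr0 => Dq'.
    have : ra <= n.+1%:R^-1 by rewrite ge_min lexx.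
    by move=> /(le_trans (rra k'))/le_trans-/(_ _ Dq); have := r0 k'; lra.
  have := fl2 l (ltnSn l); rewrite /low /= => /negP; rewrite -leNgt => Dl.
  have tl : tm m l.+1 - tm m l = m.+1%:R^-1 by rewrite /tm -(natr1 l); ring.
  have ta1 := tmm m _ _ la; have ta2 := tmm m _ _ (leqnSn l).
  have tm1 := tm0 m l.+1; have tm2 := tm0 m l.
  have : D (tm m l) w - D (tm m l.+1) w < r k / 2.
    have := hdel (tm m l) (tm m l.+1); rewrite distrC tl ger0_norm ?invr_ge0//.
    move=> /(_ _ _ _)/ltr_normlW; apply.
    - by rewrite tm2/=; lra.
    - by rewrite tm1/=; lra.
    - by apply: lt_le_trans m1 _; lra.
  by rewrite /=; lra.
suff [l [la Cl]] : exists l, (l <= a)%N /\ chain (A m) k l w.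
  by exists l => //; exact: leq_ltn_trans am.
elim: {-2}k (leqnn k) => [_|k' IH kk]; first by have [l la Al] := hA 0 (leq0n k); exists l.
have [l [la Cl]] := IH (ltnW kk); have [l' la' Al'] := hA _ kk.
exists l'; split => //; split => //; exists l => //=.
have : A m k' l w by case: k' {IH kk Al'} Cl => [|k'] //= -[].
move: Al' => [_ [[low1 _] _]] [_ [[_ low2] [D1 _]]].
have := rS k'; have := r0 k'.+1; rewrite /low /= in low1 low2 D1 => rk1 rk2'.
(* The next stage comes strictly later: r k'.+1 is below r k' / 2, and the sum was above r k' / 2 at
   the first passage. *)
case: (ltngtP l l') => // ll; last by move: D1; rewrite ll; lra.
by have := low2 _ ll; case; lra.
Qed.

(* That only finitely many of the tubes started at 0 are followed is an event A of
   F_{0+} = F_0, so that P(A) <= (1 - p) P(A). *)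
Lemma ae_no_corner_escape i : P.-negligible [set w | [/\ ~ N w, Z 0 w = 0 &
  exists2 del : R, 0 < del & forall u : R, 0 < u < del -> 0 < Z u w i 0]].
Proof.
have [M M0 hM] := pr_tube i; pose c := d (rev_ord i) i 0.
have cM0 : 0 <= `|c| * M by rewrite mulr_ge0// ltW.
have := archi_boundP cM0; set n := Num.bound _ => hn.
have [p /andP[p0 p1] [eta0 eta00 hp]] := hM n.
pose eta k : R := eta0 / k.+1%:R.
have etab k : 0 < eta k <= eta0.
  by rewrite divr_gt0//= ler_pdivrMr// ler_peMr ?ler1n// ltW.
have e0 k : 0 < eta k by have /andP[] := etab k.
have eta_small s : 0 < s -> exists K, forall k, (K <= k)%N -> n%:R * eta k ^+ 2 <= s.
  move=> s0; pose a := n.+1%:R * eta0 ^+ 2 / s.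
  have a0 : 0 <= a by rewrite divr_ge0 ?mulr_ge0 ?exprn_ge0// ltW.
  have := archi_boundP a0; set K := Num.bound _ => hK; exists K => k Kk.
  have k0 : 0 < k.+1%:R :> R by [].
  have : a < k.+1%:R by apply: lt_trans hK _; rewrite ltr_nat.
  rewrite ltr_pdivrMr// => h.
  rewrite expr_div_n mulrA ler_pdivrMr ?exprn_gt0// (le_trans _ (_ : k.+1%:R * s <= _))//.
    apply/ltW/le_lt_trans/h; rewrite ler_wpM2r ?exprn_ge0 ?ler_nat// ltW//.
  by rewrite [X in X <= _]mulrC; apply: ler_wpM2l; [exact: ltW|rewrite expr2 ler_peMl// ler1n].
pose G k := tube_event i M (eta k) n 0.
have FG k : F (n%:R * eta k ^+ 2) (G k).
  by have := tube_event_adapted i M n (lexx 0) (e0 k); rewrite add0r.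
have ne0 k : 0 <= n%:R * eta k ^+ 2 by rewrite mulr_ge0// exprn_ge0// ltW.
have mG k : measurable (G k) := filtration_measurable hF (ne0 k) (FG k).
pose A K := \bigcap_k ~` G (K + k)%N.
have mA K : measurable (A K) by apply: bigcapT_measurable => k; exact: measurableC.
have ndA : nondecreasing_seq A.
  move=> K K' KK; apply/subsetPset => w hw k _.
  by have := hw (K' - K + k)%N I; rewrite addnA subnKC.
have FA : F 0 (\bigcup_K A K).
  (* Dropping finitely many tubes does not change the event, and those from rank [K0] on end before
     s. *)
  apply: (filtration_right_cont hF) => // s s0; have [K0 hK0] := eta_small s s0.
  rewrite (_ : \bigcup_K A K = \bigcup_K A (K0 + K)%N).
    apply: (filtration_bigcup hF); first exact: ltW.
    move=> K; apply: (filtration_countable_inter hF); first exact: ltW.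
    move=> k; apply: (filtration_setC hF); first exact: ltW.
    apply: (filtration_le hF _ (FG _)); rewrite ne0 hK0// -addnA; exact: leq_addr.
  apply/seteqP; split=> w [K _ hK]; last by exists (K0 + K)%N.
  exists K => //; have /subsetPset := ndA _ _ (leq_addl K0 K); exact.
have mU : measurable (\bigcup_K A K) by exact: bigcupT_measurable.
have /pr_negligible : pr (\bigcup_K A K) = 0.
  apply/eqP; rewrite eq_le pr_ge0 andbT.
  have : pr (\bigcup_K A K) <= (1 - p) * pr (\bigcup_K A K).
    apply: pr_bigcup_le => // K.
    apply: (@le_trans _ _ (pr ((\bigcup_K A K) `\` G K))).
      apply: pr_le => //; first exact: measurableD.
      by move=> w hw; split; [exists K|have := hw 0%N I; rewrite addn0].
    have := hp 0 (eta K) _ (lexx 0) (etab K) FA.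
    have := pr_split P mU (mG K); rewrite /G; lra.
  set a := pr _; move=> h; have : p * a <= 0 by lra.
  by rewrite pmulr_rle0.
move=> /(_ mU); apply: negligibleS => w [nw Z0 [del del0 Zpos]].
have del20 : 0 < del / 2 by rewrite divr_gt0.
have [K hK] := eta_small _ del20; exists K => // k _ Gw.
set kk := (K + k)%N in Gw.
have tb := tube_event_tube (lexx 0) (e0 kk) M0 nw Gw.
have st : 0 <= (0 : R) < del / 2 by rewrite lexx.
have zi (u : R) : 0 < u <= del / 2 -> 0 < Z u w i 0.
  by move=> hu; apply: Zpos; lra.
have hn' : Z 0 w i 0 + `|d (rev_ord i) i 0| * (M * eta kk) < n%:R * eta kk.
  by rewrite Z0 mxE add0r mulrA ltr_pM2r.
have [] := tube_exit d1 (e0 kk) (ltW M0) tb (solN nw) st zi hn'.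
by rewrite add0r ltNge hK// leq_addr.
Qed.

Lemma ae_corner_null : P.-negligible [set w | ~ N w /\
  ~ lebesgue_measure.-negligible [set t : R | 0 <= t /\ Z t w = 0]].
Proof.
have [v v0 hv] := inward_halfplane dichotomy.
(* The sign turns running minima of <v, X> into running maxima. *)
pose c i := - v i.
have c_neq0 : exists i, c i != 0 by exists 0; rewrite oppr_eq0 gt_eqF.
apply: negligibleS (ae_running_max_null c_neq0) => w [nw h] h'; apply: h.
apply: negligibleS h' => t [t0 Zt]; split => // s st.
have := corner_running_min d1 v0 hv (solN nw) st Zt.
rewrite /linform -lerN2; congr (_ <= _); rewrite -sumrN; apply: eq_bigr => k _;
  by rewrite mulNr.
Qed.

(** The exceptional events are indexed by faces, rational times and thresholds 1 / (n + 1), hence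
    countably many; the rest is pathwise. *)
Lemma ae_boundary_jitter :
  {ae P, forall w, boundary_jitter (Z^~ w) (Z^~ w \- X^~ w)}.
Proof.
pose E1 (p : 'I_2 * nat) := [set w |
  forall r : R, 0 < r < p.2.+1%:R^-1 -> 0 <= X r w p.1 0 - X 0 w p.1 0].
pose Q2 i (q r del : R) := [set w | ~ N w /\ (exists2 t : R, q <= t < r - del &
      Z q w i 0 + (X t w i 0 - X q w i 0) = 0) /\
    forall u : R, q <= u <= r -> 0 <= Z q w i 0 + (X u w i 0 - X q w i 0)].
pose E2 (p : 'I_2 * rat * rat * nat) : set T :=
  if (0 <= ratr p.1.1.2 :> R) && (ratr p.1.1.2 < ratr p.1.2 :> R) then
  Q2 p.1.1.1 (ratr p.1.1.2) (ratr p.1.2) p.2.+1%:R^-1 else set0.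
pose Q3 i (q : R) := [set w | ~ N w /\ exists2 t : R, q < t &
    Z t w = 0 /\ forall u : R, q <= u < t -> 0 < Z u w i 0].
pose E3 (p : 'I_2 * rat) : set T :=
  if 0 <= ratr p.2 :> R then Q3 p.1 (ratr p.2) else set0.
have n1 : P.-negligible (\bigcup_p E1 p).
  by apply: negligible_countable_bigcup => -[i n]; exact: ae_initial_descent.
have n2 : P.-negligible (\bigcup_p E2 p).
  apply: negligible_countable_bigcup => -[[[i q] r] n]; rewrite /E2 /=.
  case: ifPn => [/andP[q0 qr]|_]; last exact: negligible_set0.
  exact: ae_no_touching.
have n3 : P.-negligible (\bigcup_p E3 p).
  apply: negligible_countable_bigcup => -[i q]; rewrite /E3 /=.
  case: ifPn => [q0|_]; last exact: negligible_set0.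
  exact: ae_no_corner_hit.
have n4 := negligible_countable_bigcup ae_no_corner_escape.
have n5 := ae_corner_null.
apply: negligibleS (negligibleU negN (negligibleU n1 (negligibleU n2
  (negligibleU n3 (negligibleU n4 n5))))) => w hw.
apply: contrapT => hU; apply: hw.
have nw : ~ N w by move=> h; apply: hU; left.
have {n1}h1 i n : ~ E1 (i, n) w by move=> h; apply: hU; right; left; exists (i, n).
have {n2}h2 i q r n : ~ E2 (i, q, r, n) w.
  by move=> h; apply: hU; right; right; left; exists (i, q, r, n).
have {n3}h3 i q : ~ E3 (i, q) w.
  by move=> h; apply: hU; right; right; right; left; exists (i, q).
have {n4}h4 i : ~ [/\ ~ N w, Z 0 w = 0 &
  exists2 del : R, 0 < del & forall u : R, 0 < u < del -> 0 < Z u w i 0].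
  by move=> h; apply: hU; right; right; right; right; left; exists i.
have {n5 hU}h5 : lebesgue_measure.-negligible [set t : R | 0 <= t /\ Z t w = 0].
  by apply: contrapT => h; apply: hU; do 5 right.
have sol := solN nw; have qZ := sp_ge0 sol.
(* Clause (4) at the corner, needed again for clause (3). *)
have hit4 (t : R) i (delta : R) : Z t w = 0 -> 0 < delta < t ->
    exists2 s : R, t - delta < s < t & active (Z s w) = [set i].
  move=> Zt hdel; apply: contrapT => no.
  have t0 : 0 <= t by lra.
  have [t1 ht1 Zt1] : exists2 t1 : R, t - delta < t1 < t & Z t1 w <> 0.
    apply: contrapT => all0.
    have : lebesgue_measure.-negligible (`]t - delta, t[%classic : set R).
      apply: negligibleS h5 => u /=; rewrite in_itv/= => hu; split; first by lra.
      by apply: contrapT => Zu; apply: all0; exists u.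
    move=> /(negligibleP lebesgue_measure (measurable_itv _)) h.
    have := etrans (esym h) (lebesgue_measure_itv `]t - delta, t[).
    rewrite /= lte_fin ifT; last by lra.
    rewrite -EFinD => -[]; lra.
  pose D u := Z u w i 0 + Z u w (rev_ord i) 0.
  have cD : path_continuous D by apply: path_continuousD; exact: sp_cont sol _.
  have D0 u : 0 <= u -> D u = 0 -> Z u w = 0.
    move=> u0 Du; have := qZ u u0 i; have := qZ u u0 (rev_ord i) => zj zi.
    by apply: (@colP2 _ _ _ i); rewrite mxE; move: Du; rewrite /D; lra.
  have Dt1 : 0 < D t1.
    rewrite lt_neqAle addr_ge0 ?andbT; [|by apply: qZ; lra..].
    by rewrite eq_sym; apply/eqP => /(D0 t1)-/(_ (ltac:(lra))).
  have [|del del0 hD] := path_continuous_gt cD _ Dt1; first by lra.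
  (* A rational time q off the corner and just before t1: if face i were not touched between q and
     the next visit of the corner, the event excluded by [h3] would occur. *)
  have : Num.max (t - delta) (t1 - del) < t1 by rewrite gt_max; lra.
  move=> /rat_in_itvoo[q]; rewrite in_itv/= gt_max => /andP[/andP[q1 q2] q3].
  have q0 : 0 <= ratr q :> R by lra.
  have Dq : 0 < D (ratr q) by apply: hD => //; rewrite ltr_norml; lra.
  have [|u [/andP[qu ut] Du] hu] := first_zero (b := t) cD q0.
    exists t; first by rewrite lexx andbT; lra.
    by rewrite /D Zt !mxE addr0.
  apply: (h3 i q); rewrite /E3 /= q0; split => //; exists u.
    rewrite lt_neqAle qu andbT; apply/eqP => h; by move: Dq; rewrite h Du ltxx.
  split; first by apply: D0 => //; lra.
  move=> v hv; have v0 : 0 <= v by lra.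
  rewrite lt_neqAle qZ// andbT eq_sym; apply/eqP => Zi.
  apply: no; exists v; first by lra.
  apply: active_set1 => //; first exact: qZ.
  by have := hu v hv; rewrite /D Zi add0r.
have cX k : path_continuous (fun t => X t w k 0) := sp_cont_in sol k.
have cZ k : path_continuous (fun t => Z t w k 0) := sp_cont sol k.
split.
- move=> t t0 [bZ _] s u stu [c hc].
  have [i Zi] := boundary_quadrant_face (qZ t t0) bZ.
  have hc' (r : R) : Num.max s 0 < r < u -> Z r w i 0 - X r w i 0 = c i 0.
    by move=> /hc <-; rewrite !mxE.
  have := t0; rewrite le_eqVlt => /predU1P[t0'|tpos].
    (* At t = 0 constancy is known on ]0, u[ only; continuity extends it to 0. *)
    subst t; have Z0 : Z 0 w i 0 - X 0 w i 0 = c i 0.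
      apply/eqP; rewrite eq_sym -subr_eq0 -normr_eq0 eq_le normr_ge0 andbT.
      apply/ler_addgt0Pl => e e0; rewrite addr0.
      have cY := path_continuousB (cZ i) (cX i).
      have [del del0 hdel] := cY 0 (lexx 0) e e0.
      pose r := Num.min del u / 2.
      have r0 : 0 < r by rewrite divr_gt0// lt_min del0; lra.
      have [rd ru] : r < del /\ r < u.
        have : Num.min del u <= del by rewrite ge_min lexx.
        have : Num.min del u <= u by rewrite ge_min lexx orbT.
        by rewrite /r; move: r0; rewrite /r; set m := Num.min _ _; lra.
      have := hdel r (ltW r0); rewrite subr0 gtr0_norm// => /(_ rd).
      by rewrite hc' ?max_r ?r0 ?ru//; [move/ltW|lra].
    have u0 : 0 < u by lra.
    have := archi_boundP (ltac:(by rewrite invr_ge0 ltW) : 0 <= u^-1).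
    set n := Num.bound _ => hn; apply: (h1 i n) => r /= /andP[r0 rn].
    have ru : r < u.
      apply: lt_trans rn _; rewrite invf_plt ?posrE//.
      by apply: lt_trans hn _; rewrite ltr_nat.
    have := hc' r; rewrite max_r ?r0 ?ru; last lra.
    by move=> /(_ isT); have := qZ r (ltW r0) i; lra.
  have : Num.max s 0 < t by rewrite gt_max tpos andbT; lra.
  move=> /rat_in_itvoo[q]; rewrite in_itv/= => /andP[sq qt].
  have : t < u by lra.
  move=> /rat_in_itvoo[r]; rewrite in_itv/= => /andP[tr ru].
  have q0 : 0 < ratr q :> R by apply: le_lt_trans sq; rewrite le_max lexx orbT.
  have qr : ratr q < ratr r :> R by lra.
  have rt : 0 < ratr r - t by lra.
  have := archi_boundP (ltac:(by rewrite invr_ge0 ltW) : 0 <= (ratr r - t)^-1).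
  (* Between the rationals q < t < r the pushing is constant, so [Z] is the free path of
     [ae_no_touching]; 1 / (n + 1) fits between t and r. *)
  set n := Num.bound _ => hn; apply: (h2 i q r n); rewrite /E2 /= (ltW q0) qr /=.
  have hY (v : R) : ratr q <= v <= ratr r ->
      Z (ratr q) w i 0 + (X v w i 0 - X (ratr q) w i 0) = Z v w i 0.
    move=> hv; have := hc' v; have := hc' (ratr q).
    rewrite sq (lt_le_trans sq) ?(le_lt_trans _ ru)//; [|lra..].
    by move=> /(_ (ltac:(lra))) + /(_ isT); lra.
  split => //; split.
    exists t; last by rewrite hY//; lra.
    rewrite (ltW qt)/= ltrBrDl -ltrBrDr invf_plt ?posrE//.
    by apply: lt_trans hn _; rewrite ltr_nat.
  by move=> v hv; rewrite hY//; apply: qZ; lra.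
- have S0E : [set t : R | 0 <= t /\ Z t w = 0] =
      [set t : R | 0 <= t /\ Z t w 0 0 = 0] `&` [set t : R | 0 <= t /\ Z t w (rev_ord 0) 0 = 0].
    apply/seteqP; split=> t; first by move=> [t0 /= Zt]; rewrite /= Zt !mxE.
    by move=> [[t0 z0] [_ z1]]; split => //; apply: (@colP2 _ _ _ 0); rewrite mxE.
  have mS0 : measurable [set t : R | 0 <= t /\ Z t w = 0].
    by rewrite S0E; apply: measurableI; exact: path_zeros_measurable.
  transitivity (\int[lebesgue_measure]_(t in `[0%R : R, +oo[)
      (\1_[set t : R | 0 <= t /\ Z t w = 0] t)%:E)%E.
    apply: eq_integral => t; rewrite inE /= in_itv/= andbT => t0.
    congr (_%:E); rewrite !indicE; congr (_%:R).
    have [Zt|Zt] := pselect (Z t w = 0).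
      by rewrite !mem_set// Zt; exact: nonsmooth_bdry0.
    by rewrite !memNset// => [[]|/(nonsmooth_bdry_corner (qZ t t0))].
  rewrite integral_indic//; apply/(negligibleP lebesgue_measure).
    exact: measurableI.
  by apply: negligibleS h5 => t [].
- move=> /(nonsmooth_bdry_corner (qZ 0 (lexx 0))) Z0 i _ delta delta0.
  apply: contrapT => no; apply: (h4 i); split => //; exists delta => // u u0d.
  have u0 : 0 <= u by lra.
  rewrite lt_neqAle qZ// andbT eq_sym; apply/eqP => Zi.
  (* If the touching point is the corner itself, clause (4) at u gives an earlier positive time on
     face i alone. *)
  apply: no; have [Zj|Zj] := eqVneq (Z u w (rev_ord i) 0) 0; last first.
    by exists u => //; apply: active_set1 => //; exact: qZ.
  have Zu : Z u w = 0 by apply: (@colP2 _ _ _ i); rewrite mxE.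
  have [|s su act] := hit4 u i (u / 2) Zu; first by lra.
  by exists s => //; lra.
- move=> t t0 /(nonsmooth_bdry_corner (qZ t (ltW t0))) Zt i _ delta hd.
  exact: hit4.
Qed.

End Reflected.

End DriftedBrownian.

Theorem proposition3p20 (R : realType)
  (disp : measure_display) (T : measurableType disp) (P : probability T R)
  (F : R -> set (set T)) (W : R -> T -> 'cV[R]_2)
  (hF : usual_filtration P F) (hW : brownian_motion P F W)
  (d : 'I_2 -> 'cV[R]_2) (hd : forall i, dotv (d i) (basisv i) = 1)
  (hB : set_B_condition d) (hpi : projection_condition d)
  (x b : 'cV[R]_2) (sigma : 'M[R]_2)
  (hx : quadrant x) (hsigma : sigma *m sigma^T \in unitmx)
  (X Z : R -> T -> 'cV[R]_2)
  (hX : forall t w, 0 <= t -> X t w = x + t *: b + sigma *m W t w)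
  (hZ : {ae P, forall w, skorokhod_map d (X^~ w) (Z^~ w)}) :
  {ae P, forall w, boundary_jitter (Z^~ w) (Z^~ w \- X^~ w)}.
Proof.
have d1 i : d i i 0 = 1 by rewrite -dotv_basisv hd.
(* The exceptional set is the complement of the event in [hZ]; continuity of [X] off it is part of
   solving the Skorokhod problem. *)
have solN w : ~ (~` [set w | skorokhod_map d (X^~ w) (Z^~ w)]) w ->
    sp_solution d (X^~ w) (Z^~ w).
  by move=> /contrapT; exact: skorokhod_map_solution.
have contX w : ~ (~` [set w | skorokhod_map d (X^~ w) (Z^~ w)]) w ->
    forall i, path_continuous (fun t => X t w i 0).
  by move=> /solN; exact: sp_cont_in.
exact: (ae_boundary_jitter hF hW hsigma hX hZ contX d1
  (reflection_dichotomy hd hB hpi) solN).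
Qed.
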